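(* Let $(X,d)$ be a compact metric space and $f:X\to X$ a topologically mixing homeomorphism with the exponential shadowing property, and let $A:X\to GL(m,\mathbb{R})$ be a Hölder continuous matrix function. Then either (1) all ergodic $f$-invariant measures have the same MLE with respect to $A$; or (2) $h_{top}(f, MLI(A,f))=h^P_{top}(f, MLI(A,f))=h_{top}(f)$, and $$h^B_{top}(f, MLI(A,f))\ \ge\ \sup\{h_\mu(f)\ :\ \mu\in\mathcal{M}^e_f(X),\ \mu\text{ is not Lyapunov minimizing for } A\}.$$
   Context: Cocycle: $A(x,n)=A(f^{n-1}x)\cdots A(x)$. MLE: $\chi_{max}(A,x)=\lim_n\frac1n\log\|A(x,n)\|$ when it exists; $MLI(A,f)$ is the set of $x$ where it does not exist; $\chi_{max}(A,\mu)=\int\chi_{max}(A,x)d\mu$ for $\mu\in\mathcal{M}_f(X)$. An ergodic $\mu$ is Lyapunov minimizing for $A$ if $\chi_{max}(A,\mu)=\inf_{\nu\in\mathcal{M}_f(X)}\chi_{max}(A,\nu)$. $A$ Hölder: $\|A(x)-A(y)\|\le Cd(x,y)^\alpha$. Exponential shadowing: for $\lambda>0$, $f$ has $\lambda$-exponential shadowing if for every $\tau>0$ there is $\delta>0$ such that for every sequence $\{x_i,n_i\}_{i\in\mathbb{Z}}$ with $x_i\in X$, $n_i\in\mathbb{N}$, $d(f^{n_i}x_i,x_{i+1})<\delta$ for all $i$, there is $x\in X$ with $d(f^{c_i+j}x,f^jx_i)<\tau e^{-\lambda\min\{j,n_i-j\}}$ for all $0\le j\le n_i-1$ and all $i\in\mathbb{Z}$,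 where $c_0=0$, $c_i=\sum_{j=0}^{i-1}n_j$ for $i>0$, $c_i=-\sum_{j=i}^{-1}n_j$ for $i<0$. $f$ has the exponential shadowing property if it has $\lambda$-exponential shadowing for some $\lambda>0$. Entropies: $d_n(x,y)=\max_{0\le i\le n-1}d(f^ix,f^iy)$, $B_n(x,\varepsilon)=\{y:d_n(x,y)<\varepsilon\}$, $\overline{B}_n(x,\varepsilon)=\{y:d_n(x,y)\le\varepsilon\}$. For compact $E$, $h_{top}(f,E)=\lim_{\varepsilon\to0}\limsup_n\frac1n\log s_n(E,\varepsilon)$ ($s_n$ = maximal cardinality of a subset of $E$ with pairwise $d_n$-distance $>\varepsilon$); for general $Y$, $h_{top}(f,Y)=\sup$ over compact $E\subseteq Y$. Bowen Hausdorff entropy: $C(E;t,n,\sigma)=\inf\sum e^{-tu}$ over finite/countable covers of $E$ by $B_u(x,\sigma)$, $u\ge n$; $C(E;t,\sigma)=\lim_nC(E;t,n,\sigma)$; $h^B_{top}(f,E)=\lim_{\sigma\to0}\inf\{t:C(E;t,\sigma)=0\}$. Packing entropy: $P^s_{N,\varepsilon}(E)=\sup\sum_ie^{-sn_i}$ over finite/countable pairwise disjoint families $\{\overline{B}_{n_i}(x_i,\varepsilon)\}$, $x_i\in E$, $n_i\ge N$; $P^s_\varepsilon=\lim_NP^s_{N,\varepsilon}$; $\mathcal{P}^s_\varepsilon(E)=\inf\{\sum_iP^s_\varepsilon(E_i):\bigcup E_i\supseteq E\}$; $h^P_{top}(f,E)=\lim_{\varepsilon\to0}$ of the critical $s$ where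 $\mathcal{P}^s_\varepsilon(E)$ jumps from $\infty$ to $0$. *)

(* Defs.v *)
From mathcomp Require Import all_boot all_algebra.
From mathcomp Require Import all_classical all_reals all_analysis.
Set Implicit Arguments. Unset Strict Implicit. Unset Printing Implicit Defensive.
Import GRing.Theory Num.Theory numFieldNormedType.Exports.
Local Open Scope classical_set_scope.
Local Open Scope ring_scope.

Section Defs.
Context {R : realType} {X : Type}.
Implicit Types (d : X -> X -> R) (f g : X -> X).

Definition is_metric d :=
  [/\ forall x y, d x y = 0 <-> x = y,
      forall x y, d x y = d y x &
      forall x y z, d x z <= d x y + d y z].

Definition dball d (x : X) (r : R) : set X := [set y | d x y < r].

Definition dopen d (U : set X) :=
  forall x, U x -> exists2 r : R, 0 < r & dball d x r `<=` U.

Definition dcompact d (E : set X) :=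
  forall (I : Type) (U : I -> set X), (forall i, dopen d (U i)) ->
    E `<=` \bigcup_(i in setT) U i ->
    exists (k : nat) (h : 'I_k -> I), E `<=` \bigcup_(j in setT) U (h j).

Definition dcontinuous d f :=
  forall x (e : R), 0 < e -> exists2 r : R, 0 < r &
    forall y, d x y < r -> d (f x) (f y) < e.

Definition homeo d f g :=
  [/\ cancel f g, cancel g f, dcontinuous d f & dcontinuous d g].

Definition top_mixing d f :=
  forall U V : set X, dopen d U -> dopen d V -> U !=set0 -> V !=set0 ->
    exists N : nat, forall n, (N <= n)%N -> (iter n f @` U) `&` V !=set0.

Definition zit f g (k : int) : X -> X :=
  match k with Posz n => iter n f | Negz n => iter n.+1 g end.

Definition ctime (n : int -> nat) (i : int) : int :=
  match i with
  | Posz k => (\sum_(j < k) n (Posz j))%N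
  | Negz k => - (\sum_(j < k.+1) n (- (Posz j.+1)))%N%:Z
  end.

Definition exp_shadowing_lambda d f g (lam : R) :=
  forall tau : R, 0 < tau -> exists2 delta : R, 0 < delta &
    forall (x : int -> X) (n : int -> nat),
      (forall i, (0 < n i)%N) ->
      (forall i, d (iter (n i) f (x i)) (x (i + 1)) < delta) ->
      exists z : X, forall (i : int) (j : nat), (j < n i)%N ->
        d (zit f g (ctime n i + j%:Z) z) (iter j f (x i))
          < tau * expR (- lam * (minn j (n i - j))%:R).

Definition exp_shadowing d f g := exists2 lam : R, 0 < lam & exp_shadowing_lambda d f g lam.

Definition dn d f (n : nat) (x y : X) : R :=
  \big[Num.max/0]_(i < n) d (iter i f x) (iter i f y).

Definition bowen_ball d f n x (e : R) : set X := [set y | dn d f n x y < e].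
Definition bowen_cball d f n x (e : R) : set X := [set y | dn d f n x y <= e].

Definition elog (z : \bar R) : \bar R :=
  match z with
  | r%:E => (ln r)%:E
  | +oo%E => +oo%E
  | -oo%E => -oo%E
  end.

Definition sep_num d f (E : set X) n (e : R) : \bar R :=
  ereal_sup [set (k%:R)%:E | k in [set k : nat | exists g : 'I_k -> X,
     (forall i, E (g i)) /\ (forall i j, i != j -> e < dn d f n (g i) (g j))]].

(* h_top(f,E) for compact E: lim_{e->0} limsup_n 1/n log s_n(E,e); the quantity is
   nonincreasing in e, so the limit is the supremum over e > 0 *)
Definition htop_cpt d f (E : set X) : \bar R :=
  ereal_sup [set limn_esup (fun n : nat => ((n%:R)^-1)%:E * elog (sep_num d f E n e))%E
            | e in [set e : R | 0 < e]].

Definition htop d f (Y : set X) : \bar R :=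
  ereal_sup [set htop_cpt d f E | E in [set E | E `<=` Y /\ dcompact d E]].

(* a finite or countable family of Bowen balls B_u(x, s) is encoded by
   c : nat -> option (X * nat), with c i = Some (x, u) *)
Definition bowenC d f (E : set X) (t : R) (n : nat) (s : R) : \bar R :=
  ereal_inf [set (\sum_(i <oo) (match c i with
                                 | Some xu => (expR (- t * (xu.2)%:R))%:E
                                 | None => 0%E end))%E
     | c in [set c : nat -> option (X * nat) |
          (forall i xu, c i = Some xu -> (n <= xu.2)%N) /\
          E `<=` \bigcup_(i in setT)
                   (match c i with Some xu => bowen_ball d f xu.2 xu.1 s
                                 | None => set0 end)]].

Definition bowenC_lim d f E t s : \bar R := limn (fun n => bowenC d f E t n s).

Definition hB d f (E : set X) : \bar R :=
  ereal_sup [set ereal_inf [set t%:E | t in [set t : R | 0 <= t /\ bowenC_lim d f E t s = 0%E]]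
            | s in [set s : R | 0 < s]].

Definition packP_N d f (E : set X) (s : R) (N : nat) (e : R) : \bar R :=
  ereal_sup [set (\sum_(i <oo) (match c i with
                                 | Some xu => (expR (- s * (xu.2)%:R))%:E
                                 | None => 0%E end))%E
     | c in [set c : nat -> option (X * nat) |
          (forall i xu, c i = Some xu -> E xu.1 /\ (N <= xu.2)%N) /\
          (forall i j xu yv, i != j -> c i = Some xu -> c j = Some yv ->
              bowen_cball d f xu.2 xu.1 e `&` bowen_cball d f yv.2 yv.1 e = set0)]].

Definition packP d f E s e : \bar R := limn (fun N => packP_N d f E s N e).

Definition packPP d f (E : set X) (s e : R) : \bar R :=
  ereal_inf [set (\sum_(i <oo) packP d f (F i) s e)%E
     | F in [set F : nat -> set X | E `<=` \bigcup_(i in setT) F i]].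

Definition hP d f (E : set X) : \bar R :=
  ereal_sup [set ereal_inf [set s%:E | s in [set s : R | 0 <= s /\ packPP d f E s e = 0%E]]
            | e in [set e : R | 0 < e]].

End Defs.

Section Matrices.
Context {R : realType}.

Definition vnorm m (v : 'cV[R]_m) : R := Num.sqrt (\sum_(i < m) v i ord0 ^+ 2).

Definition opnorm m (M : 'M[R]_m) : R :=
  sup [set vnorm (M *m v) | v in [set v : 'cV[R]_m | vnorm v = 1]].

Context {X : Type}.

Definition holder (d : X -> X -> R) m (A : X -> 'M[R]_m) :=
  exists C alpha : R, 0 < alpha /\
    forall x y, opnorm (A x - A y) <= C * d x y `^ alpha.

Fixpoint cocycle m (A : X -> 'M[R]_m) (f : X -> X) (n : nat) (x : X) : 'M[R]_m :=
  match n with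
  | 0 => 1%:M
  | k.+1 => A (iter k f x) *m cocycle A f k x
  end.

Definition lyap_seq m (A : X -> 'M[R]_m) f (x : X) (n : nat) : R :=
  (n%:R)^-1 * ln (opnorm (cocycle A f n x)).

Definition MLI m (A : X -> 'M[R]_m) f : set X :=
  [set x | ~ cvgn (lyap_seq A f x)].

(* chi_max(A,x); equals the limit wherever it exists *)
Definition chi_pt m (A : X -> 'M[R]_m) f (x : X) : \bar R :=
  limn_esup (fun n => (lyap_seq A f x n)%:E).
End Matrices.

Section Measures.
Context {R : realType} {dsp : measure_display} {X : measurableType dsp}.
Local Open Scope ereal_scope.

Definition invariant (f : X -> X) (mu : probability X R) :=
  forall A : set X, measurable A -> mu (f @^-1` A) = mu A.

Definition ergodic (f : X -> X) (mu : probability X R) :=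
  invariant f mu /\
  forall A : set X, measurable A -> f @^-1` A = A -> mu A = 0 \/ mu A = 1.

Definition chi_mu m (A : X -> 'M[R]_m) f (mu : probability X R) : \bar R :=
  \int[mu]_x chi_pt A f x.

Definition lyap_minimizing m (A : X -> 'M[R]_m) f (mu : probability X R) :=
  ergodic f mu /\
  chi_mu A f mu = ereal_inf [set chi_mu A f nu | nu in [set nu | invariant f nu]].

Definition meas_partition k (P : 'I_k -> set X) :=
  [/\ forall i, measurable (P i),
      forall i j, i != j -> P i `&` P j = set0 &
      \bigcup_(i in setT) P i = setT].

Definition phiH (t : R) : R := (- (t * ln t))%R.

Definition Hjoin (f : X -> X) (mu : probability X R) k (P : 'I_k -> set X) (n : nat) : R :=
  (\sum_(w : {ffun 'I_n -> 'I_k})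
     phiH (fine (mu (\bigcap_(i in [set i : 'I_n | True]) (iter i f @^-1` P (w i))))))%R.

Definition h_part f mu k (P : 'I_k -> set X) : \bar R :=
  limn_esup (fun n => (((n%:R)^-1 * Hjoin f mu P n)%R)%:E).

Definition h_mu (f : X -> X) (mu : probability X R) : \bar R :=
  ereal_sup [set h_part f mu (projT2 P) | P in
     [set P : {k : nat & 'I_k -> set X} | meas_partition (projT2 P)]].
End Measures.

(* Main.v *)
(* Write L_n(x) = ln ||A(x,n)||. If two ergodic measures have different exponents, choose an
   ergodic mu and an invariant nu with chi(nu) < chi(mu).

   Two kinds of orbit segments are available. For nu there are arbitrarily long segments along
   which the norms of the blocks of a fixed length multiply to at most e^((chi(nu)+e)n); by
   submultiplicativity this bound survives a uniformly small perturbation of the orbit. For mu,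
   most points x have the property that every orbit that is exponentially close to the first n
   iterates of x satisfies |L_n - chi(mu) n| <= e n; this replaces Oseledets' theorem and follows
   by telescoping over finitely many windows of length proportional to n.

   Topological mixing and exponential shadowing glue arbitrary sequences of segments, with gaps
   of a fixed length. A point whose orbit is glued from mu-segments and nu-segments in such a way
   that the average growth oscillates lies in MLI. Let h be a lower bound of the entropy.
   - For h_top and h^P, insert (n,e)-separated sets of cardinality at least e^(hn) for enormous n
     infinitely often between the segments that create the oscillation.
   - For h^B, the mu-segments themselves carry the entropy: within the set of mu-good points there
     is a tree with e^(hb) pairwise separated children at each of M levels of length b. The
     nu-segments occupy a small proportion of time, just enough to spoil convergence. The growth
     rate is positive at all time scales, whence a lower bound for covers by Bowen balls of
     arbitrary lengths. *)
Require Import Defs.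
From mathcomp Require Import all_boot all_order all_algebra.
From mathcomp Require Import all_classical all_reals all_analysis.
From mathcomp Require Import measurable_realfun.
From mathcomp Require Import ring lra zify.
Set Implicit Arguments. Unset Strict Implicit. Unset Printing Implicit Defensive.
Import Order.TTheory GRing.Theory Num.Theory numFieldNormedType.Exports.
Local Open Scope classical_set_scope.
Local Open Scope ring_scope.

(** * Operator norms and products of matrices *)

(** An upper bound on the growth of norms survives uniform perturbations, a lower bound need not:
    hence the asymmetry between the two kinds of segments, and the role of the exponential rate,
    which makes the shadowing error in the middle of a long segment smaller than every product of
    norms involved. Convergence in probability is enough, since segments are selected one length at
    a time. For the exponent, a pointwise limsup, the upper half is then immediate, and the lower
    half follows by comparing integrals. For entropy, let [r] be the critical rate of the number of
    names covering most of the measure. A rate slightly above [r] bounds the children of a node, a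
    rate slightly below bounds the leaves from below; together they force nearly full branching on
    every level. For h^B the obstacle is that a Bowen ball may end at any time, also inside a tree.
    A choice is made over a whole block, so blocks must be short compared with the elapsed time:
    their proportion is about [1 / J]. The same proportion is given to the nu-segments, and the
    entropy lost is a factor [(1 + 1 / J) (1 + 3 / J)], which tends to one. *)

Ltac nlia := repeat match goal with
  | H : is_true (@Order.le _ _ _ _) |- _ => clear H
  | H : is_true (@Order.lt _ _ _ _) |- _ => clear H end; lia.

Section Norms.
Context {R : realType} {m : nat}.
Implicit Types (u v : 'cV[R]_m) (M N : 'M[R]_m).

Lemma vnorm_ge0 v : 0 <= vnorm v.
Proof. exact: sqrtr_ge0. Qed.

Lemma vnorm_sqr v : vnorm v ^+ 2 = \sum_(i < m) v i ord0 ^+ 2.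
Proof. by rewrite /vnorm sqr_sqrtr//; apply: sumr_ge0 => i _; exact: sqr_ge0. Qed.

Lemma vnormZ (c : R) v : vnorm (c *: v) = `|c| * vnorm v.
Proof.
rewrite /vnorm -sqrtr_sqr -sqrtrM ?sqr_ge0// mulr_sumr.
by congr Num.sqrt; apply: eq_bigr => i _; rewrite mxE exprMn.
Qed.

Lemma le_coord_vnorm v i : `|v i ord0| <= vnorm v.
Proof.
rewrite -sqrtr_sqr ler_wsqrtr// (bigD1 i)//= lerDl.
by apply: sumr_ge0 => j _; exact: sqr_ge0.
Qed.

Lemma vnorm_eq0 v : vnorm v = 0 -> v = 0.
Proof.
move=> v0; apply/matrixP => i j; rewrite !ord1 mxE; apply/eqP.
by rewrite -normr_le0 -v0 le_coord_vnorm.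
Qed.

Lemma vnorm0 : vnorm (0 : 'cV[R]_m) = 0.
Proof. by rewrite -(scale0r (0 : 'cV[R]_m)) vnormZ normr0 mul0r. Qed.

Lemma cauchy_schwarz u v :
  \sum_(i < m) u i ord0 * v i ord0 <= vnorm u * vnorm v.
Proof.
have [/eqP v0|v0] := boolP (vnorm v == 0).
  rewrite v0 mulr0 big1// => i _.
  by rewrite (vnorm_eq0 v0) mxE mulr0.
set S := \sum_(i < m) _.
have V0 : 0 < vnorm v by rewrite lt0r v0 vnorm_ge0.
(* Expanded, this sum of squares is [|v|^2 (|v|^2 |u|^2 - S^2)]. *)
have : 0 <= \sum_(i < m) (vnorm v ^+ 2 * u i ord0 - S * v i ord0) ^+ 2.
  by apply: sumr_ge0 => i _; exact: sqr_ge0.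
under eq_bigr => i _ do rewrite sqrrB !exprMn.
rewrite big_split/= sumrB -!mulr_sumr -!vnorm_sqr.
have -> : \sum_(i < m) vnorm v ^+ 2 * u i ord0 * (S * v i ord0) *+ 2 =
   vnorm v ^+ 2 * S ^+ 2 * 2.
  rewrite [in RHS]expr2 /S -!mulrA mulr_suml mulr_sumr.
  rewrite [RHS]mulr_sumr; apply: eq_bigr => i _; rewrite -/S.
  by rewrite -mulr_natr; ring.
move=> h.
have : 0 <= vnorm v ^+ 2 * ((vnorm v * vnorm u) ^+ 2 - S ^+ 2).
  by move: h; rewrite exprMn; nra.
rewrite pmulr_rge0 ?exprn_gt0// subr_ge0 => h2.
rewrite mulrC; have [S0|S0] := leP 0 S.
  by move: h2; rewrite ler_sqr// nnegrE mulr_ge0 ?vnorm_ge0.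
by rewrite (le_trans (ltW S0))// mulr_ge0 ?vnorm_ge0.
Qed.

Lemma vnormD u v : vnorm (u + v) <= vnorm u + vnorm v.
Proof.
rewrite -ler_sqr ?nnegrE ?addr_ge0 ?vnorm_ge0// sqrrD !vnorm_sqr.
under eq_bigr => i _ do rewrite mxE sqrrD.
rewrite !big_split/= lerD2r lerD2l.
by rewrite mulr2n lerD// cauchy_schwarz.
Qed.

Lemma vnormN v : vnorm (- v) = vnorm v.
Proof. by rewrite -scaleN1r vnormZ normrN1 mul1r. Qed.

Lemma vnorm_sum (I : Type) (r : seq I) (F : I -> 'cV[R]_m) :
  vnorm (\sum_(i <- r) F i) <= \sum_(i <- r) vnorm (F i).
Proof.
elim/big_rec2 : _ => [|i y x _ h]; first by rewrite vnorm0.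
by rewrite (le_trans (vnormD _ _))// lerD2l.
Qed.

Lemma mulmx_bounded M : exists2 C : R, 0 <= C &
  forall v, vnorm (M *m v) <= C * vnorm v.
Proof.
exists (\sum_(j < m) vnorm (col j M)).
  by apply: sumr_ge0 => i _; exact: vnorm_ge0.
move=> v.
have -> : M *m v = \sum_(j < m) v j ord0 *: col j M.
  apply/matrixP => i k; rewrite !ord1 mxE summxE.
  by apply: eq_bigr => j _; rewrite !mxE mulrC.
rewrite (le_trans (vnorm_sum _ _))// mulr_suml ler_sum// => j _.
by rewrite vnormZ mulrC ler_wpM2l ?vnorm_ge0// le_coord_vnorm.
Qed.

Lemma opnorm_ubound M v : vnorm v = 1 -> vnorm (M *m v) <= opnorm M.
Proof.
move=> v1; apply: ub_le_sup; last by exists v.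
have [C C0 H] := mulmx_bounded M.
by exists C => _ [w /= w1 <-]; rewrite (le_trans (H _))// w1 mulr1.
Qed.

Lemma opnorm_ge0 M : 0 <= opnorm M.
Proof.
have [[v v1]|nv] := pselect (exists v : 'cV[R]_m, vnorm v = 1).
  by rewrite (le_trans _ (opnorm_ubound M v1))// vnorm_ge0.
(* Without unit vectors, that is for [m = 0], the supremum of the empty set is [0]. *)
rewrite /opnorm sup_out// => -[[x [v v1 _]] _].
by apply: nv; exists v.
Qed.

Lemma le_opnorm M v : vnorm (M *m v) <= opnorm M * vnorm v.
Proof.
have [/eqP v0|v0] := boolP (vnorm v == 0).
  by rewrite (vnorm_eq0 v0) mulmx0 vnorm0 mulr0.
have V0 : 0 < vnorm v by rewrite lt0r v0 vnorm_ge0.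
have h : vnorm ((vnorm v)^-1 *: v) = 1.
  by rewrite vnormZ ger0_norm ?invr_ge0 ?vnorm_ge0// mulVf.
have := opnorm_ubound M h.
by rewrite -scalemxAr vnormZ ger0_norm ?invr_ge0 ?vnorm_ge0// mulrC ler_pdivrMr.
Qed.

Lemma opnorm_le M (c : R) : 0 <= c ->
  (forall v, vnorm (M *m v) <= c * vnorm v) -> opnorm M <= c.
Proof.
move=> c0 H.
have [[v v1]|nv] := pselect (exists v : 'cV[R]_m, vnorm v = 1).
  apply: ge_sup; first by exists (vnorm (M *m v)), v.
  by move=> _ [w /= w1 <-]; rewrite (le_trans (H _))// w1 mulr1.
rewrite /opnorm sup_out// => -[[x [v v1 _]] _].
by apply: nv; exists v.
Qed.

Lemma opnormD M N : opnorm (M + N) <= opnorm M + opnorm N.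
Proof.
apply: opnorm_le => [|v]; first by rewrite addr_ge0 ?opnorm_ge0.
by rewrite mulmxDl (le_trans (vnormD _ _))// mulrDl lerD ?le_opnorm.
Qed.

Lemma opnormN M : opnorm (- M) = opnorm M.
Proof.
suff h N : opnorm (- N) <= opnorm N.
  by apply/eqP; rewrite eq_le h; have := h (- M); rewrite opprK.
apply: opnorm_le => [|v]; first exact: opnorm_ge0.
by rewrite mulNmx vnormN le_opnorm.
Qed.

Lemma opnormB M N : opnorm (M - N) = opnorm (N - M).
Proof. by rewrite -opnormN opprB. Qed.

Lemma opnormM M N : opnorm (M *m N) <= opnorm M * opnorm N.
Proof.
apply: opnorm_le => [|v]; first by rewrite mulr_ge0 ?opnorm_ge0.
rewrite -mulmxA (le_trans (le_opnorm _ _))// -mulrA ler_wpM2l ?opnorm_ge0//.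
exact: le_opnorm.
Qed.

Lemma opnorm1_le : opnorm (1%:M : 'M[R]_m) <= 1.
Proof. by apply: opnorm_le => // v; rewrite mul1mx mul1r. Qed.

Lemma opnorm_subr_le M N : opnorm M <= opnorm N + opnorm (M - N).
Proof. by rewrite (le_trans _ (opnormD _ _))// addrC subrK. Qed.

(** For invertible [M] this bounds the norm of the inverse by [c]; written without the inverse, it
    passes directly to products and to nearby matrices. *)
Definition expands (c : R) M := forall v, vnorm v <= c * vnorm (M *m v).

Lemma expands_unit M : M \in unitmx -> expands (opnorm (invmx M)) M.
Proof. by move=> Mu v; rewrite -{1}(mulKmx Mu v) le_opnorm. Qed.

Lemma expandsM (c c' : R) M N : 0 <= c' ->
  expands c M -> expands c' N -> expands (c' * c) (M *m N).
Proof.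
move=> c0 hM hN v; rewrite (le_trans (hN v))// -mulrA ler_wpM2l//.
by rewrite -mulmxA hM.
Qed.

Lemma opnorm_mull (c : R) M N : 0 <= c -> expands c M ->
  opnorm N <= c * opnorm (M *m N).
Proof.
move=> c0 hM; apply: opnorm_le => [|v]; first by rewrite mulr_ge0 ?opnorm_ge0.
rewrite (le_trans (hM _))// -mulrA.
by rewrite ler_wpM2l// mulmxA le_opnorm.
Qed.

Lemma opnorm_mulr (c : R) M N : 0 <= c -> N \in unitmx -> expands c N ->
  opnorm M <= opnorm (M *m N) * c.
Proof.
move=> c0 Nu hN; apply: opnorm_le => [|v]; first by rewrite mulr_ge0 ?opnorm_ge0.
have -> : M *m v = M *m N *m (invmx N *m v) by rewrite -mulmxA mulKVmx.
rewrite (le_trans (le_opnorm _ _))// -mulrA.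
by rewrite ler_wpM2l ?opnorm_ge0// (le_trans (hN _))// mulKVmx.
Qed.

Lemma opnorm_gt0 M : (0 < m)%N -> M \in unitmx -> 0 < opnorm M.
Proof.
move=> m0 Mu; rewrite lt0r opnorm_ge0 andbT; apply/negP => /eqP M0.
pose v : 'cV[R]_m := const_mx 1.
have /vnorm_eq0 : vnorm (M *m v) = 0.
  apply/eqP; rewrite eq_le vnorm_ge0 andbT.
  by rewrite (le_trans (le_opnorm _ _))// M0 mul0r.
move=> /(congr1 (fun u => invmx M *m u)); rewrite mulKmx// mulmx0.
move=> /matrixP/(_ (Ordinal m0) ord0); rewrite !mxE => /eqP.
by rewrite oner_eq0.
Qed.

Fixpoint mprod (F : nat -> 'M[R]_m) (n : nat) : 'M[R]_m :=
  if n is k.+1 then F k *m mprod F k else 1%:M.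

Lemma mprodD F n k : mprod F (n + k) = mprod (fun i => F (n + i)%N) k *m mprod F n.
Proof.
elim: k => [|k IH]; first by rewrite addn0 mul1mx.
by rewrite addnS /= IH mulmxA.
Qed.

Lemma opnorm_mprod F n (u : nat -> R) : (forall i, (i < n)%N -> opnorm (F i) <= u i) ->
  opnorm (mprod F n) <= \prod_(i < n) u i.
Proof.
elim: n => [|n IH] H; first by rewrite big_ord0 opnorm1_le.
rewrite big_ord_recr/= mulrC (le_trans (opnormM _ _))//.
by rewrite ler_pM ?opnorm_ge0// ?H// IH// => i ni; rewrite H// ltnW.
Qed.

Lemma opnorm_mprod_exp F n (u : R) : (forall i, (i < n)%N -> opnorm (F i) <= u) ->
  opnorm (mprod F n) <= u ^+ n.
Proof.
by move=> /(@opnorm_mprod F n (fun=> u)); rewrite prodr_const card_ord.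
Qed.

(** Telescoping: replacing one factor of [F] by one of [G] costs [u ^+ n * e], because the error is
    measured relative to the common bound [u] of the factors. *)
Lemma mprod_perturb F G n (u e : R) : 0 <= u -> 0 <= e ->
  (forall i, (i < n)%N -> opnorm (F i) <= u) ->
  (forall i, (i < n)%N -> opnorm (G i) <= u) ->
  (forall i, (i < n)%N -> opnorm (F i - G i) <= u * e) ->
  opnorm (mprod F n - mprod G n) <= n%:R * u ^+ n * e.
Proof.
move=> u0 e0; elim: n => [|n IH] HF HG HD.
  by rewrite !mul0r subrr; apply: opnorm_le => // v; rewrite mul0mx vnorm0 mul0r.
rewrite /=; have -> : F n *m mprod F n - G n *m mprod G n =
   F n *m (mprod F n - mprod G n) + (F n - G n) *m mprod G n.
  by rewrite mulmxBr mulmxBl addrA subrK.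
rewrite (le_trans (opnormD _ _))//.
have -> : n.+1%:R * u ^+ n.+1 * e = u * (n%:R * u ^+ n * e) + u * e * u ^+ n.
  by rewrite -natr1 exprS; ring.
have mono (H : nat -> 'M[R]_m) (v : R) : (forall i, (i < n.+1)%N -> opnorm (H i) <= v) ->
  (forall i, (i < n)%N -> opnorm (H i) <= v).
  by move=> h i ni; apply: h; exact: ltnW.
apply: lerD; apply: (le_trans (opnormM _ _)).
  apply: ler_pM (opnorm_ge0 _) (opnorm_ge0 _) (HF n (ltnSn n)) _.
  by apply: IH; [exact: mono|exact: mono|move=> i ni; apply: HD; exact: ltnW].
apply: ler_pM (opnorm_ge0 _) (opnorm_ge0 _) (HD n (ltnSn n)) _.
by apply: opnorm_mprod_exp; exact: mono.
Qed.

End Norms.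

(** * Compact metric spaces and gluing of orbit segments *)

Section Metric.
Context {R : realType} {X : Type} (d : X -> X -> R).
Context (dm : is_metric d).

Lemma dxx x : d x x = 0.
Proof. by have [h _ _] := dm; apply/h. Qed.

Lemma dsym x y : d x y = d y x.
Proof. by have [_ h _] := dm. Qed.

Lemma dtri y x z : d x z <= d x y + d y z.
Proof. by have [_ _ h] := dm. Qed.

Lemma d_ge0 x y : 0 <= d x y.
Proof. by have := dtri y x x; rewrite dxx (dsym y x); lra. Qed.

Definition dclosed (F : set X) := dopen d (~` F).

Lemma dopen_ball x r : dopen d (dball d x r).
Proof.
move=> y xy; exists (r - d x y) => [|z]; first by rewrite subr_gt0.
by rewrite /dball/= => yz; have := dtri y x z; move: xy; rewrite /dball/=; lra.
Qed.

Lemma dopen_bigcup I (U : I -> set X) :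
  (forall i, dopen d (U i)) -> dopen d (\bigcup_(i in setT) U i).
Proof.
by move=> oU x [i _ /(oU i)[r r0 h]]; exists r => // y /h; exists i.
Qed.

Lemma dclosed_bigcap I (F : I -> set X) :
  (forall i, dclosed (F i)) -> dclosed (\bigcap_(i in setT) F i).
Proof.
by move=> cF; rewrite /dclosed setC_bigcap; exact: dopen_bigcup.
Qed.

Lemma dclosedU E F : dclosed E -> dclosed F -> dclosed (E `|` F).
Proof.
move=> cE cF x /not_orP[/cE[r r0 hr] /cF[s s0 hs]].
exists (Num.min r s) => [|y]; first by rewrite lt_min r0.
by rewrite /dball/= lt_min => /andP[/hr ? /hs ?] [].
Qed.

Lemma dclosed_fin (T : finType) (F : T -> set X) :
  (forall t, dclosed (F t)) -> dclosed [set p | exists t, F t p].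
Proof.
move=> cF.
suff h (s : seq T) : dclosed [set p | exists2 t, t \in s & F t p].
  have := h (enum T); congr dclosed; apply/seteqP; split => p /=.
    by move=> [t _ ?]; exists t.
  by move=> [t ?]; exists t => //; rewrite mem_enum.
elim: s => [|t s IH]; first by move=> x _; exists 1 => // y _ [].
have := dclosedU (cF t) IH; congr dclosed; apply/seteqP; split => p /=.
  by move=> [?|[t' ? ?]]; [exists t; rewrite ?mem_head|exists t' => //; rewrite inE orbC; apply/orP; left].
move=> [t']; rewrite inE => /predU1P[-> ?|? ?]; [by left|by right; exists t'].
Qed.

Lemma dopenI U V : dopen d U -> dopen d V -> dopen d (U `&` V).
Proof.
move=> oU oV x [/oU[r r0 hr] /oV[s s0 hs]].
exists (Num.min r s) => [|y]; first by rewrite lt_min r0.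
by rewrite /dball/= lt_min => /andP[/hr ? /hs ?].
Qed.

Lemma dcontinuous_iter f n : dcontinuous d f -> dcontinuous d (iter n f).
Proof.
move=> cf; elim: n => [|n IH] x e e0; first by exists e.
have [r r0 hr] := cf (iter n f x) e e0.
have [s s0 hs] := IH x r r0.
by exists s => // y /hs/hr.
Qed.

Lemma dclosed_le_comp f x e : dcontinuous d f -> dclosed [set p | d (f p) x <= e].
Proof.
move=> cf p /= /negP; rewrite -ltNge => ep.
have [r r0 hr] := cf p (d (f p) x - e) ltac:(lra).
exists r => // q /hr h /= hq.
by have := dtri (f q) (f p) x; lra.
Qed.

Context (cX : dcompact d [set: X]).

Lemma dclosed_compact E : dclosed E -> dcompact d E.
Proof.
move=> cE J U oU EU.
pose V (o : option J) := if o is Some i then U i else ~` E.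
have oV o : dopen d (V o) by case: o => [i|]; [exact: oU|exact: cE].
have [x _|k [h hk]] := cX oV.
  have [/EU[i _ ?]|nE] := pselect (E x); first by exists (Some i).
  by exists None.
have [[i0]|nI] := pselect (inhabited J).
  exists k, (fun j => odflt i0 (h j)) => x Ex.
  have [j _] := hk x I; rewrite /V; case hj : (h j) => [i|] // Ui.
  by exists j => //; rewrite hj.
suff E0 x : ~ E x by exists 0%N, (fun i : 'I_0 => False_rect J (notF (ltn_ord i))) => x /E0.
by move=> /EU[i _ _]; apply: nI; exists.
Qed.

Lemma total_bounded (r : R) : 0 < r ->
  exists (k : nat) (h : 'I_k -> X), forall x, exists i, d (h i) x < r.
Proof.
move=> r0; have [|x _|k [h hk]] := @cX X (fun x => dball d x r).
- by move=> x; exact: dopen_ball.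
- by exists x => //; rewrite /dball/= dxx.
- by exists k, h => x; have [i _ ?] := hk x I; exists i.
Qed.

Lemma nested_nonempty (F : nat -> set X) :
  (forall n, dclosed (F n)) -> (forall n, F n !=set0) ->
  (forall n, F n.+1 `<=` F n) -> exists p, forall n, F n p.
Proof.
move=> cF F0 dF; apply: contrapT => nF.
have [|x _|k [h hk]] := @cX nat (fun n => ~` F n); first exact: cF.
  have [n ?] : exists n, ~ F n x by apply/existsNP => ?; apply: nF; exists x.
  by exists n.
have mono i j : (i <= j)%N -> F j `<=` F i.
  move=> /subnKC <-; elim: (j - i)%N => [|l IH]; first by rewrite addn0.
  by rewrite addnS => x /dF/IH.
pose M := (\max_(j < k) h j)%N.
have [x Fx] := F0 M; have [j _] := hk x I.
by apply; apply: mono Fx; exact: leq_bigmax.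
Qed.

(** A Lebesgue number argument: a ball of radius [2 * r x] misses [E] or [F], and the balls of
    radius [r x] form the cover, so two points closer than the least radius of a finite subcover
    share one of the doubled balls. *)
Lemma closed_disjoint_dist E F : dclosed E -> dclosed F -> E `&` F = set0 ->
  exists2 r : R, 0 < r & forall x y, E x -> F y -> r <= d x y.
Proof.
move=> cE cF EF0.
have hr x : exists r, 0 < r /\ (dball d x (2 * r) `<=` ~` E \/ dball d x (2 * r) `<=` ~` F).
  have [Ex|nE] := pselect (E x).
    have nF : (~` F) x by move=> Fx; have : (E `&` F) x by []; rewrite EF0.
    have [r r0 h] := cF x nF; exists (r / 2); split; first lra.
    by right; rewrite mulrC divfK.
  have [r r0 h] := cE x nE; exists (r / 2); split; first lra.
  by left; rewrite mulrC divfK.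
have [r rP] := choice hr.
have [|x _|k [h hk]] := @cX X (fun x => dball d x (r x)).
- by move=> x; exact: dopen_ball.
- by exists x => //; rewrite /dball/= dxx; case: (rP x).
pose s := \big[Num.min/1]_(i < k) r (h i).
have s0 : 0 < s.
  by rewrite /s; elim/big_ind : _ => // [x y ? ?|i _]; rewrite ?lt_min ?[0 < x]H// ; [apply/andP|case: (rP (h i))].
have sle i : s <= r (h i) by rewrite /s (bigD1 i)//= ge_min lexx.
exists s => // x y Ex Fy; rewrite leNgt; apply/negP => xy.
have [i _ hx] := hk x I; have [_ [h1|h1]] := rP (h i).
  apply: (h1 x) => //; rewrite /dball/=; move: hx; rewrite /dball/=.
  by have := sle i; lra.
apply: (h1 y) => //; rewrite /dball/=; move: hx; rewrite /dball/=.
by have := sle i; have := dtri x (h i) y; lra.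
Qed.

Context (f g : X -> X).

(** By compactness mixing is applied only to the finitely many pairs of balls of a finite cover, so
    one transition time serves all pairs of points. *)
Lemma mixing_gap : top_mixing d f -> forall r : R, 0 < r ->
  exists2 N, (0 < N)%N & forall x y, exists p, d x p < r /\ d (iter N f p) y < r.
Proof.
move=> mf r r0; have r20 : 0 < r / 2 by rewrite divr_gt0.
have [k [h hk]] := total_bounded r20.
have hN (ij : 'I_k * 'I_k) : exists N, forall n, (N <= n)%N ->
    (iter n f @` dball d (h ij.1) (r / 2)) `&` dball d (h ij.2) (r / 2) !=set0.
  apply: mf; [exact: dopen_ball|exact: dopen_ball| |].
    by exists (h ij.1); rewrite /dball/= dxx.
  by exists (h ij.2); rewrite /dball/= dxx.
have [N NP] := choice hN.
pose M := (\max_ij N ij).+1.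
exists M => // x y; have [i xi] := hk x; have [j yj] := hk y.
have [|_ [[p pi <-] pj]] := NP (i, j) M.
  by rewrite /M leqW// (leq_bigmax (i, j)).
exists p; move: pi pj; rewrite /dball/= => pi pj; split.
  by have := dtri (h i) x p; rewrite (dsym x (h i)); lra.
have := dtri (h j) (iter M f p) y; rewrite (dsym (iter M f p) (h j)); lra.
Qed.

End Metric.

Definition seg_start (N : nat) (n : nat -> nat) (i : nat) : nat := \sum_(l < i) (n l + N)%N.

Lemma seg_startS N n i : seg_start N n i.+1 = (seg_start N n i + n i + N)%N.
Proof. by rewrite /seg_start big_ord_recr/= addnA. Qed.

Section Gluing.
Context {R : realType} {X : Type} (d : X -> X -> R) (f g : X -> X).
Context (dm : is_metric d) (cX : dcompact d [set: X]).

Lemma gluing (lam : R) : homeo d f g -> top_mixing d f ->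
  exp_shadowing_lambda d f g lam -> forall tau : R, 0 < tau ->
  exists2 N, (0 < N)%N & forall (x : nat -> X) (n : nat -> nat),
    (forall i, (0 < n i)%N) -> exists z, forall i j, (j < n i)%N ->
      d (iter (seg_start N n i + j) f z) (iter j f (x i))
        < tau * expR (- lam * (minn j (n i - j))%:R).
Proof.
move=> [fK gK _ _] mf sh tau tau0.
have [del del0 hdel] := sh tau tau0.
have [N N0 hN] := mixing_gap dm cX mf del0.
exists N => // x n n0.
have [p pP] := choice (fun i => hN (iter (n i) f (x i)) (x i.+1)).
(* Prescribed segments (even indices) alternate with connecting segments of length [N] (odd
   indices). The negative side is filled with the true backward orbit of [x 0] in steps of length
   one, where no jump occurs. *)
pose xx (i : int) := match i with
  | Posz k => if odd k then p k./2 else x k./2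
  | Negz k => iter k.+1 g (x 0%N) end.
pose nn (i : int) := match i with
  | Posz k => if odd k then N else n k./2
  | Negz k => 1%N end.
have [i|i|z zP] := hdel xx nn.
- by case: i => [k|k] //=; case: ifP.
- case: i => [k|[|k]].
  + rewrite (_ : Posz k + 1 = Posz k.+1); last by lia.
    by have := pP k./2; rewrite /nn /xx /= uphalf_half; case: (odd k) => -[].
  + by rewrite /= gK (dxx dm).
  + rewrite (_ : Negz k.+1 + 1 = Negz k); last by lia.
    by rewrite /= gK (dxx dm).
exists z => i j ji.
have := zP (Posz i.*2) j; rewrite /nn /xx /= odd_double doubleK => /(_ ji).
suff -> : (\sum_(l < i.*2) (if odd l then N else n l./2))%N = seg_start N n i by [].
rewrite /seg_start; elim: i {ji} => [|i IH]; first by rewrite !big_ord0.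
by rewrite doubleS !big_ord_recr/= IH /= odd_double uphalf_double doubleK addnA.
Qed.

End Gluing.

(** * Cocycles along shadowing orbits *)

Section Cocycle.
Context {R : realType} {X : Type} {m : nat} (f : X -> X) (A : X -> 'M[R]_m).

Lemma cocycleE n x : cocycle A f n x = mprod (fun j => A (iter j f x)) n.
Proof. by elim: n => //= n ->. Qed.

Lemma cocycleD n k x :
  cocycle A f (n + k) x = cocycle A f k (iter n f x) *m cocycle A f n x.
Proof.
rewrite !cocycleE mprodD; congr (_ *m _); rewrite -!cocycleE.
rewrite cocycleE; elim: k => //= k ->.
by rewrite addnC iterD.
Qed.

Lemma cocycle_window n w x :
  cocycle A f (n * w) x = mprod (fun i => cocycle A f w (iter (i * w) f x)) n.
Proof.
elim: n => //= n IH; rewrite -IH mulSn addnC cocycleD.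
by [].
Qed.

Context (Au : forall x, A x \in unitmx).

Lemma cocycle_unit n x : cocycle A f n x \in unitmx.
Proof. by elim: n => [|n IH] /=; rewrite ?unitmx1// unitmx_mul Au. Qed.

Context (C0 : R) (C0_ge0 : 0 <= C0)
  (hA : forall x, opnorm (A x) <= expR C0) (hA' : forall x, expands (expR C0) (A x)).

Lemma opnorm_cocycle_le n x : opnorm (cocycle A f n x) <= expR (C0 * n%:R).
Proof.
by rewrite cocycleE expRM_natr; apply: opnorm_mprod_exp.
Qed.

Lemma cocycle_expands n x : expands (expR (C0 * n%:R)) (cocycle A f n x).
Proof.
elim: n => [|n IH] /=.
  by rewrite mulr0 expR0 => v; rewrite mul1mx mul1r.
rewrite -natr1 mulrDr mulr1 expRD; by apply: expandsM => //; exact: expR_ge0.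
Qed.

Lemma cocycleD_le_l n k x : opnorm (cocycle A f (n + k) x) <=
  expR (C0 * n%:R) * opnorm (cocycle A f k (iter n f x)).
Proof.
rewrite cocycleD mulrC (le_trans (opnormM _ _))// ler_wpM2l ?opnorm_ge0//.
exact: opnorm_cocycle_le.
Qed.

Lemma cocycleD_le_r n k x : opnorm (cocycle A f (n + k) x) <=
  expR (C0 * k%:R) * opnorm (cocycle A f n x).
Proof.
rewrite cocycleD (le_trans (opnormM _ _))// ler_wpM2r ?opnorm_ge0//.
exact: opnorm_cocycle_le.
Qed.

Lemma cocycleD_ge_l n k x : opnorm (cocycle A f k (iter n f x)) <=
  expR (C0 * n%:R) * opnorm (cocycle A f (n + k) x).
Proof.
rewrite cocycleD mulrC; apply: opnorm_mulr; rewrite ?expR_ge0 ?cocycle_unit//.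
exact: cocycle_expands.
Qed.

Lemma cocycleD_ge_r n k x : opnorm (cocycle A f n x) <=
  expR (C0 * k%:R) * opnorm (cocycle A f (n + k) x).
Proof.
rewrite cocycleD; apply: opnorm_mull; rewrite ?expR_ge0//.
exact: cocycle_expands.
Qed.

Lemma cocycle_perturb w p x (e : R) : 0 <= e ->
  (forall j, (j < w)%N -> opnorm (A (iter j f p) - A (iter j f x)) <= e) ->
  opnorm (cocycle A f w p - cocycle A f w x) <= w%:R * expR (C0 * w%:R) * e.
Proof.
move=> e0 H; rewrite !cocycleE expRM_natr; apply: mprod_perturb => //.
move=> i iw; rewrite (le_trans (H i iw))// ler_peMl//.
by rewrite -expR0 ler_expR.
Qed.

Context (d : X -> X -> R) (C alpha lam : R) (C_ge0 : 0 <= C) (alpha0 : 0 < alpha)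
  (lam0 : 0 < lam) (hol : forall x y, opnorm (A x - A y) <= C * d x y `^ alpha).
Context (dm : is_metric d).

(* Only the middle windows of the orbit of [p] are compared with those of [x]:
   they lie at distance at least [D w] from both ends, so the shadowing error there
   is exponentially small compared with every product of norms that occurs in the
   telescoping sum, whereas the [2 D w] extreme steps cost a factor [expR (2 D C0 w)],
   which is negligible because [D / W] is small. *)
Lemma robust_growth (chi eps : R) (W0 : nat) : 0 < eps ->
  exists D W w0 : nat, exists eps' : R, [/\ 0 < eps', (W0 <= W)%N, (D.*2 < W)%N &
  forall w, (w0 <= w)%N -> forall x,
   (forall i, (i < W)%N ->
      opnorm (cocycle A f w (iter (i * w) f x)) <= expR ((chi + eps') * w%:R)) ->
   expR ((chi - eps') * ((W - D.*2) * w)%:R) <=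
      opnorm (cocycle A f ((W - D.*2) * w) (iter (D * w) f x)) ->
   forall p, (forall j, (j < W * w)%N ->
      d (iter j f p) (iter j f x) <= expR (- lam * (minn j (W * w - j))%:R)) ->
   expR ((chi - eps) * (W * w)%:R) <= opnorm (cocycle A f (W * w) p) /\
   opnorm (cocycle A f (W * w) p) <= expR ((chi + eps) * (W * w)%:R)].
Proof.
move=> eps0.
pose sg := lam * alpha; have sg0 : 0 < sg by rewrite mulr_gt0.
(* As [w * C <= expR (2 * w)] for large [w], the error of one window is at most
   [expR ((2 + C0 - sg * D) * w)]; this [D] makes it [expR (- 2 * w)] times the bound [U] of a
   window. *)
have [D hD] : exists D : nat, (4 + C0 + `|chi|) / sg <= D%:R.
  by exists (Num.truncn ((4 + C0 + `|chi|) / sg)).+1; apply/ltW/truncnS_gt.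
have {}hD : 4 + C0 + `|chi| <= sg * D%:R by rewrite mulrC -ler_pdivrMr.
(* The cost, in units of [w], of cutting off [D] windows at each end; the summand [1] absorbs
   constant factors. *)
pose cst := 2 * D%:R * C0 + 2 * D%:R * `|chi| + 1.
have [W1 hW1] : exists W1 : nat, cst * 2 / eps <= W1%:R.
  by exists (Num.truncn (cst * 2 / eps)).+1; apply/ltW/truncnS_gt.
pose W := (W0 + W1 + D.*2.+1)%N.
have DW : (D.*2 < W)%N by rewrite /W leq_addl.
have W0W : (W0 <= W)%N by rewrite /W -addnA leq_addr.
have W1W : (W1 <= W)%N by rewrite /W addnAC leq_addl.
clearbody W.
have : exists n, [/\ (W - D.*2 = n)%N, (0 < n)%N & (n + D.*2 = W)%N].
  by exists (W - D.*2)%N; split; nlia.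
move=> [n [nE n0 nW]].
have D2 : D.*2 = (D + D)%N by rewrite addnn.
pose nr : R := n%:R; have nr0 : 1 <= nr by rewrite /nr ler1n.
(* With [2 * eps' * n <= 1] the upper and lower hypotheses differ by at most [w] in the exponent
   over the [n] middle windows. Of the factor [expR (- 2 * w)] one half pays for this, the other for
   [n * 2 ^ n.+1]. *)
pose eps' := Num.min (eps / 2) (Num.min 1 (1 / (2 * nr))).
have eps'0 : 0 < eps' by rewrite !lt_min !divr_gt0//= ?mulr_gt0//; lra.
have eps'1 : eps' <= 1 by rewrite !ge_min lexx orbT.
have eps'h : eps' <= eps / 2 by rewrite !ge_min lexx.
have eps'n : 2 * (eps' * nr) <= 1.
  have : eps' <= 1 / (2 * nr) by rewrite !ge_min lexx !orbT.
  by rewrite ler_pdivlMr; lra.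
have [w1 hw1] : exists w1 : nat, C <= w1%:R.
  by exists (Num.truncn C).+1; apply/ltW/truncnS_gt.
have [k2 k2n k2E] : exists2 k2, (n <= k2)%N & k2%:R = nr * 2 ^+ n.+1.
  by exists (n * 2 ^ n.+1)%N; rewrite ?natrM ?natrX// leq_pmulr// expn_gt0.
exists D, W, (w1 + k2).+1, eps'; split => // w ww x; rewrite ?nE => Hup Hlo p Hp.
pose wr : R := w%:R.
have w1r : 1 <= wr by rewrite /wr ler1n; nlia.
have wC : C <= expR wr.
  rewrite (le_trans hw1)// (le_trans _ (expR_ge1Dx _))//.
  have : (w1%:R <= wr) by rewrite /wr ler_nat; nlia.
  lra.
have wn : nr * 2 ^+ n.+1 <= expR wr.
  rewrite (le_trans _ (expR_ge1Dx _))//.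
  have : (k2%:R <= wr) by rewrite /wr ler_nat; nlia.
  by rewrite k2E; lra.
have ww' : wr <= expR wr by rewrite (le_trans _ (expR_ge1Dx _))//; lra.
have nw : nr <= wr.
  rewrite /nr /wr ler_nat; nlia.
pose U := expR ((chi + eps') * wr).
have U0 : 0 < U by exact: expR_gt0.
pose x' := iter (D * w) f x; pose p' := iter (D * w) f p.
have itE (q : X) i : iter (i * w) f (iter (D * w) f q) = iter ((i + D) * w) f q.
  by rewrite -iterD mulnDl.
have win i : (i < n)%N ->
    opnorm (cocycle A f w (iter (i * w) f p') - cocycle A f w (iter (i * w) f x'))
      <= U * expR (- 2 * wr).
  move=> iN; rewrite !itE.
  apply: (le_trans (@cocycle_perturb _ _ _ (C * expR (- (sg * D%:R) * wr)) _ _)).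
  - by rewrite mulr_ge0 ?expR_ge0.
  - move=> j jw; rewrite -!iterD.
    apply: (le_trans (hol _ _)); rewrite ler_wpM2l//.
    have -> : expR (- (sg * D%:R) * wr) = expR (- lam * (D * w)%:R) `^ alpha.
      by rewrite -expRM natrM /sg /wr; congr expR; ring.
    have jW : (j + (i + D) * w < W * w)%N.
      have : ((i + D).+1 * w <= W * w)%N by rewrite leq_mul2r; apply/orP; right; nlia.
      rewrite mulSn; nlia.
    rewrite ge0_ler_powR ?nnegrE ?expR_ge0 ?d_ge0 ?(ltW alpha0)//.
    rewrite (le_trans (Hp _ jW))// ler_expR !mulNr lerN2 ler_wpM2l ?(ltW lam0)//.
    rewrite ler_nat leq_min; apply/andP; split.
      by rewrite mulnDl; nlia.
    have : ((i + D + 1 + D) * w <= W * w)%N by rewrite leq_mul2r; apply/orP; right; nlia.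
    rewrite !mulnDl; nlia.
  - have h1 : w%:R * expR (C0 * w%:R) * (C * expR (- (sg * D%:R) * wr)) <=
      expR wr * expR (C0 * wr) * (expR wr * expR (- (sg * D%:R) * wr)).
      rewrite ler_pM ?mulr_ge0 ?expR_ge0//.
        by rewrite ler_wpM2r ?expR_ge0.
      by rewrite ler_wpM2r ?expR_ge0.
    apply: (le_trans h1); rewrite -!expRD ler_expR.
    suff : (2 + C0 - sg * D%:R) * wr <= (chi + eps' - 2) * wr by lra.
    rewrite ler_wpM2r//.
    by have := ler_norm (- chi); rewrite normrN; lra.
have UA i : (i < n)%N -> opnorm (cocycle A f w (iter (i * w) f x')) <= 2 * U.
  move=> iN; rewrite itE; apply: (le_trans (Hup _ _)); first by nlia.
  by rewrite -/wr -/U; lra.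
have e1 : expR (- 2 * wr) <= 1 by rewrite -[leRHS]expR0 ler_expR; lra.
have UB i : (i < n)%N -> opnorm (cocycle A f w (iter (i * w) f p')) <= 2 * U.
  move=> iN; rewrite (le_trans (opnorm_subr_le _ (cocycle A f w (iter (i * w) f x'))))//.
  have h1 : opnorm (cocycle A f w (iter (i * w) f x')) <= U.
    by rewrite itE Hup//; nlia.
  have h2 : U * expR (- 2 * wr) <= U by rewrite ler_piMr// ltW.
  have := win i iN; lra.
have exE : (2 * U) ^+ n = 2 ^+ n * expR ((chi + eps') * (wr * nr)).
  by rewrite exprMn mulrA expRM_natr.
(* Half of the lower bound for the orbit of [x], so that the other half remains for [p]. *)
have pert : opnorm (cocycle A f (n * w) p' - cocycle A f (n * w) x') <=
    expR ((chi - eps') * (n * w)%:R) / 2.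
  rewrite !cocycle_window.
  apply: (le_trans (@mprod_perturb _ _ _ _ _ (2 * U) (expR (- 2 * wr)) _ _ UB UA _)).
  - by rewrite mulr_ge0// ltW.
  - exact: expR_ge0.
  - move=> i iN; rewrite (le_trans (win i iN))// -mulrA ler_peMl ?mulr_ge0 ?expR_ge0//; lra.
  rewrite exE ler_pdivlMr//.
  have -> : n%:R * (2 ^+ n * expR ((chi + eps') * (wr * nr))) * expR (- 2 * wr) * 2 =
    (nr * 2 ^+ n.+1) * (expR ((chi + eps') * (wr * nr)) * expR (- 2 * wr)).
    by rewrite exprS /nr; ring.
  apply: (@le_trans _ _ (expR wr * (expR ((chi + eps') * (wr * nr)) * expR (- 2 * wr)))).
    by rewrite ler_wpM2r// mulr_ge0 ?expR_ge0.
  rewrite -!expRD ler_expR natrM -/nr -/wr.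
  have : (2 * (eps' * nr)) * wr <= 1 * wr by rewrite ler_wpM2r//; lra.
  lra.
have ends k : k = (D * w + n * w + D * w)%N -> k = (W * w)%N.
  by move=> ->; rewrite -!mulnDl; congr (_ * _)%N; nlia.
have Wr : W%:R = nr + 2 * D%:R :> R by rewrite -nW natrD -muln2 natrM /nr; ring.
have key : eps' * nr + cst <= eps * W%:R.
  have h1 : W1%:R <= W%:R :> R by rewrite ler_nat.
  have h2 : cst * 2 <= eps * W1%:R by rewrite mulrC (mulrC eps) -ler_pdivrMr// mulrC.
  have h3 : eps' * nr <= eps / 2 * W%:R.
    have h4 : eps / 2 * nr <= eps / 2 * W%:R.
      by rewrite ler_wpM2l ?Wr; have := ler0n R D; lra.
    by apply: le_trans h4; rewrite ler_wpM2r//; lra.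
  have : eps * W1%:R <= eps * W%:R by rewrite ler_wpM2l// ltW.
  lra.
have nchi : - (2 * D%:R * chi) <= 2 * D%:R * `|chi|.
  rewrite -mulrN ler_wpM2l ?mulr_ge0//.
  by have := ler_norm (- chi); rewrite normrN.
have pchi : 2 * D%:R * chi <= 2 * D%:R * `|chi|.
  by rewrite ler_wpM2l ?mulr_ge0// ler_norm.
rewrite -(ends _ erefl); split.
  have h1 : opnorm (cocycle A f (n * w) p') <=
      expR (C0 * (D * w)%:R) * (expR (C0 * (D * w)%:R) * opnorm (cocycle A f (D * w + n * w + D * w) p)).
    apply: (le_trans (cocycleD_ge_l (D * w) (n * w) p)).
    by rewrite ler_wpM2l ?expR_ge0//; exact: cocycleD_ge_r.
  have h2 : expR ((chi - eps') * (n * w)%:R) / 2 <= opnorm (cocycle A f (n * w) p').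
    have := opnorm_subr_le (cocycle A f (n * w) x') (cocycle A f (n * w) p').
    rewrite opnormB; lra.
  have h3 : expR ((chi - eps) * (D * w + n * w + D * w)%:R) * 2 *
     (expR (C0 * (D * w)%:R) * expR (C0 * (D * w)%:R)) <= expR ((chi - eps') * (n * w)%:R).
    apply: (@le_trans _ _ (expR ((chi - eps) * (D * w + n * w + D * w)%:R) * expR 1 *
     (expR (C0 * (D * w)%:R) * expR (C0 * (D * w)%:R)))).
      rewrite ler_wpM2r ?mulr_ge0 ?expR_ge0// ler_wpM2l ?expR_ge0//.
      by have := expR_ge1Dx (1 : R); lra.
    rewrite -!expRD ler_expR !natrD !natrM -/wr -/nr.
    suff : ((chi - eps) * W%:R + 1 + 2 * D%:R * C0) * wr <= ((chi - eps') * nr) * wr.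
      rewrite Wr; lra.
    rewrite ler_wpM2r//.
    by rewrite /cst Wr in key *; lra.
  set E := expR (C0 * (D * w)%:R) in h1 h3; have E0 : 0 < E by exact: expR_gt0.
  rewrite mulrA in h1.
  have : expR ((chi - eps) * (D * w + n * w + D * w)%:R) * (E * E) <=
    opnorm (cocycle A f (D * w + n * w + D * w) p) * (E * E) by lra.
  by rewrite ler_pM2r// mulr_gt0.
have h1 : opnorm (cocycle A f (D * w + n * w + D * w) p) <=
   expR (C0 * (D * w)%:R) * (expR (C0 * (D * w)%:R) * opnorm (cocycle A f (n * w) p')).
  apply: (le_trans (cocycleD_le_r _ _ _)).
  by rewrite ler_wpM2l ?expR_ge0//; exact: cocycleD_le_l.
apply: (le_trans h1).
have h2 : opnorm (cocycle A f (n * w) p') <= expR nr * expR ((chi + eps') * (wr * nr)).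
  rewrite cocycle_window (le_trans (opnorm_mprod_exp UB))// exE.
  rewrite ler_wpM2r ?expR_ge0// -[nr]mul1r expRM_natr lerXn2r ?nnegrE ?expR_ge0//.
  by have := expR_ge1Dx (1 : R); lra.
apply: (@le_trans _ _ (expR (C0 * (D * w)%:R) * (expR (C0 * (D * w)%:R) *
   (expR nr * expR ((chi + eps') * (wr * nr)))))).
  by rewrite !ler_wpM2l ?expR_ge0.
rewrite -!expRD ler_expR !natrD !natrM -/wr -/nr.
suff : (2 * D%:R * C0 + 1 + (chi + eps') * nr) * wr <= ((chi + eps) * W%:R) * wr.
  rewrite Wr; lra.
rewrite ler_wpM2r//.
by rewrite /cst Wr in key *; lra.
Qed.

End Cocycle.

(** * Measurability and expectations *)

Section HolderBounds.
Context {R : realType} {X : Type} {m : nat} (f : X -> X) (A : X -> 'M[R]_m).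
Context (d : X -> X -> R) (dm : is_metric d) (cX : dcompact d [set: X]).

Lemma holder_nonneg : holder d A -> exists C alpha : R, [/\ 0 <= C, 0 < alpha &
  forall x y, opnorm (A x - A y) <= C * d x y `^ alpha].
Proof.
move=> [C [alpha [a0 h]]]; exists `|C|, alpha; split => // x y.
by rewrite (le_trans (h x y))// ler_wpM2r ?powR_ge0// ler_norm.
Qed.

Context (C alpha : R) (C_ge0 : 0 <= C) (alpha0 : 0 < alpha)
  (hol : forall x y, opnorm (A x - A y) <= C * d x y `^ alpha).

Lemma holder_small (e : R) : 0 < e -> exists2 r : R, 0 < r &
  forall x y, d x y <= r -> opnorm (A x - A y) <= e.
Proof.
move=> e0; have C1 : 0 < C + 1 by move: C_ge0; lra.
exists ((e / (C + 1)) `^ alpha^-1); first by rewrite powR_gt0// divr_gt0.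
move=> x y xy; rewrite (le_trans (hol x y))//.
have h : d x y `^ alpha <= e / (C + 1).
  have -> : e / (C + 1) = ((e / (C + 1)) `^ alpha^-1) `^ alpha.
    by rewrite -powRrM mulVf ?gt_eqF// powRr1// ltW// divr_gt0.
  by rewrite ge0_ler_powR ?nnegrE ?powR_ge0 ?(d_ge0 dm) ?(ltW alpha0).
rewrite (@le_trans _ _ (C * (e / (C + 1))))// ?ler_wpM2l//.
by rewrite mulrA ler_pdivrMr//; nra.
Qed.

(** If [c] works for [A x], then [2 * c] works for every matrix within [(2 * c)^-1] of it, since
    half of the norm of [v] can be absorbed. A finite cover makes the bounds uniform; the sum of the
    local constants serves as their maximum. *)
Lemma cocycle_bounds : (forall x, A x \in unitmx) ->
  exists C0 : R, [/\ 0 <= C0, forall x, opnorm (A x) <= expR C0 &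
   forall x, expands (expR C0) (A x)].
Proof.
move=> Au.
have loc x : exists rc : R * R, [/\ 0 < rc.1, 0 <= rc.2 &
   forall y, d x y < rc.1 -> opnorm (A y) <= rc.2 /\ expands rc.2 (A y)].
  pose c := opnorm (invmx (A x)) + 1.
  have c0 : 0 < c by have := opnorm_ge0 (invmx (A x)); rewrite /c; lra.
  have e0 : 0 < (2 * c)^-1 by rewrite invr_gt0 mulr_gt0.
  have [r r0 hr] := holder_small e0.
  exists (r, opnorm (A x) + (2 * c)^-1 + 2 * c); split => //=.
    by have := opnorm_ge0 (A x); lra.
  move=> y /ltW /hr xy; split.
    have := opnorm_subr_le (A y) (A x); rewrite opnormB in xy; lra.
  move=> v; apply: (@le_trans _ _ (2 * c * vnorm (A y *m v))); last first.
    by rewrite ler_wpM2r ?vnorm_ge0//; have := opnorm_ge0 (A x); lra.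
  have h1 : vnorm v <= c * vnorm (A x *m v).
    rewrite (le_trans (expands_unit (Au x) v))// ler_wpM2r ?vnorm_ge0// /c; lra.
  have h2 : vnorm (A x *m v) <= vnorm (A y *m v) + (2 * c)^-1 * vnorm v.
    have -> : A x *m v = A y *m v + (A x - A y) *m v by rewrite mulmxBl addrC subrK.
    rewrite (le_trans (vnormD _ _))// lerD2l (le_trans (le_opnorm _ _))//.
    by rewrite ler_wpM2r ?vnorm_ge0.
  have h3 : c * vnorm (A x *m v) <= c * vnorm (A y *m v) + 2^-1 * vnorm v.
    have -> : 2^-1 = c * (2 * c)^-1 :> R by rewrite invfM; field; rewrite gt_eqF.
    by rewrite -mulrA -mulrDr ler_wpM2l// ltW.
  lra.
have [rc rcP] := choice loc.
have [|x _|k [h hk]] := @cX X (fun x => dball d x (rc x).1).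
- by move=> x; exact: dopen_ball.
- by exists x => //; rewrite /dball/= (dxx dm); case: (rcP x).
pose S := \sum_(i < k) (rc (h i)).2.
have Sle i : (rc (h i)).2 <= S.
  rewrite /S (bigD1 i)//= lerDl sumr_ge0// => j _; by case: (rcP (h j)).
have S0 : 0 <= S by rewrite /S sumr_ge0// => j _; case: (rcP (h j)).
have SE : S <= expR S by rewrite (le_trans _ (expR_ge1Dx _))//; lra.
exists S; split => // x; have [i _ xi] := hk x I; have [_ _ /(_ _ xi) [h1 h2]] := rcP (h i).
  by rewrite (le_trans h1)// (le_trans (Sle i)).
by move=> v; rewrite (le_trans (h2 v))// ler_wpM2r ?vnorm_ge0// (le_trans (Sle i)).
Qed.

End HolderBounds.

Section Borel.
Context {R : realType} {dsp : measure_display} {X : measurableType dsp}.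
Context (d : X -> X -> R) (dm : is_metric d).
Context (hm : (@measurable dsp X) = <<s dopen d >>).

Lemma dopen_measurable U : dopen d U -> measurable U.
Proof. by move=> oU; rewrite hm; exact: sub_sigma_algebra. Qed.

Lemma dclosed_measurable F : dclosed d F -> measurable F.
Proof. by move=> /dopen_measurable/measurableC; rewrite setCK. Qed.

Lemma dcontinuous_measurable f : dcontinuous d f -> measurable_fun [set: X] f.
Proof.
move=> cf; apply: (measurability _ hm) => _ [U oU <-].
rewrite setTI; apply: dopen_measurable => x /= /oU[r r0 hr].
by have [s s0 hs] := cf x r r0; exists s => // y /hs /hr.
Qed.

Lemma continuous_real_measurable (phi : X -> R) :
  (forall x (e : R), 0 < e -> exists2 r, 0 < r & forall y, d x y < r -> `|phi x - phi y| < e) ->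
  measurable_fun [set: X] phi.
Proof.
move=> cphi; apply: (measurability _ (measurable_realfun.RGenOInfty.measurableE R)) => //.
move=> /= _ [_ [a ->] <-]; rewrite setTI; apply: dopen_measurable => x /=.
rewrite in_itv/= andbT => ax.
have [r r0 hr] := cphi x (phi x - a) ltac:(lra).
exists r => // y /hr /=; rewrite in_itv/= andbT.
have := ler_norm (phi x - phi y); lra.
Qed.

Context (f : X -> X) {m : nat} (A : X -> 'M[R]_m) (C0 C alpha : R) (C0_ge0 : 0 <= C0)
  (hA : forall x, opnorm (A x) <= expR C0) (C_ge0 : 0 <= C) (alpha0 : 0 < alpha)
  (hol : forall x y, opnorm (A x - A y) <= C * d x y `^ alpha).
Context (cf : dcontinuous d f).

Lemma opnorm_cocycle_measurable n :
  measurable_fun [set: X] (fun x => opnorm (cocycle A f n x)).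
Proof.
apply: continuous_real_measurable => x e e0.
pose K := n%:R * expR (C0 * n%:R) + 1.
have K0 : 0 < K by rewrite ltr_wpDl// mulr_ge0// expR_ge0.
have [r r0 hr] := holder_small dm C_ge0 alpha0 hol (divr_gt0 e0 K0).
have hs j : exists s, 0 < s /\ forall y, d x y < s -> d (iter j f x) (iter j f y) < r.
  by have [s s0 hs] := dcontinuous_iter j cf x r0; exists s.
have [s sP] := choice hs.
pose t := \big[Num.min/1]_(i < n) s i.
have t0 : 0 < t.
  rewrite /t; elim/big_ind : _ => // [a b a0 b0|i _]; first by rewrite lt_min a0.
  by case: (sP i).
exists t => // y xy.
have h1 : opnorm (cocycle A f n x - cocycle A f n y) <= n%:R * expR (C0 * n%:R) * (e / K).
  apply: cocycle_perturb => //; first by rewrite divr_ge0 ?ltW.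
  move=> j jn; apply: hr; apply: ltW; apply: (sP j).2; apply: (lt_le_trans xy).
  by rewrite /t (bigD1 (Ordinal jn))//= ge_min lexx.
have h2 : n%:R * expR (C0 * n%:R) * (e / K) < e.
  rewrite mulrA ltr_pdivrMr// mulrC ltr_pM2l// /K; lra.
have := opnorm_subr_le (cocycle A f n x) (cocycle A f n y).
have := opnorm_subr_le (cocycle A f n y) (cocycle A f n x).
rewrite (opnormB (cocycle A f n y)) => h3 h4.
by rewrite ltr_norml; apply/andP; split; lra.
Qed.

Lemma lnorm_measurable n : measurable_fun [set: X] (fun x => ln (opnorm (cocycle A f n x))).
Proof.
exact: (measurableT_comp (@measurable_ln R) (opnorm_cocycle_measurable n)).
Qed.

End Borel.

Section Expectation.
Context {R : realType} {dsp : measure_display} {X : measurableType dsp}.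
Context (mu : probability X R).

Definition bmeas (phi : X -> R) :=
  measurable_fun [set: X] phi /\ exists B : R, forall x, `|phi x| <= B.

Definition Ex (phi : X -> R) : R := \int[mu]_(x in [set: X]) phi x.

Definition prob (U : set X) : R := fine (mu U).

Lemma probE U : measurable U -> mu U = (prob U)%:E.
Proof. by move=> mU; rewrite /prob fineK// fin_num_measure. Qed.

Lemma prob_ge0 U : 0 <= prob U.
Proof. exact/fine_ge0/measure_ge0. Qed.

Lemma probT : prob [set: X] = 1.
Proof. by rewrite /prob probability_setT. Qed.

Lemma prob_le U V : measurable U -> measurable V -> U `<=` V -> prob U <= prob V.
Proof.
move=> mU mV UV; rewrite -lee_fin -!probE//.
by apply: le_measure; rewrite ?inE.
Qed.

Lemma probU2 U V : measurable U -> measurable V -> prob (U `|` V) <= prob U + prob V.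
Proof.
move=> mU mV; rewrite -lee_fin EFinD -!probE//; first exact: measureU2.
exact: measurableU.
Qed.

Lemma prob_bigU (T : finType) (U : T -> set X) :
  (forall i, measurable (U i)) ->
  prob (\bigcup_(i in [set: T]) U i) <= \sum_i prob (U i).
Proof.
move=> mU; rewrite -lee_fin -probE; last exact: fin_bigcup_measurable.
rewrite -sumEFin.
have -> : (\sum_i (prob (U i))%:E = \sum_(i : T) mu (U i))%E.
  by apply: eq_bigr => i _; rewrite probE.
have -> : \bigcup_(i in [set: T]) U i = \big[setU/set0]_(i <- enum T) U i.
  by rewrite -bigcup_seq; apply: eq_bigcupl; split => x _ //=; rewrite mem_enum.
rewrite -big_enum/=.
elim: (enum T) => [|t s IH]; first by rewrite !big_nil measure0.
rewrite !big_cons (le_trans (measureU2 _ _ _))//; last by rewrite leeD2l.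
by apply: bigsetU_measurable.
Qed.

Lemma bmeas_integrable phi : bmeas phi -> mu.-integrable [set: X] (EFin \o phi).
Proof.
move=> [mphi [B hB]]; apply: measurable_bounded_integrable => //.
  by rewrite ltey_eq fin_num_measure.
exists B; split; first by rewrite num_real.
by move=> M BM x _; apply: (le_trans (hB x)); exact: ltW.
Qed.

Lemma bmeas_cst (c : R) : bmeas (fun=> c).
Proof. by split; [exact: measurable_cst|exists `|c|]. Qed.

Lemma bmeasD phi psi : bmeas phi -> bmeas psi -> bmeas (fun x => phi x + psi x).
Proof.
move=> [m1 [B1 h1]] [m2 [B2 h2]]; split; first exact: measurable_funD.
by exists (B1 + B2) => x; rewrite (le_trans (ler_normD _ _))// lerD.
Qed.

Lemma bmeasZ (c : R) phi : bmeas phi -> bmeas (fun x => c * phi x).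
Proof.
move=> [m1 [B1 h1]]; split; first exact: measurable_funM.
by exists (`|c| * B1) => x; rewrite normrM ler_wpM2l.
Qed.

Lemma bmeas_indic U : measurable U -> bmeas (\1_U).
Proof.
move=> mU; split; first exact: measurable_indic.
exists 1 => x; rewrite indicE; case: (_ \in _); by rewrite ?normr1 ?normr0.
Qed.

Lemma bmeas_sum (n : nat) (phi : nat -> X -> R) : (forall i, bmeas (phi i)) ->
  bmeas (fun x => \sum_(i < n) phi i x).
Proof.
move=> bphi; elim: n => [|n IH].
  by under eq_fun => x do rewrite big_ord0; exact: bmeas_cst.
by under eq_fun => x do rewrite big_ord_recr; exact: bmeasD.
Qed.

Lemma bmeas_comp phi F : bmeas phi -> measurable_fun [set: X] F -> bmeas (phi \o F).
Proof.
move=> [mphi [B hB]] mF; split; first exact: measurableT_comp.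
by exists B => x; exact: hB.
Qed.

Lemma Ex_cst (c : R) : Ex (fun=> c) = c.
Proof. by rewrite /Ex Rintegral_cst// -[fine _]/(prob [set: X]) probT mulr1. Qed.

Lemma ExD phi psi : bmeas phi -> bmeas psi ->
  Ex (fun x => phi x + psi x) = Ex phi + Ex psi.
Proof. by move=> b1 b2; rewrite /Ex RintegralD//; exact: bmeas_integrable. Qed.

Lemma ExZ (c : R) phi : bmeas phi -> Ex (fun x => c * phi x) = c * Ex phi.
Proof. by move=> b1; rewrite /Ex RintegralZl//; exact: bmeas_integrable. Qed.

Lemma Ex_le phi psi : bmeas phi -> bmeas psi -> (forall x, phi x <= psi x) ->
  Ex phi <= Ex psi.
Proof. by move=> b1 b2 h; rewrite /Ex le_Rintegral//; exact: bmeas_integrable. Qed.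

Lemma Ex_indic U : measurable U -> Ex (\1_U) = prob U.
Proof. by move=> mU; rewrite /Ex /Rintegral integral_indic// setIT. Qed.

Lemma Ex_sum (n : nat) (phi : nat -> X -> R) : (forall i, bmeas (phi i)) ->
  Ex (fun x => \sum_(i < n) phi i x) = \sum_(i < n) Ex (phi i).
Proof.
move=> bphi; elim: n => [|n IH].
  by under eq_fun => x do rewrite big_ord0; rewrite big_ord0 Ex_cst.
under eq_fun => x do rewrite big_ord_recr/=.
rewrite big_ord_recr/= -IH ExD//; exact: bmeas_sum.
Qed.

Lemma EFin_Ex phi : bmeas phi -> (Ex phi)%:E = (\int[mu]_x (phi x)%:E)%E.
Proof.
move=> b; rewrite /Ex /Rintegral fineK//.
by apply: (integrable_fin_num _ (bmeas_integrable b)).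
Qed.

Lemma Ex_comp phi F : measurable_fun [set: X] F ->
  (forall U, measurable U -> mu (F @^-1` U) = mu U) -> bmeas phi ->
  Ex (phi \o F) = Ex phi.
Proof.
move=> mF inv b; rewrite /Ex /Rintegral; congr fine.
transitivity (\int[pushforward mu F]_x (phi x)%:E)%E.
  rewrite (integral_pushforward mF)//; last first.
    by rewrite preimage_setT; apply: (bmeas_integrable (bmeas_comp b mF)).
  by apply/measurable_EFinP; case: b.
by apply: eq_measure_integral => U mU _; exact: inv.
Qed.

(** Markov's inequality for the number of indices [i] with [x] in [U i], whose expectation is at
    most [n * e]. *)
Lemma prob_count_le (n : nat) (U : nat -> set X) (s e : R) : 0 < s -> 0 <= e ->
  (forall i, measurable (U i)) ->
  (forall i, (i < n)%N -> prob (U i) <= e) ->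
  let V := [set x | s * n%:R < \sum_(i < n) \1_(U i) x] in
  measurable V /\ prob V * s <= e.
Proof.
move=> s0 e0 mU pU V.
have bU i : bmeas (\1_(U i)) by exact: bmeas_indic.
have bS := bmeas_sum n bU.
have mV : measurable V.
  have -> : V = [set: X] `&` (fun x => \sum_(i < n) \1_(U i) x) @^-1` `]s * n%:R, +oo[.
    by apply/seteqP; split => x; rewrite /V /= in_itv/= andbT; [|case].
  by apply: bS.1 => //; exact: measurable_itv.
split=> //; case: n pU @V bS mV => [|n] pU V bS mV.
  suff -> : V = set0 by rewrite /prob measure0 mul0r.
  by apply/seteqP; split => x; rewrite /V /= ?big_ord0 ?mulr0 ?ltxx.
have n0 : 0 < n.+1%:R :> R by rewrite ltr0n.
have h1 : Ex (fun x => (s * n.+1%:R) * \1_V x) <= Ex (fun x => \sum_(i < n.+1) \1_(U i) x).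
  apply: Ex_le => [||x]; [by apply: bmeasZ; exact: bmeas_indic|exact: bS|].
  have h0 : 0 <= \sum_(i < n.+1) \1_(U i) x :> R by apply: sumr_ge0 => i _; rewrite indicE.
  rewrite [in leLHS]indicE; have [|xV] := boolP (x \in V); last by rewrite mulr0.
  by rewrite inE /V /= mulr1 => /ltW.
move: h1; rewrite ExZ; last exact: bmeas_indic.
rewrite Ex_indic// (Ex_sum n.+1 bU) => h1.
have h2 : \sum_(i < n.+1) Ex (\1_(U i)) <= n.+1%:R * e.
  rewrite -[n.+1%:R]/(n.+1%:R) mulr_natl -[X in e *+ X]card_ord -sumr_const.
  by apply: ler_sum => i _; rewrite Ex_indic// pU.
rewrite -(ler_pM2l n0); lra.
Qed.

End Expectation.

Section LimSup.
Context {R : realType} (u : nat -> \bar R).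
Implicit Type c : \bar R.

Lemma limn_esup_gt c : (c < limn_esup u)%E ->
  forall n0, exists2 n, (n0 <= n)%N & (c < u n)%E.
Proof.
move=> h n0; apply: contrapT => H.
suff : (limn_esup u <= c)%E by rewrite leNgt h.
rewrite limn_esup_lim (cvg_lim _ (@cvg_esups_inf _ _))//.
apply: (@le_trans _ _ (esups u n0)).
  by apply: ereal_inf_lbound; exists n0.
apply: ge_ereal_sup => _ [n /= n0n <-]; rewrite leNgt; apply/negP => cu.
by apply: H; exists n.
Qed.

Lemma limn_esup_lt c : (limn_esup u < c)%E ->
  exists n0, forall n, (n0 <= n)%N -> (u n < c)%E.
Proof.
rewrite limn_esup_lim (cvg_lim _ (@cvg_esups_inf _ _))//.
move=> /ereal_inf_lt[_ [n0 _ <-]] h; exists n0 => n n0n.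
by apply: le_lt_trans h; apply: ereal_sup_ubound; exists n.
Qed.

Lemma limn_esup_le c n0 : (forall n, (n0 <= n)%N -> (u n <= c)%E) ->
  (limn_esup u <= c)%E.
Proof.
move=> h; rewrite leNgt; apply/negP => /limn_esup_gt/(_ n0)[n /h].
by rewrite leNgt => /negP.
Qed.

Lemma limn_esup_ge c : (forall n0, exists2 n, (n0 <= n)%N & (c <= u n)%E) ->
  (c <= limn_esup u)%E.
Proof.
move=> h; rewrite leNgt; apply/negP => /limn_esup_lt[n1 h1].
by have [n /h1] := h n1; rewrite ltNge => /negP.
Qed.

End LimSup.

Lemma bigger {R : realType} (r : R) : exists n : nat, (0 < n)%N /\ r <= n%:R.
Proof. by exists (Num.truncn r).+1; split => //; apply/ltW/truncnS_gt. Qed.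

Section MeasurableSets.
Context {R : realType} {dsp : measure_display} {X : measurableType dsp}.
Implicit Types phi psi : X -> R.

Lemma measurable_set_lt phi psi : measurable_fun [set: X] phi ->
  measurable_fun [set: X] psi -> measurable [set x | phi x < psi x].
Proof.
move=> m1 m2; have mb : measurable [set true] by [].
by have := measurable_fun_ltr m1 m2 measurableT mb; rewrite setTI.
Qed.

Lemma measurable_set_le phi psi : measurable_fun [set: X] phi ->
  measurable_fun [set: X] psi -> measurable [set x | phi x <= psi x].
Proof.
move=> m1 m2; have mb : measurable [set true] by [].
by have := measurable_fun_ler m1 m2 measurableT mb; rewrite setTI.
Qed.

End MeasurableSets.

Section Invariant.
Context {R : realType} {dsp : measure_display} {X : measurableType dsp}.
Context (mu : probability X R).

Lemma decreasing_prob (U : nat -> set X) : (forall n, measurable (U n)) ->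
  (forall n, U n.+1 `<=` U n) -> prob mu (\bigcap_(n in [set: nat]) U n) = 0 ->
  forall e : R, 0 < e -> exists n0, forall n, (n0 <= n)%N -> prob mu (U n) <= e.
Proof.
move=> mU dU U0 e e0.
have mI : measurable (\bigcap_(n in [set: nat]) U n) by exact: bigcapT_measurable.
have mono i j : (i <= j)%N -> U j `<=` U i.
  move=> /subnKC <-; elim: (j - i)%N => [|l IH]; first by rewrite addn0.
  by rewrite addnS => x /dU/IH.
have cv : mu \o U @ \oo --> mu (\bigcap_(n in [set: nat]) U n).
  apply: nonincreasing_cvg_mu => //.
    by rewrite ltey_eq fin_num_measure.
  by move=> i j ij; apply/subsetPset; exact: mono.
rewrite probE// U0 in cv.
have [n0 _ h] := iffLR (cvgrPdist_lt _ _) (fine_cvg cv) e e0.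
exists n0 => n nn; have := h n nn; rewrite /= sub0r normrN => h'.
by rewrite (le_trans (ler_norm _))// ltW.
Qed.

Context (F : X -> X) (mF : measurable_fun [set: X] F).
Context (inv : forall U, measurable U -> mu (F @^-1` U) = mu U).

Lemma measurable_iter n : measurable_fun [set: X] (iter n F).
Proof.
elim: n => [|n IH]; first exact: measurable_id.
exact: (measurableT_comp mF IH).
Qed.

Lemma invariant_iter n U : measurable U -> mu (iter n F @^-1` U) = mu U.
Proof.
move=> mU; elim: n => [|n IH] //.
rewrite -[in RHS]IH -[RHS]inv; last first.
  by rewrite -[X in measurable X]setTI; apply: measurable_iter.
congr (mu _); apply/seteqP; by split => x; rewrite /preimage/= -iterSr.
Qed.

Lemma prob_iter n U : measurable U -> prob mu (iter n F @^-1` U) = prob mu U.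
Proof. by move=> mU; rewrite /prob invariant_iter. Qed.

Lemma Ex_iter n phi : bmeas phi -> Ex mu (phi \o iter n F) = Ex mu phi.
Proof.
move=> b; apply: Ex_comp => //; first exact: measurable_iter.
by move=> U mU; exact: invariant_iter.
Qed.

(* The Katznelson-Weiss argument: cut an orbit greedily into blocks on which the
   average of [phi] is at least [c]. *)
Lemma Ex_ge_blocks (phi : X -> R) (c : R) : bmeas phi ->
  (forall e : R, 0 < e -> exists n,
     let V := [set x | forall k, (0 < k <= n)%N ->
                  \sum_(i < k) phi (iter i F x) < c * k%:R] in
     measurable V /\ prob mu V <= e) ->
  c <= Ex mu phi.
Proof.
move=> bphi H; have [mphi [B hB]] := bphi.
have B0 : 0 <= B by rewrite (le_trans _ (hB point)).
apply/ler_addgt0Pr => e e0.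
pose K := B + `|c| + 1; have K0 : 0 < K by rewrite /K; have := normr_ge0 c; lra.
have [n [mV pV]] := H (e / K) (divr_gt0 e0 K0).
set V := [set x | _] in mV pV.
have bV : bmeas (fun x => (B + `|c|) * \1_V x) by apply: bmeasZ; exact: bmeas_indic.
(* Outside [V] some block of length at most [n] has average at least [c]; on [V] the added term
   gives this to a block of length one. *)
pose psi x := phi x + (B + `|c|) * \1_V x.
have bpsi : bmeas psi by exact: bmeasD.
have phipsi x : phi x <= psi x.
  by rewrite /psi lerDl mulr_ge0 ?addr_ge0// indicE.
have psilo x : - B <= psi x.
  by apply: le_trans (phipsi x); have := hB x; rewrite ler_norml => /andP[].
(* The cutting stops when at most [n.+1] times remain; the unfinished piece costs at most
   [(B + |c|) * n.+1], independently of [T]. *)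
have Spsi : forall T x, c * T%:R - (B + `|c|) * n.+1%:R <= \sum_(i < T) psi (iter i F x).
  move=> T; elim/ltn_ind: T => T IH x.
  have [Tn|nT] := leqP T n.+1.
    have h1 : T%:R <= n.+1%:R :> R by rewrite ler_nat.
    have h2 : - B * T%:R <= \sum_(i < T) psi (iter i F x).
      rewrite mulr_natr -[X in _ *+ X]card_ord -sumr_const.
      by apply: ler_sum => i _.
    have h3 : c * T%:R <= `|c| * T%:R by rewrite ler_wpM2r// ler_norm.
    have h4 : (B + `|c|) * T%:R <= (B + `|c|) * n.+1%:R by rewrite ler_wpM2l// addr_ge0.
    by lra.
  have [k [k0 kn hk]] : exists k, [/\ (0 < k)%N, (k <= n.+1)%N &
      c * k%:R <= \sum_(i < k) psi (iter i F x)].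
    have [xV|xV] := pselect (V x).
      exists 1%N; split => //; rewrite big_ord_recl big_ord0 addr0 mulr1 /= /psi indicE.
      rewrite mem_set// mulr1; have := hB x; rewrite ler_norml => /andP[? _].
      by have := ler_norm c; lra.
    have [k /not_implyP[/andP[k0 kn] /negP]] : exists k, ~ ((0 < k <= n)%N ->
        \sum_(i < k) phi (iter i F x) < c * k%:R) by apply/existsNP.
    rewrite -leNgt => hk; exists k; split => //; first exact: leqW.
    by rewrite (le_trans hk)// ler_sum.
  have kT : (k <= T)%N by apply: (leq_trans kn); exact: ltnW.
  have -> : \sum_(i < T) psi (iter i F x) =
      \sum_(i < k) psi (iter i F x) + \sum_(i < T - k) psi (iter i F (iter k F x)).
    rewrite -!(big_mkord xpredT (fun i => psi (iter i F _))).
    rewrite (big_cat_nat _ kT)//=; congr (_ + _).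
    rewrite -{1}(add0n k) big_addn; apply: eq_bigr => i _.
    by rewrite iterD.
  have := IH (T - k)%N ltac:(lia) (iter k F x).
  rewrite natrB// => h; lra.
have Eit i : Ex mu (psi \o iter i F) = Ex mu psi by exact: Ex_iter.
have bit i : bmeas (psi \o iter i F) by apply: bmeas_comp => //; exact: measurable_iter.
have ET T : c * T%:R - (B + `|c|) * n.+1%:R <= T%:R * Ex mu psi.
  rewrite -(Ex_cst mu (c * _ - _)).
  apply: (le_trans (Ex_le mu (bmeas_cst _) (bmeas_sum T bit) (Spsi T))).
  rewrite (Ex_sum mu T bit); under eq_bigr => i _ do rewrite Eit.
  by rewrite sumr_const card_ord mulr_natl.
have cpsi : c <= Ex mu psi.
  rewrite leNgt; apply/negP => lt; have g0 : 0 < c - Ex mu psi by lra.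
  have [T [T0 hT]] := bigger (((B + `|c|) * n.+1%:R + 1) / (c - Ex mu psi)).
  move: hT; rewrite ler_pdivrMr// => hT; have := ET T; lra.
apply: (le_trans cpsi); rewrite /psi ExD// lerD2l ExZ; last exact: bmeas_indic.
rewrite Ex_indic//; apply: (@le_trans _ _ (K * prob mu V)).
  by rewrite ler_wpM2r ?prob_ge0// /K; lra.
by rewrite mulrC -ler_pdivlMr.
Qed.

End Invariant.

(** * Growth of the cocycle along invariant measures *)

Section Growth.
Context {R : realType} {dsp : measure_display} {X : measurableType dsp}.
Context (f : X -> X) {m : nat} (A : X -> 'M[R]_m) (C0 : R) (C0_ge0 : 0 <= C0).
Context (m0 : (0 < m)%N) (Au : forall x, A x \in unitmx)
  (hA : forall x, opnorm (A x) <= expR C0) (hA' : forall x, expands (expR C0) (A x)).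

(* [lnorm] and [chiR] are opaque: otherwise unification unfolds them. *)
Lemma lnorm_sig : {L : nat -> X -> R | forall n x, L n x = ln (opnorm (cocycle A f n x))}.
Proof. by exists (fun n x => ln (opnorm (cocycle A f n x))). Qed.

Definition lnorm : nat -> X -> R := projT1 lnorm_sig.

Lemma lnormE n x : lnorm n x = ln (opnorm (cocycle A f n x)).
Proof. exact: (projT2 lnorm_sig). Qed.

Lemma opnorm_cocycleE n x : opnorm (cocycle A f n x) = expR (lnorm n x).
Proof. by rewrite lnormE lnK// posrE opnorm_gt0// cocycle_unit. Qed.

Lemma lnorm_le (c : R) n x : (lnorm n x <= c) = (opnorm (cocycle A f n x) <= expR c).
Proof. by rewrite opnorm_cocycleE ler_expR. Qed.

Lemma lnorm_ge (c : R) n x : (c <= lnorm n x) = (expR c <= opnorm (cocycle A f n x)).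
Proof. by rewrite opnorm_cocycleE ler_expR. Qed.

Lemma lnorm_subadd n k x : lnorm (n + k) x <= lnorm n x + lnorm k (iter n f x).
Proof.
rewrite lnorm_le addrC expRD -!opnorm_cocycleE cocycleD; exact: opnormM.
Qed.

Lemma lnormD_le_l n k x : lnorm (n + k) x <= C0 * n%:R + lnorm k (iter n f x).
Proof. by rewrite lnorm_le expRD -opnorm_cocycleE cocycleD_le_l. Qed.

Lemma lnormD_le_r n k x : lnorm (n + k) x <= C0 * k%:R + lnorm n x.
Proof. by rewrite lnorm_le expRD -opnorm_cocycleE cocycleD_le_r. Qed.

Lemma lnormD_ge_l n k x : lnorm k (iter n f x) <= C0 * n%:R + lnorm (n + k) x.
Proof. by rewrite lnorm_le expRD -opnorm_cocycleE; apply: cocycleD_ge_l. Qed.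

Lemma lnormD_ge_r n k x : lnorm n x <= C0 * k%:R + lnorm (n + k) x.
Proof. by rewrite lnorm_le expRD -opnorm_cocycleE; apply: cocycleD_ge_r. Qed.

Lemma lnorm0 x : lnorm 0 x = 0.
Proof.
have h : 1 <= opnorm (1%:M : 'M[R]_m).
  pose v : 'cV[R]_m := const_mx 1.
  have v0 : 0 < vnorm v.
    rewrite lt0r vnorm_ge0 andbT; apply/negP => /eqP/vnorm_eq0.
    move=> /matrixP/(_ (Ordinal m0) ord0); rewrite !mxE => /eqP.
    by rewrite oner_eq0.
  by have := le_opnorm 1%:M v; rewrite mul1mx ler_pMl.
have -> : lnorm 0 x = ln 1; last exact: ln1.
by rewrite lnormE /=; congr ln; apply/eqP; rewrite eq_le h opnorm1_le.
Qed.

Lemma lnorm_bound n x : `|lnorm n x| <= C0 * n%:R.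
Proof.
rewrite ler_norml; apply/andP; split.
  have := lnormD_ge_r 0 n x; rewrite add0n lnorm0; lra.
by have := lnormD_le_r 0 n x; rewrite add0n lnorm0; lra.
Qed.

Lemma lnorm_blocks k N x : lnorm (k * N) x <= \sum_(i < k) lnorm N (iter (i * N) f x).
Proof.
elim: k => [|k IH]; first by rewrite big_ord0 lnorm0.
rewrite mulSn addnC big_ord_recr/= (le_trans (lnorm_subadd _ _ _))//.
by rewrite lerD2r.
Qed.

Lemma lyapE n x : (0 < n)%N -> lyap_seq A f x n = lnorm n x / n%:R.
Proof. by move=> n0; rewrite /lyap_seq lnormE mulrC. Qed.

Lemma chi_pt_bound x : ((- C0)%:E <= chi_pt A f x <= C0%:E)%E.
Proof.
have h n : (0 < n)%N -> `|lyap_seq A f x n| <= C0.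
  move=> n0; have n0' : 0 < n%:R :> R by rewrite ltr0n.
  by rewrite lyapE// normrM normfV (gtr0_norm n0') ler_pdivrMr// lnorm_bound.
apply/andP; split.
  apply: limn_esup_ge => n; exists n.+1; first exact: leqnSn.
  by rewrite lee_fin; have := h n.+1 isT; rewrite ler_norml => /andP[].
apply: (@limn_esup_le _ _ _ 1) => n n0.
by rewrite lee_fin (le_trans (ler_norm _))// h.
Qed.

Lemma chiR_sig : {g : X -> R | forall x, chi_pt A f x = (g x)%:E}.
Proof.
exists (fun x => fine (chi_pt A f x)) => x.
have /andP[h1 h2] := chi_pt_bound x; rewrite fineK//.
by rewrite fin_numE; apply/andP; split; apply/eqP => E; rewrite E in h1 h2.
Qed.

Definition chiR : X -> R := projT1 chiR_sig.

Lemma chi_ptE x : chi_pt A f x = (chiR x)%:E.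
Proof. exact: (projT2 chiR_sig). Qed.

Lemma chiR_bound x : `|chiR x| <= C0.
Proof. by have := chi_pt_bound x; rewrite chi_ptE !lee_fin ler_norml. Qed.

Lemma chiR_lt (c : R) x : chiR x < c -> exists n0, forall n, (n0 <= n)%N ->
  lnorm n x <= c * n%:R.
Proof.
move=> h; have : (chi_pt A f x < c%:E)%E by rewrite chi_ptE lte_fin.
move=> /limn_esup_lt[n0 hn]; exists n0.+1 => n n0n.
have n0' : 0 < n%:R :> R by rewrite ltr0n; lia.
by have := hn n (ltnW n0n); rewrite lte_fin lyapE ?ltr_pdivrMr//; [move=> /ltW|lia].
Qed.

Lemma chiR_gt (c : R) x : c < chiR x -> forall n0, exists2 n, (n0 <= n)%N &
  c * n%:R < lnorm n x.
Proof.
move=> h n0; have : (c%:E < chi_pt A f x)%E by rewrite chi_ptE lte_fin.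
move=> /limn_esup_gt/(_ n0.+1)[n n0n hn]; exists n; first exact: ltnW.
have n0' : 0 < n%:R :> R by rewrite ltr0n; lia.
by move: hn; rewrite lte_fin lyapE ?ltr_pdivlMr//; lia.
Qed.

(** A shift of time by [s] and an additive error [K] disappear after division by [n]. Used with a
    point and its image, in both orders. *)
Lemma chiR_le_shift x y (s : nat) (K : R) : 0 <= K ->
  (forall n, lnorm n y <= lnorm (n + s) x + K) -> chiR y <= chiR x.
Proof.
move=> K0 H; rewrite leNgt; apply/negP => lt.
pose e := (chiR y - chiR x) / 3; have e0 : 0 < e by rewrite /e; lra.
have [n1 h1] := @chiR_lt (chiR x + e) x ltac:(lra).
have [n2 [_ h2]] := bigger ((`|chiR x + e| * s%:R + K) / e).
have [n nn hn] := @chiR_gt (chiR x + 2 * e) y ltac:(rewrite /e; lra) (maxn n1 n2).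
have := h1 (n + s)%N ltac:(lia); have := H n; rewrite natrD.
have n2n : n2%:R <= n%:R :> R by rewrite ler_nat; lia.
have : `|chiR x + e| * s%:R + K <= e * n%:R.
  by rewrite [leRHS]mulrC -ler_pdivrMr// (le_trans h2).
have : (chiR x + e) * s%:R <= `|chiR x + e| * s%:R by rewrite ler_wpM2r// ler_norm.
lra.
Qed.

Lemma chiR_inv x : chiR (f x) = chiR x.
Proof.
apply/eqP; rewrite eq_le; apply/andP; split.
  apply: (@chiR_le_shift _ _ 1 C0) => // n.
  by have := lnormD_ge_l 1 n x; rewrite add1n addn1 /=; lra.
apply: (@chiR_le_shift _ _ 0 (2 * C0)) => [|n]; first by rewrite mulr_ge0.
rewrite addn0; case: n => [|n]; first by rewrite !lnorm0 add0r mulr_ge0.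
have := lnormD_le_l 1 n x; rewrite add1n /=.
by have := lnormD_ge_r n 1 (f x); rewrite addn1 mulr1; lra.
Qed.

Context (mf : measurable_fun [set: X] f).
Context (mL : forall n, measurable_fun [set: X] (lnorm n)).

Lemma lnorm_bmeas n : bmeas (lnorm n).
Proof. by split => //; exists (C0 * n%:R) => x; exact: lnorm_bound. Qed.

Lemma chiR_bmeas : bmeas chiR.
Proof.
split; last by exists C0 => x; exact: chiR_bound.
apply/measurable_EFinP.
have -> : EFin \o chiR = (fun x => limn_esup (fun n => (lyap_seq A f x n)%:E)).
  by apply/funext => x /=; rewrite -chi_ptE.
apply: measurable_fun_limn_esup => n; apply/measurable_EFinP.
have -> : (fun x => lyap_seq A f x n) = (fun x => n%:R^-1 * lnorm n x).
  by apply/funext => x; rewrite /lyap_seq lnormE.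
exact: measurable_funM.
Qed.

Lemma measurable_lnorm_gt (phi : X -> R) n : measurable_fun [set: X] phi ->
  measurable [set x | phi x < lnorm n x].
Proof. by move=> mphi; exact: measurable_set_lt. Qed.

Context (mu : probability X R) (imu : Defs.invariant f mu).

Lemma chi_muE : chi_mu A f mu = (Ex mu chiR)%:E.
Proof.
rewrite EFin_Ex; last exact: chiR_bmeas.
by apply: eq_integral => x _; rewrite chi_ptE.
Qed.

(** Since [chiR x] is a limsup, the sets of points violating the bound at some time after [n]
    decrease to the empty set. *)
Lemma lnorm_le_chiR (e g : R) : 0 < e -> 0 < g -> exists n0, forall n, (n0 <= n)%N ->
  let U := [set x | (chiR x + e) * n%:R < lnorm n x] in
  measurable U /\ prob mu U <= g.
Proof.
move=> e0 g0.
pose U1 n := [set x | (chiR x + e) * n%:R < lnorm n x].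
have mU1 n : measurable (U1 n).
  apply: measurable_lnorm_gt; apply: measurable_funM => //.
  by apply: measurable_funD => //; exact: chiR_bmeas.1.
pose U n := \bigcup_(k in [set k | (n <= k)%N]) U1 k.
have mU n : measurable (U n) by exact: bigcup_measurable.
have dU n : U n.+1 `<=` U n.
  by move=> x [k /= nk ?]; exists k => //=; exact: ltnW.
have U0 : prob mu (\bigcap_(n in [set: nat]) U n) = 0.
  suff -> : \bigcap_(n in [set: nat]) U n = set0 by rewrite /prob measure0.
  apply/seteqP; split => // x Ux.
  have [n0 h] := @chiR_lt (chiR x + e) x ltac:(lra).
  have [k /= nk] := Ux n0 I; rewrite /U1 /= ltNge => /negP; apply; exact: h.
have [n0 h] := decreasing_prob mU dU U0 g0.
exists n0 => n nn; split; first exact: mU1.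
apply: (le_trans _ (h n nn)); apply: prob_le; [exact: mU1|exact: mU|by move=> x Ux; exists n => /=].
Qed.

(** On the exceptional set of [lnorm_le_chiR] only the trivial bound [C0] per step is available; it
    exceeds [chiR] by less than [K], and the set has measure at most [e / (2 * K)]. *)
Lemma integral_lnorm_le (e : R) : 0 < e -> exists2 w, (0 < w)%N &
  Ex mu (lnorm w) <= (Ex mu chiR + e) * w%:R.
Proof.
move=> e0.
pose K := 2 * C0 + e; have K0 : 0 < K by move: C0_ge0; rewrite /K; lra.
have [n0 h] := @lnorm_le_chiR (e / 2) (e / (2 * K)) ltac:(lra) ltac:(by rewrite divr_gt0// mulr_gt0).
exists n0.+1 => //; set n := n0.+1; have n0' : 0 < n%:R :> R by rewrite ltr0n.
have [mU pU] := h n (leqnSn _); set U := [set x | _] in mU pU.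
have bU : bmeas (\1_U : X -> R) by exact: bmeas_indic.
have bc := chiR_bmeas.
have b1 : bmeas (fun x => chiR x + (e / 2 + K * \1_U x)).
  by apply: bmeasD => //; apply: bmeasD; [exact: bmeas_cst|exact: bmeasZ].
have : Ex mu (lnorm n) <= Ex mu (fun x => n%:R * (chiR x + (e / 2 + K * \1_U x))).
  apply: Ex_le; [exact: lnorm_bmeas|exact: bmeasZ|move=> x].
  rewrite indicE; have [|xU] := boolP (x \in U).
    rewrite inE => _; rewrite mulr1.
    have := lnorm_bound n x; rewrite ler_norml => /andP[_ h1].
    apply: (le_trans h1); rewrite mulrC ler_wpM2l//.
    by have := chiR_bound x; rewrite ler_norml /K => /andP[]; lra.
  rewrite mulr0 addr0 mulrC leNgt; apply/negP => h1; move: xU.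
  by rewrite notin_setE; apply; rewrite /U /=.
rewrite ExZ// ExD//; last by apply: bmeasD; [exact: bmeas_cst|exact: bmeasZ].
rewrite ExD//; [|exact: bmeas_cst|exact: bmeasZ].
rewrite Ex_cst ExZ// Ex_indic// => h1; apply: (le_trans h1).
rewrite mulrC ler_wpM2r// lerD2l.
have : K * prob mu U <= e / 2.
  rewrite mulrC -ler_pdivlMr// (le_trans pU)//.
  by rewrite invfM mulrA.
lra.
Qed.

(** By invariance the sum over [Q] blocks has mean [Q] times that of one block, and some orbit does
    not exceed the mean. The block length [w] is independent of [Q], so one perturbation radius will
    serve segments of all lengths. *)
Lemma low_orbit (e : R) : 0 < e -> exists2 w, (0 < w)%N & forall Q, exists y,
  \sum_(i < Q) lnorm w (iter (i * w) f y) <= (Ex mu chiR + e) * (Q * w)%:R.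
Proof.
move=> e0; have [w w0 hw] := @integral_lnorm_le (e / 2) ltac:(lra).
exists w => // Q; apply: contrapT => H.
case: Q H => [|Q] H.
  by apply: H; exists point; rewrite big_ord0 mul0n mulr0.
have bi i : bmeas (lnorm w \o iter (i * w) f).
  by apply: bmeas_comp; [exact: lnorm_bmeas|exact: measurable_iter].
have : Ex mu (fun=> (Ex mu chiR + e) * (Q.+1 * w)%:R) <=
   Ex mu (fun y => \sum_(i < Q.+1) (lnorm w \o iter (i * w) f) y).
  apply: Ex_le; [exact: bmeas_cst|exact: (bmeas_sum Q.+1 bi)|move=> y].
  by rewrite leNgt; apply/negP => h; apply: H; exists y; exact: ltW.
rewrite Ex_cst (Ex_sum mu Q.+1 bi).
have Ei i : Ex mu (lnorm w \o iter (i * w) f) = Ex mu (lnorm w).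
  by apply: (Ex_iter mf imu); exact: lnorm_bmeas.
under eq_bigr => i _ do rewrite Ei.
rewrite sumr_const card_ord -[leRHS]mulr_natl natrM.
have Q0 : 0 < Q.+1%:R :> R by rewrite ltr0n.
rewrite mulrCA ler_pM2l// => h.
have w0' : 0 < w%:R :> R by rewrite ltr0n.
have : 0 < e * w%:R by rewrite mulr_gt0.
lra.
Qed.

Context (erg : ergodic f mu).

(** The set is invariant, hence of measure [0] or [1]; measure [1] would raise the mean of [chiR]
    above itself. *)
Lemma chiR_gt_null (e : R) : 0 < e -> prob mu [set x | Ex mu chiR + e < chiR x] = 0.
Proof.
move=> e0; set c := Ex mu chiR + e; set S := [set x | _].
have mS : measurable S.
  apply: measurable_set_lt => //; exact: chiR_bmeas.1.
have SE : f @^-1` S = S by apply/seteqP; split => x; rewrite /S /= chiR_inv.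
have [/(congr1 fine)|S1] := erg.2 S mS SE; first by [].
have bc := chiR_bmeas; have b1 : bmeas (\1_S : X -> R) by exact: bmeas_indic.
have b2 : bmeas (fun x => - C0 + (c + C0) * \1_S x).
  by apply: bmeasD; [exact: bmeas_cst|exact: bmeasZ].
have : Ex mu (fun x => - C0 + (c + C0) * \1_S x) <= Ex mu chiR.
  apply: Ex_le => // x; have := chiR_bound x; rewrite ler_norml => /andP[h1 h2].
  rewrite indicE; have [|xS] := boolP (x \in S); last by rewrite mulr0 addr0.
  by rewrite inE /S /= mulr1 => h; lra.
rewrite ExD//; [|exact: bmeas_cst|exact: bmeasZ].
rewrite Ex_cst ExZ// Ex_indic//.
by rewrite [prob _ _](_ : _ = 1) ?/prob ?S1// /c; lra.
Qed.

Lemma chiR_lt_null (e : R) : 0 < e -> prob mu [set x | chiR x < Ex mu chiR - e] = 0.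
Proof.
move=> e0; set c := Ex mu chiR - e; set S := [set x | _].
have mS : measurable S.
  apply: measurable_set_lt => //; exact: chiR_bmeas.1.
have SE : f @^-1` S = S by apply/seteqP; split => x; rewrite /S /= chiR_inv.
have [/(congr1 fine)|S1] := erg.2 S mS SE; first by [].
have bc := chiR_bmeas; have b1 : bmeas (\1_S : X -> R) by exact: bmeas_indic.
have b2 : bmeas (fun x => C0 + (c - C0) * \1_S x).
  by apply: bmeasD; [exact: bmeas_cst|exact: bmeasZ].
have : Ex mu chiR <= Ex mu (fun x => C0 + (c - C0) * \1_S x).
  apply: Ex_le => // x; have := chiR_bound x; rewrite ler_norml => /andP[h1 h2].
  rewrite indicE; have [|xS] := boolP (x \in S); last by rewrite mulr0 addr0.
  by rewrite inE /S /= mulr1 => h; lra.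
rewrite ExD//; [|exact: bmeas_cst|exact: bmeasZ].
rewrite Ex_cst ExZ// Ex_indic//.
by rewrite [prob _ _](_ : _ = 1) ?/prob ?S1// /c; lra.
Qed.

Lemma lnorm_upper (e g : R) : 0 < e -> 0 < g -> exists n0, forall n, (n0 <= n)%N ->
  let U := [set x | (Ex mu chiR + e) * n%:R < lnorm n x] in
  measurable U /\ prob mu U <= g.
Proof.
move=> e0 g0; have [n0 h] := @lnorm_le_chiR (e / 2) g ltac:(lra) g0.
exists n0 => n nn U; have mU : measurable U by exact: measurable_lnorm_gt.
have [mV pV] := h n nn; set V := [set x | _] in mV pV; split => //.
pose S := [set x | Ex mu chiR + e / 2 < chiR x].
have S0 : prob mu S = 0 by apply: chiR_gt_null; lra.
have mS : measurable S.
  apply: measurable_set_lt => //; exact: chiR_bmeas.1.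
have : prob mu U <= prob mu (S `|` V).
  apply: prob_le => //; first exact: measurableU.
  move=> x Ux; have [xS|/negP xS] := boolP (`[< S x >]); first by left; exact/asboolP.
  right; rewrite /V /=; apply: le_lt_trans Ux; rewrite ler_wpM2r//.
  have : ~ S x by move=> /asboolP.
  rewrite /S /= => /negP; rewrite -leNgt; lra.
have : prob mu (S `|` V) <= prob mu S + prob mu V.
  exact: probU2.
lra.
Qed.

(** The lower half of Kingman's theorem for integrals: almost every orbit has long times [n] with
    [lnorm n x] close to [Ex mu chiR * n], and subadditivity gives the same for a sum of [N]-blocks.
    [Ex_ge_blocks] is applied to [iter N f], which preserves [mu] but may fail to be ergodic;
    ergodicity enters through [chiR_lt_null] for [f]. *)
Lemma integral_lnorm_ge N : (0 < N)%N -> Ex mu chiR * N%:R <= Ex mu (lnorm N).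
Proof.
move=> N0; have N0' : 0 < N%:R :> R by rewrite ltr0n.
have mfN : measurable_fun [set: X] (iter N f) by exact: measurable_iter.
have iN U : measurable U -> mu (iter N f @^-1` U) = mu U by exact: invariant_iter.
apply/ler_addgt0Pr => e e0; rewrite -lerBlDr.
pose e' := e / N%:R; have e'0 : 0 < e' by rewrite divr_gt0.
have -> : Ex mu chiR * N%:R - e = (Ex mu chiR - e') * N%:R.
  by rewrite mulrBl /e' divfK// gt_eqF.
set c := (Ex mu chiR - e') * N%:R.
apply: (Ex_ge_blocks mfN iN); first exact: lnorm_bmeas.
move=> g g0.
have itE i x : iter i (iter N f) x = iter (i * N) f x.
  by elim: i => //= i ->; rewrite mulSn iterD.
pose S k := [set x | c * k%:R <= \sum_(i < k) lnorm N (iter i (iter N f) x)].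
have mS k : measurable (S k).
  apply: measurable_set_le => //.
  have bi i : bmeas (lnorm N \o iter i (iter N f)).
    by apply: bmeas_comp; [exact: lnorm_bmeas|exact: measurable_iter].
  exact: (bmeas_sum k bi).1.
pose V n := [set x | forall k, (0 < k <= n)%N ->
   \sum_(i < k) lnorm N (iter i (iter N f) x) < c * k%:R].
have VE n : V n = \bigcap_(k in [set k | (0 < k <= n)%N]) ~` S k.
  apply/seteqP; split => x h k /h; rewrite /S /= ?ltNge => h1.
    exact/negP.
  by apply/negP.
have mV n : measurable (V n).
  by rewrite VE -setC_bigcup; apply: measurableC; exact: bigcup_measurable.
have dV n : V n.+1 `<=` V n.
  by move=> x h k /andP[k0 kn]; apply: h; rewrite k0 leqW.
have V0 : prob mu (\bigcap_(n in [set: nat]) V n) = 0.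
  apply/eqP; rewrite eq_le prob_ge0 andbT -(@chiR_lt_null (e' / 3)); last lra.
  apply: prob_le; first exact: bigcapT_measurable.
    apply: measurable_set_lt => //; exact: chiR_bmeas.1.
  move=> x Vx /=; rewrite ltNge; apply/negP => hx.
  pose a := Ex mu chiR - 2 * e' / 3.
  have [n2 [_ h2]] := bigger ((2 * C0 * N%:R + 3 * `|a| * N%:R) / (e' / 3)).
  have [n nn hn] := @chiR_gt a x ltac:(rewrite /a; lra) n2.
  (* Rounding [n] up to a multiple of [N] costs at most [C0 * N], which is negligible because
     [n >= n2]. *)
  pose k := (n %/ N).+1.
  have kN : (n <= k * N)%N by rewrite /k; exact/ltnW/ltn_ceil.
  have kN' : (k * N <= n + N)%N by rewrite /k mulSn addnC leq_add2r leq_divM.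
  have := Vx k I k; rewrite leqnn => /(_ erefl); rewrite ltNge => /negP; apply.
  have h3 := lnorm_blocks k N x.
  under eq_bigr => i _ do rewrite itE.
  apply: le_trans h3.
  have h4 := lnormD_ge_r n (k * N - n) x; rewrite subnKC// in h4.
  have h5 : (k * N - n)%:R <= N%:R :> R by rewrite ler_nat leq_subLR.
  have h6 : C0 * (k * N - n)%:R <= C0 * N%:R by rewrite ler_wpM2l.
  have n2n : n2%:R <= n%:R :> R by rewrite ler_nat.
  have h7 : 2 * C0 * N%:R + 3 * `|a| * N%:R <= e' / 3 * n%:R.
    rewrite [leRHS]mulrC -ler_pdivrMr; last lra.
    exact: le_trans h2 n2n.
  have h8 : c * k%:R = (Ex mu chiR - e') * (k * N)%:R by rewrite /c natrM; ring.
  have h9 : (k * N)%:R = n%:R + (k * N - n)%:R :> R by rewrite -natrD subnKC.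
  rewrite h8 h9; set r : R := (k * N - n)%:R in h4 h5 h6 *.
  have r0 : 0 <= r by rewrite /r.
  have ha : (Ex mu chiR - e') * r <= `|a| * N%:R.
    apply: (@le_trans _ _ (`|a| * r)); last by rewrite ler_wpM2l.
    by rewrite ler_wpM2r//; have := ler_norm a; rewrite {1}/a; lra.
  have ha0 : 0 <= `|a| * N%:R by rewrite mulr_ge0.
  have hC : 0 <= C0 * N%:R by rewrite mulr_ge0.
  rewrite /a in hn ha h7 ha0 *; lra.
have [n0 h] := decreasing_prob mV dV V0 g0.
by exists n0; split; [exact: mV|exact: h].
Qed.

(** The mean of [lnorm n] is at least [chi * n] and upward deviations are rare, so downward
    deviations must be rare too. They lower the mean by [e * prob mu U], against at most
    [2 * e1 = e * g] gained elsewhere. *)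
Lemma lnorm_lower (e g : R) : 0 < e -> 0 < g -> exists n0, forall n, (n0 <= n)%N ->
  let U := [set x | lnorm n x < (Ex mu chiR - e) * n%:R] in
  measurable U /\ prob mu U <= g.
Proof.
move=> e0 g0; set chi := Ex mu chiR.
pose K := C0 + `|chi| + 1; have K0 : 0 < K.
  by move: C0_ge0; rewrite /K; have := normr_ge0 chi; lra.
pose e1 := e * g / 2; have e10 : 0 < e1 by rewrite /e1; nra.
pose g1 := e1 / K; have g10 : 0 < g1 by rewrite divr_gt0.
have [n0 h] := lnorm_upper e10 g10; exists n0.+1 => n nn U.
have n0' : 0 < n%:R :> R by rewrite ltr0n; lia.
have mU : measurable U.
  by exact: measurable_set_lt.
have [mV pV] := h n (ltnW nn); set V := [set x | _] in mV pV; split => //.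
have bU : bmeas (\1_U : X -> R) by exact: bmeas_indic.
have bV : bmeas (\1_V : X -> R) by exact: bmeas_indic.
have bUV : bmeas (fun x => K * \1_V x + (- e) * \1_U x) by apply: bmeasD; exact: bmeasZ.
have b1 : bmeas (fun x => (chi + e1) + (K * \1_V x + (- e) * \1_U x)).
  by apply: bmeasD => //; exact: bmeas_cst.
have := integral_lnorm_ge (leq_trans (ltn0Sn _) nn); rewrite -/chi => h1.
have : Ex mu (lnorm n) <= Ex mu (fun x => n%:R * ((chi + e1) + (K * \1_V x + (- e) * \1_U x))).
  apply: Ex_le; [exact: lnorm_bmeas|exact: bmeasZ|move=> x].
  rewrite !indicE; have [xU|xU] := boolP (x \in U); have [xV|xV] := boolP (x \in V); rewrite ?mulr1 ?mulr0.
  - move: xU xV; rewrite !inE /U /V /= => xU xV.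
    have := lt_trans xV xU; rewrite ltr_pM2r// -/chi; lra.
  - move: xU; rewrite inE /U /= -/chi => xU; rewrite mulrC.
    by apply: (le_trans (ltW xU)); rewrite ler_wpM2r//; lra.
  - have := lnorm_bound n x; rewrite ler_norml => /andP[_ h2].
    apply: (le_trans h2); rewrite mulrC ler_wpM2l//.
    by rewrite /K; have := ler_norm (- chi); rewrite normrN; lra.
  - move: xV; rewrite notin_setE /V /= -/chi => /negP; rewrite -leNgt => h2.
    by apply: (le_trans h2); rewrite mulrC ler_wpM2l//; lra.
rewrite ExZ// ExD//; last exact: bmeas_cst.
rewrite (ExD mu (bmeasZ K bV) (bmeasZ (- e) bU)).
rewrite Ex_cst !ExZ// !Ex_indic// => h2.
have := le_trans h1 h2; rewrite mulrC ler_pM2l// => h3.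
have h4 : K * prob mu V <= e1 by rewrite mulrC -ler_pdivlMr.
have : e * prob mu U <= e * g by rewrite /e1 in h3 h4; lra.
by rewrite ler_pM2l.
Qed.

End Growth.

(** * Orbit segments with prescribed growth under shadowing *)

Section Segments.
Context {R : realType} {dsp : measure_display} {X : measurableType dsp}.
Context (d : X -> X -> R) (dm : is_metric d).
Context (hm : (@measurable dsp X) = <<s dopen d >>).
Context (f : X -> X) (cf : dcontinuous d f).
Context {m : nat} (A : X -> 'M[R]_m) (C0 C alpha lam : R) (C0_ge0 : 0 <= C0).
Context (m0 : (0 < m)%N) (Au : forall x, A x \in unitmx)
  (hA : forall x, opnorm (A x) <= expR C0) (hA' : forall x, expands (expR C0) (A x)).
Context (C_ge0 : 0 <= C) (alpha0 : 0 < alpha)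
  (lam0 : 0 < lam) (hol : forall x y, opnorm (A x - A y) <= C * d x y `^ alpha).

Let L := lnorm f A.
Let chi := chiR f m0 Au hA hA'.

Let mf : measurable_fun [set: X] f.
Proof. exact: (dcontinuous_measurable hm). Qed.

Let mL n : measurable_fun [set: X] (L n).
Proof.
have -> : L n = fun x => ln (opnorm (cocycle A f n x)).
  by apply/funext => x; rewrite /L lnormE.
exact: (lnorm_measurable dm hm C0_ge0 hA C_ge0 alpha0 hol cf).
Qed.

Let inv_iter (mu : probability X R) (imu : Defs.invariant f mu) n U :
  measurable U -> measurable (iter n f @^-1` U) /\ prob mu (iter n f @^-1` U) = prob mu U.
Proof.
move=> mU; split; last exact: prob_iter.
by rewrite -[X in measurable X]setTI; apply: measurable_iter.
Qed.

(** The hypotheses of [robust_growth] are finitely many events of large measure. [W] is fixed before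
    the tolerance [g]: it becomes the number of levels of a tree, and the tolerance used there
    depends on that number. *)
Lemma good_set (mu : probability X R) (eps : R) (W0 : nat) :
  ergodic f mu -> 0 < eps ->
  exists W : nat, [/\ (W0 <= W)%N, (0 < W)%N & forall g : R, 0 < g ->
    exists w0, forall w, (w0 <= w)%N ->
    exists G : set X, [/\ measurable G, prob mu (~` G) <= g &
    forall x p, G x -> (forall j, (j < W * w)%N ->
      d (iter j f p) (iter j f x) <= expR (- lam * (minn j (W * w - j))%:R)) ->
      (Ex mu chi - eps) * (W * w)%:R <= L (W * w) p /\
      L (W * w) p <= (Ex mu chi + eps) * (W * w)%:R]].
Proof.
move=> erg eps0; have imu := erg.1.
have [D [W [w0 [e' [e'0 WW0 DW rob]]]]] :=
  robust_growth f Au C0_ge0 hA hA' C_ge0 alpha0 lam0 hol dm (Ex mu chi) W0 eps0.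
exists W; split => //; first by apply: leq_ltn_trans DW.
move=> g g0; have g1 : 0 < g / W.+1%:R by rewrite divr_gt0// ltr0n.
have [n1 h1] := lnorm_upper C0_ge0 m0 Au hA hA' mL erg e'0 g1.
have [n2 h2] := lnorm_lower C0_ge0 m0 Au hA hA' mf mL imu erg e'0 g1.
exists (n1 + n2 + w0).+1.
move=> w ww; pose n := (W - D.*2)%N.
have n0 : (0 < n)%N by rewrite subn_gt0.
have nw2 : (n2 <= n * w)%N by rewrite (leq_trans _ (leq_pmull _ n0))//; lia.
have [mU pU] := h1 w ltac:(lia); set U := [set x | _] in mU pU.
have [mV pV] := h2 _ nw2; set V := [set x | _] in mV pV.
(* For [i < W] the [i]-th window grows too fast; the last index stands for the middle stretch
   growing too slowly. *)
pose B (i : 'I_W.+1) := if (i < W)%N then iter (i * w) f @^-1` U else iter (D * w) f @^-1` V.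
have mB i : measurable (B i).
  by rewrite /B; case: ifP => _; apply: (inv_iter imu _ _).1.
have pB i : prob mu (B i) <= g / W.+1%:R.
  by rewrite /B; case: ifP => _; rewrite (inv_iter imu _ _).2.
pose Bad := \bigcup_(i in [set: 'I_W.+1]) B i.
have mBad : measurable Bad by exact: fin_bigcup_measurable.
exists (~` Bad); split; first exact: measurableC.
  rewrite setCK (le_trans (prob_bigU _ mB))//.
  apply: (@le_trans _ _ (\sum_(i < W.+1) g / W.+1%:R)); first exact: ler_sum.
  by rewrite sumr_const card_ord -[leLHS]mulr_natr divfK// pnatr_eq0.
move=> x p xG Hp.
have notB i : ~ B i x by move=> ?; apply: xG; exists i.
rewrite (lnorm_le f m0 Au) (lnorm_ge f m0 Au).
apply: (rob w _ x _ _ p Hp); first by nlia.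
  move=> i iW; rewrite -(lnorm_le f m0 Au) leNgt; apply/negP => h.
  by apply: (notB (Ordinal (ltnW iW : (i < W.+1)%N))); rewrite /B /= iW.
rewrite -/n -(lnorm_ge f m0 Au) leNgt; apply/negP => h.
by apply: (notB ord_max); rewrite /B /= ltnn.
Qed.

Lemma low_segments (nu : probability X R) (e : R) : Defs.invariant f nu -> 0 < e ->
  exists w, (0 < w)%N /\ exists2 tau0 : R, 0 < tau0 & forall Q, exists y, forall p,
    (forall j, (j < Q * w)%N -> d (iter j f p) (iter j f y) <= tau0) ->
    L (Q * w) p <= (Ex nu chi + e) * (Q * w)%:R.
Proof.
move=> inu e0.
have e20 : 0 < e / 2 by lra.
have [w w0 hw] := low_orbit C0_ge0 m0 Au hA hA' mf mL inu e20.
exists w; split => //.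
have wr0 : 0 < w%:R :> R by rewrite ltr0n.
(* A block has norm at least [expR (- (C0 * w))], so with this [del] its relative error is at most
   [e / 2 * w], and [1 + e / 2 * w <= expR (e / 2 * w)]. *)
pose del := e / 2 / expR (2 * C0 * w%:R).
have del0 : 0 < del by rewrite divr_gt0// expR_gt0.
have [r r0 hr] := holder_small dm C_ge0 alpha0 hol del0.
exists r => // Q; have [y hy] := hw Q; exists y => p hp.
apply: (le_trans (lnorm_blocks f m0 Au Q w p)).
have step i : (i < Q)%N -> L w (iter (i * w) f p) <= L w (iter (i * w) f y) + e / 2 * w%:R.
  move=> iQ; set p' := iter _ f p; set y' := iter _ f y.
  have pert : opnorm (cocycle A f w p' - cocycle A f w y') <= w%:R * expR (C0 * w%:R) * del.
    apply: cocycle_perturb => //; first exact: ltW.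
    move=> j jw; apply: hr; rewrite -!iterD; apply: hp.
    by have : (i.+1 * w <= Q * w)%N; [rewrite leq_mul2r iQ orbT|rewrite mulSn; lia].
  rewrite (lnorm_le f m0 Au).
  apply: (le_trans (opnorm_subr_le _ (cocycle A f w y'))).
  have lo : expR (- (C0 * w%:R)) <= opnorm (cocycle A f w y').
    rewrite -(lnorm_ge f m0 Au); have := lnorm_bound f m0 Au hA hA' w y'.
    by rewrite ler_norml => /andP[].
  rewrite expRD -(opnorm_cocycleE f m0 Au).
  set M := opnorm (cocycle A f w y') in lo *.
  have h1 : w%:R * expR (C0 * w%:R) * del = expR (- (C0 * w%:R)) * (e / 2 * w%:R).
    rewrite /del (_ : 2 * C0 * w%:R = C0 * w%:R + C0 * w%:R); last by ring.
    rewrite expRD expRN; field.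
    by rewrite gt_eqF ?expR_gt0.
  have h2 : expR (- (C0 * w%:R)) * (e / 2 * w%:R) <= M * (e / 2 * w%:R).
    by rewrite ler_wpM2r// mulr_ge0 ?ltW.
  have h3 : M * (1 + e / 2 * w%:R) <= M * expR (e / 2 * w%:R).
    by rewrite ler_wpM2l ?expR_ge1Dx// opnorm_ge0.
  lra.
have : \sum_(i < Q) L w (iter (i * w) f p) <=
    \sum_(i < Q) (L w (iter (i * w) f y) + e / 2 * w%:R).
  by apply: ler_sum => i _; exact: step.
rewrite big_split/= sumr_const card_ord -mulr_natl natrM.
rewrite natrM in hy; rewrite -/chi -/L in hy *; move=> h; apply: (le_trans h).
have := hy; lra.
Qed.

End Segments.

(** * Topological and packing entropy *)

(** Entropies are compared through the reals below them, so that the value [+oo] requires no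
    separate argument later. *)
Lemma lee_real_dense {R : realType} (a b : \bar R) : (0 <= a)%E ->
  (forall t : R, 0 <= t -> (t%:E < b)%E -> (t%:E <= a)%E) -> (b <= a)%E.
Proof.
case: a => [a| |]; [|by move=> *; rewrite leey|by []].
rewrite lee_fin => a0 H; case: b H => [b| |] H; last by rewrite leNye.
  rewrite lee_fin leNgt; apply/negP => ab.
  have := H ((a + b) / 2) ltac:(lra); rewrite lte_fin lee_fin => /(_ ltac:(lra)).
  lra.
have := H (a + 1) ltac:(lra) (ltry _); rewrite lee_fin => h.
by exfalso; lra.
Qed.

Section EntropyBounds.
Context {R : realType} {X : Type} (d : X -> X -> R) (f : X -> X) (dm : is_metric d).

Lemma dn_leP n x y (e : R) : 0 <= e ->
  dn d f n x y <= e <-> forall i, (i < n)%N -> d (iter i f x) (iter i f y) <= e.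
Proof.
move=> e0; split=> [/bigmax_leP[_ h] i iN|h]; first exact: (h (Ordinal iN)).
by apply/bigmax_leP; split => // i _; exact: h.
Qed.

Lemma dn_ltP n x y (e : R) : 0 < e ->
  dn d f n x y < e <-> forall i, (i < n)%N -> d (iter i f x) (iter i f y) < e.
Proof.
move=> e0; split=> [/bigmax_ltP[_ h] i iN|h]; first exact: (h (Ordinal iN)).
by apply/bigmax_ltP; split => // i _; exact: h.
Qed.

Lemma dn_gtP n x y (e : R) : 0 <= e ->
  e < dn d f n x y <-> exists2 i, (i < n)%N & e < d (iter i f x) (iter i f y).
Proof.
move=> e0; rewrite ltNge; split => [/negP h|[i iN h]].
  apply: contrapT => H; apply: h; apply/(dn_leP _ _ _ e0) => i iN.
  by rewrite leNgt; apply/negP => ei; apply: H; exists i.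
apply/negP => /(dn_leP _ _ _ e0)/(_ i iN); lra.
Qed.

(** The points are indexed by [nat], only the first [k] values being constrained, so that choices in
    a gluing scheme are plain numbers. *)
Definition dn_separated (n k : nat) (e : R) (E : set X) (p : nat -> X) :=
  (forall a, (a < k)%N -> E (p a)) /\
  (forall a b, (a < k)%N -> (b < k)%N -> a != b -> e < dn d f n (p a) (p b)).

Lemma sep_num_ge n k e E p : dn_separated n k e E p -> (k%:R%:E <= sep_num d f E n e)%E.
Proof.
move=> [pE psep]; apply: ereal_sup_ubound; exists k => //=.
exists (fun i : 'I_k => p i); split => [i|i j ij]; first exact: pE.
by apply: psep.
Qed.

Lemma sep_num_gt (x0 : X) n e E (r : R) : (r%:E < sep_num d f E n e)%E ->
  exists k p, dn_separated n k e E p /\ r < k%:R.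
Proof.
move=> /ereal_sup_gt[_ [k [g [gE gsep]] <-]]; rewrite lte_fin => rk.
exists k, (fun a => if insub a is Some i then g i else x0); split => //.
split => [a ak|a b ak bk ab]; first by rewrite insubT.
by rewrite !insubT; apply: gsep.
Qed.

Lemma sep_num_ge0 n e E : (0 <= sep_num d f E n e)%E.
Proof.
apply: ereal_sup_ubound; exists 0%N => //=.
by exists (fun i : 'I_0 => False_rect X (notF (ltn_ord i))); split => [[]|[]].
Qed.

Lemma sep_num_set0 n e : sep_num d f set0 n e = 0%E.
Proof.
apply/eqP; rewrite eq_le sep_num_ge0 andbT; apply: ge_ereal_sup => _ [k [g [gE _]] <-].
by case: k g gE => [//|k] g /(_ ord0).
Qed.

Lemma htop_ge0 Y : (0 <= htop d f Y)%E.
Proof.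
apply: (@le_trans _ _ (htop_cpt d f set0)); last first.
  apply: ereal_sup_ubound; exists set0 => //; split => //.
  move=> I U _ _; exists 0%N, (fun i : 'I_0 => False_rect I (notF (ltn_ord i))).
  by move=> x [].
apply: le_ereal_sup_tmp; exists (limn_esup (fun n : nat => ((n%:R)^-1)%:E * elog (sep_num d f set0 n 1))%E).
  by exists 1 => //=.
apply: limn_esup_ge => n0; exists n0 => //.
by rewrite sep_num_set0 /= ln0// mule0.
Qed.

Lemma htop_cpt_ge E e (t : R) : 0 < e -> 0 <= t ->
  (forall n0, exists n k p, [/\ (n0 <= n)%N, dn_separated n k e E p & expR (t * n%:R) <= k%:R]) ->
  (t%:E <= htop_cpt d f E)%E.
Proof.
move=> e0 t0 H.
apply: le_ereal_sup_tmp; exists (limn_esup (fun n : nat => ((n%:R)^-1)%:E * elog (sep_num d f E n e))%E).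
  by exists e => //=.
apply: limn_esup_ge => n0; have [n [k [p [nn sep hk]]]] := H n0.+1.
exists n; first exact: ltnW.
have n0' : 0 < n%:R :> R by rewrite ltr0n (leq_trans _ nn).
have := sep_num_ge sep; case: (sep_num d f E n e) => [r| |] //=; last first.
  by rewrite gt0_muley ?leey// lte_fin invr_gt0.
rewrite lee_fin => kr; rewrite lee_fin mulrC ler_pdivlMr//.
rewrite -[leLHS]expRK ler_ln ?posrE ?expR_gt0//; first exact: le_trans hk kr.
by rewrite (lt_le_trans _ (le_trans hk kr))// expR_gt0.
Qed.

Lemma htop_cpt_lt (x0 : X) E (t : R) : 0 <= t -> (t%:E < htop_cpt d f E)%E ->
  exists2 e, 0 < e & forall n0, exists n k p,
    [/\ (n0 <= n)%N, dn_separated n k e E p & expR (t * n%:R) <= k%:R].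
Proof.
move=> t0 /ereal_sup_gt[_ [e /= e0 <-]] h; exists e => // n0.
have [n nn hn] := limn_esup_gt h n0.+1; exists n.
have n0' : 0 < n%:R :> R by rewrite ltr0n (leq_trans _ nn).
suff : ((expR (t * n%:R))%:E < sep_num d f E n e)%E.
  move=> /(sep_num_gt x0)[k [p [sep kr]]]; exists k, p; split => //; [exact: ltnW|exact: ltW].
move: hn; case: (sep_num d f E n e) => [r| |] //=; last first.
- by rewrite gt0_muleNy// lte_fin invr_gt0.
- by rewrite ltry.
rewrite !lte_fin mulrC ltr_pdivlMr// => h1.
have r1 : 0 < ln r by rewrite (le_lt_trans _ h1)// mulr_ge0.
have r0 : 0 < r by rewrite ltNge; apply/negP => /ln0 E0; rewrite E0 ltxx in r1.
by rewrite -[ltRHS]lnK ?posrE// ltr_expR.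
Qed.

Lemma htop_cpt_gt E (s : R) e : 0 < e -> (htop_cpt d f E < s%:E)%E ->
  exists n0, forall n k p, (n0 <= n)%N -> dn_separated n k e E p -> k%:R <= expR (s * n%:R).
Proof.
move=> e0 h.
have : (limn_esup (fun n : nat => ((n%:R)^-1)%:E * elog (sep_num d f E n e)) < s%:E)%E.
  by apply: le_lt_trans h; apply: ereal_sup_ubound; exists e.
move=> /limn_esup_lt[n0 hn]; exists n0.+1 => n k p nn sep.
have n0' : 0 < n%:R :> R by rewrite ltr0n (leq_trans _ nn).
have := hn n (ltnW nn); have := sep_num_ge sep.
case: (sep_num d f E n e) => [r| |] //=; last first.
  by rewrite gt0_muley ?lte_fin ?invr_gt0.
rewrite lee_fin lte_fin mulrC ltr_pdivrMr// => kr h1; apply: (le_trans kr).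
have [r0|r0] := leP r 0; first by rewrite (le_trans r0)// expR_ge0.
by rewrite -[leLHS]lnK ?posrE// ler_expR ltW.
Qed.

Lemma htop_mono Y Z : Y `<=` Z -> (htop d f Y <= htop d f Z)%E.
Proof.
move=> YZ; apply: ereal_sup_le => _ [E [EY cE] <-].
by exists E => //; split => // x /EY/YZ.
Qed.

Lemma htop_cpt_le_htop E Y : E `<=` Y -> dcompact d E -> (htop_cpt d f E <= htop d f Y)%E.
Proof. by move=> EY cE; apply: ereal_sup_ubound; exists E. Qed.

Notation famsum s c := (\sum_(i <oo) (match c i with
   | Some xu => (expR (- s * (xu.2)%:R))%:E | None => 0%E end))%E.

Lemma famterm_ge0 (s : R) (c : nat -> option (X * nat)) i :
  (0 <= match c i with Some xu => (expR (- s * (xu.2)%:R))%:E | None => 0 end)%E.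
Proof. by case: (c i) => [xu|] //; rewrite lee_fin expR_ge0. Qed.

Lemma packP_N_ge0 E s N e : (0 <= packP_N d f E s N e)%E.
Proof.
apply: le_ereal_sup_tmp; exists (famsum s (fun=> None : option (X * nat))); last exact: nneseries_ge0.
by exists (fun=> None).
Qed.

Lemma packP_N_ninc E s e : nonincreasing_seq (fun N => packP_N d f E s N e).
Proof.
move=> N M NM; apply: ereal_sup_le => _ [c [c1 c2] <-]; exists c => //; split => //.
by move=> i xu /c1[? h]; split => //; exact: leq_trans h.
Qed.

Lemma packPE E s e : packP d f E s e = ereal_inf (range (fun N => packP_N d f E s N e)).
Proof.
by apply/cvg_lim => //; apply: ereal_nonincreasing_cvgn; exact: packP_N_ninc.
Qed.

Lemma packP_ge0 E s e : (0 <= packP d f E s e)%E.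
Proof.
by rewrite packPE; apply: le_ereal_inf_tmp => _ [N _ <-]; exact: packP_N_ge0.
Qed.

Lemma packP_N_ge E s N e T k (p : nat -> X) : (N <= T)%N ->
  (forall a, (a < k)%N -> E (p a)) ->
  (forall a b, (a < k)%N -> (b < k)%N -> a != b ->
     bowen_cball d f T (p a) e `&` bowen_cball d f T (p b) e = set0) ->
  ((k%:R * expR (- s * T%:R))%:E <= packP_N d f E s N e)%E.
Proof.
move=> NT pE pd; pose c i := if (i < k)%N then Some (p i, T) else None.
apply: le_ereal_sup_tmp; exists (famsum s c).
  exists c => //; split => [i xu|i j xu yv ij]; rewrite /c.
    by case: ifP => // ik [<-]; split => //; exact: pE.
  by case: ifP => // ik [<-]; case: ifP => // jk [<-]; exact: pd.
apply: (@le_trans _ _ (\sum_(0 <= i < k) (match c i with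
   | Some xu => (expR (- s * (xu.2)%:R))%:E | None => 0%E end))%E); last first.
  by apply: nneseries_lim_ge => i _ _; exact: famterm_ge0.
rewrite big_mkord (eq_bigr (fun=> (expR (- s * T%:R))%:E)) => [|i _]; last by rewrite /c ltn_ord.
by rewrite sumEFin sumr_const card_ord lee_fin -[leRHS]mulr_natl.
Qed.

(** For [s < t] every cover has a member all of whose [packP_N] are at least [1]; hence [packPP]
    does not vanish at [s]. *)
Lemma hP_ge Y (e t : R) : 0 < e ->
  (forall F : nat -> set X, Y `<=` \bigcup_(i in setT) F i ->
    forall s : R, 0 <= s < t -> exists i, forall N, exists T k p,
    [/\ (N <= T)%N, forall a, (a < k)%N -> F i (p a),
     forall a b, (a < k)%N -> (b < k)%N -> a != b ->
     bowen_cball d f T (p a) e `&` bowen_cball d f T (p b) e = set0 &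
     1 <= k%:R * expR (- s * T%:R)]) ->
  (t%:E <= hP d f Y)%E.
Proof.
move=> e0 H; apply: le_ereal_sup_tmp.
exists (ereal_inf [set s%:E | s in [set s : R | 0 <= s /\ packPP d f Y s e = 0%E]]).
  by exists e.
apply: le_ereal_inf_tmp => _ [s [s0 ps] <-]; rewrite lee_fin leNgt; apply/negP => st.
have : (packPP d f Y s e < 1%:E)%E by rewrite ps lte_fin.
move=> /ereal_inf_lt[_ [F YF <-]] hF.
have [|i hi] := H F YF s; first by rewrite s0.
have : (packP d f (F i) s e < 1%:E)%E.
  apply: le_lt_trans hF.
  apply: (@le_trans _ _ (\sum_(0 <= j < i.+1) packP d f (F j) s e)%E).
    rewrite big_nat_recr//= leeDr// sume_ge0// => j _; exact: packP_ge0.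
  by apply: nneseries_lim_ge => j _ _; exact: packP_ge0.
rewrite packPE => /ereal_inf_lt[_ [N _ <-]].
rewrite ltNge => /negP; apply.
have [T [k [p [NT pF pd h]]]] := hi N.
by apply: le_trans (packP_N_ge s NT pF pd); rewrite lee_fin.
Qed.

(* Group the members of a packing family according to their length [T]: their centres
   are [(T, e)]-dn_separated. *)
Lemma packP_N_le E s s0 e N (n0 : nat) : 0 <= e -> s0 < s -> (n0 <= N)%N ->
  (forall n k p, (n0 <= n)%N -> dn_separated n k e [set: X] p -> k%:R <= expR (s0 * n%:R)) ->
  (packP_N d f E s N e <= (expR (s0 - s) ^+ N / (1 - expR (s0 - s)))%:E)%E.
Proof.
move=> e0 ss nN H; set r := expR (s0 - s).
have r0 : 0 < r by exact: expR_gt0.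
have r1 : r < 1 by rewrite -[ltRHS]expR0 ltr_expR; lra.
apply: ge_ereal_sup => _ [c [c1 c2] <-].
apply: lime_le; first by apply: is_cvg_nneseries => i _ _; exact: famterm_ge0.
apply: nearW => I; rewrite big_mkord.
pose len i := if c i is Some xu then xu.2 else 0%N.
pose M := (\max_(i < I) len i).+1.
have termE i : (i < I)%N ->
    (match c i with Some xu => (expR (- s * (xu.2)%:R))%:E | None => 0%E end <=
    (\sum_(T < M) (if c i is Some xu then (xu.2 == T :> nat) else false)%:R * expR (- s * T%:R))%:E)%E.
  move=> iI; case ci : (c i) => [xu|]; rewrite lee_fin; last by rewrite big1// => T _; rewrite mul0r.
  have xM : (xu.2 < M)%N.
    by rewrite /M ltnS (leq_trans _ (leq_bigmax (Ordinal iI)))// /len /= ci.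
  by rewrite (bigD1 (Ordinal xM))//= eqxx mul1r lerDl sumr_ge0//.
apply: (@le_trans _ _ (\sum_(i < I) (\sum_(T < M)
   (if c i is Some xu then (xu.2 == T :> nat) else false)%:R * expR (- s * T%:R))%:E)%E).
  by apply: lee_sum => i _; exact: termE.
rewrite sumEFin lee_fin exchange_big/=.
under eq_bigr => T _ do rewrite -mulr_suml.
have cnt (T : 'I_M) : \sum_(i < I) (if c i is Some xu then (xu.2 == T :> nat) else false)%:R
    <= (if (N <= T)%N then expR (s0 * T%:R) else 0) :> R.
  pose S := [set i : 'I_I | if c i is Some xu then (xu.2 == T :> nat) else false]%SET.
  have -> : \sum_(i < I) (if c i is Some xu then (xu.2 == T :> nat) else false)%:R = #|S|%:R :> R.
    rewrite -sum1_card natr_sum [RHS]big_mkcond; apply: eq_bigr => i _.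
    by rewrite inE; case: (c i) => [xu|] //; case: eqP.
  have [NT|TN] := leqP N T; last first.
    rewrite (_ : #|S| = 0%N)//; apply/eqP; rewrite cards_eq0; apply/eqP/setP => i.
    rewrite !inE; case ci : (c i) => [xu|] //; apply/negP => /eqP xT.
    by have [_] := c1 _ _ ci; rewrite xT leqNgt TN.
  have [->|Sne] := posnP #|S|; first exact: expR_ge0.
  have /card_gt0P[i1 i1S] := Sne.
  move: i1S; rewrite inE; case ci1 : (c i1) => [[x1 u1]|] // _.
  pose p a := if c (nth i1 (enum S) a) is Some xu then xu.1 else x1.
  apply: (@H _ _ p (leq_trans nN NT)); split => // a b aS bS ab.
  have aS' : (a < size (enum S))%N by rewrite -cardE.
  have bS' : (b < size (enum S))%N by rewrite -cardE.
  have nab : nth i1 (enum S) a != nth i1 (enum S) b.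
    by rewrite nth_uniq// enum_uniq.
  have := mem_nth i1 aS'; have := mem_nth i1 bS'; rewrite !mem_enum !inE.
  rewrite /p; case cb : (c _) => [[xb ub]|] // /eqP/= ubT.
  case ca : (c _) => [[xa ua]|] // /eqP/= uaT.
  (* Were the distance at most [e], the centre [xb] would lie in both balls. *)
  rewrite ltNge; apply/negP => dab.
  have := c2 _ _ _ _ nab ca cb; rewrite /= ubT uaT => /seteqP[/(_ xb) + _].
  apply; split => //=; rewrite /bowen_cball/=.
  by apply/(dn_leP _ _ _ e0) => i _; rewrite (dxx dm).
apply: (@le_trans _ _ (\sum_(T < M) (if (N <= T)%N then r ^+ T else 0))).
  apply: ler_sum => T _.
  apply: (@le_trans _ _ ((if (N <= T)%N then expR (s0 * T%:R) else 0) * expR (- s * T%:R))).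
    by rewrite ler_wpM2r ?expR_ge0.
  case: ifP => _; last by rewrite mul0r.
  by rewrite -expRD -mulrDl /r expRM_natr.
have geo M' : (\sum_(T < M') (if (N <= T)%N then r ^+ T else 0)) * (1 - r) <= r ^+ N.
  suff : (\sum_(T < M') (if (N <= T)%N then r ^+ T else 0)) * (1 - r)
     <= r ^+ N - r ^+ (maxn N M').
    by move=> h; apply: (le_trans h); rewrite gerBl exprn_ge0// ltW.
  elim: M' => [|M' IH]; first by rewrite big_ord0 mul0r maxn0 subrr.
  rewrite big_ord_recr/= mulrDl; have [NM|MN] := leqP N M'.
    rewrite (maxn_idPr (leqW NM)); rewrite (maxn_idPr NM) in IH.
    rewrite exprS; lra.
  rewrite mul0r addr0 (maxn_idPl MN); rewrite (maxn_idPl (ltnW MN)) in IH.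
  by [].
by rewrite ler_pdivlMr ?subr_gt0.
Qed.

(** With [s1] strictly between the topological entropy and [s], [packP_N] is at most a geometric
    tail, which tends to [0] with [N]; the cover by [Y] alone suffices. *)
Lemma hP_le Y (s : R) : 0 <= s -> (htop_cpt d f [set: X] < s%:E)%E -> (hP d f Y <= s%:E)%E.
Proof.
move=> s0 hs.
have [s1 s1s hs1] : exists2 s1, s1 < s & (htop_cpt d f [set: X] < s1%:E)%E.
  case E : (htop_cpt d f [set: X]) hs => [r| |] //= hs.
    by exists ((r + s) / 2); rewrite ?lte_fin; move: hs; rewrite lte_fin; lra.
  by exists (s - 1); rewrite ?ltNyr//; lra.
apply: ge_ereal_sup => _ [e /= e0 <-].
apply: ereal_inf_lbound; exists s => //; split => //.
apply/eqP; rewrite eq_le; apply/andP; split; last first.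
  apply: le_ereal_inf_tmp => _ [F _ <-]; apply: nneseries_ge0 => i _ _; exact: packP_ge0.
have [n0 H] := htop_cpt_gt e0 hs1.
have r0 : 0 < expR (s1 - s) by exact: expR_gt0.
have r1 : expR (s1 - s) < 1 by rewrite -[ltRHS]expR0 ltr_expR; lra.
have pY : packP d f Y s e = 0%E.
  apply/eqP; rewrite eq_le packP_ge0 andbT; apply/lee_addgt0Pr => g g0; rewrite add0e.
  have cv : expR (s1 - s) ^+ n @[n --> \oo] --> (0 : R).
    by apply: cvg_expr; rewrite gtr0_norm.
  have g1 : 0 < g * (1 - expR (s1 - s)) by rewrite mulr_gt0// subr_gt0.
  have [n1 _ h1] := iffLR (cvgrPdist_lt _ _) cv _ g1.
  pose N := maxn n0 n1.
  apply: (@le_trans _ _ (packP_N d f Y s N e)).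
    by rewrite packPE; apply: ereal_inf_lbound; exists N.
  apply: (le_trans (packP_N_le _ (ltW e0) s1s (leq_maxl n0 n1) H)).
  rewrite lee_fin ler_pdivrMr ?subr_gt0//.
  have := h1 N (leq_maxr _ _); rewrite sub0r normrN => h2.
  by rewrite (le_trans (ler_norm _))// ltW.
apply: (@le_trans _ _ (\sum_(i <oo) packP d f ((fun=> Y) i) s e)%E).
  by apply: ereal_inf_lbound; exists (fun=> Y) => // x Yx; exists 0%N.
by rewrite eseries0// => i _ _.
Qed.

End EntropyBounds.

(** * Points glued from prescribed segments *)

Section Scheme.
Context {R : realType} {X : Type} (d : X -> X -> R) (dm : is_metric d).
Context (cX : dcompact d [set: X]) (f : X -> X) (cf : dcontinuous d f).
Context (lam tau : R) (N : nat).
Context (glue : forall (x : nat -> X) (n : nat -> nat), (forall i, (0 < n i)%N) ->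
  exists z, forall i j, (j < n i)%N ->
    d (iter (seg_start N n i + j) f z) (iter j f (x i))
      < tau * expR (- lam * (minn j (n i - j))%:R)).

(* [D i c = (l, q, s)]: the [i]-th segment, if it starts at time [c], has length [l]
   and follows the orbit of one of the [q] points [s 0], ..., [s q.-1]. *)
Context (D : nat -> nat -> nat * nat * (nat -> X)).

(** Lengths may depend on the starting time, so that a segment can be made long, or short, relative
    to the time elapsed before it. *)
Fixpoint time i := if i is k.+1 then (time k + (D k (time k)).1.1 + N)%N else 0%N.

Definition len i := (D i (time i)).1.1.
Definition nch i := (D i (time i)).1.2.
Definition pt i := (D i (time i)).2.

Context (len_gt0 : forall i, (0 < len i)%N) (nch_gt0 : forall i, (0 < nch i)%N).

Lemma timeS i : time i.+1 = (time i + len i + N)%N. Proof. by []. Qed.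

Lemma seg_start_time i : seg_start N len i = time i.
Proof.
by elim: i => [|i IH]; [rewrite /seg_start big_ord0|rewrite seg_startS IH].
Qed.

Lemma time_ge i : (i <= time i)%N.
Proof. elim: i => // i IH; rewrite timeS; have := len_gt0 i; lia. Qed.

(** The inequality is not strict, which makes the set of such points closed. *)
Definition follows (w : nat -> nat) K p := forall i j, (i < K)%N -> (j < len i)%N ->
  d (iter (time i + j) f p) (iter j f (pt i (w i)))
    <= tau * expR (- lam * (minn j (len i - j))%:R).

Definition admissible (w : nat -> nat) K := forall i, (i < K)%N -> (w i < nch i)%N.

Lemma follows_closed w K : dclosed d [set p | follows w K p].
Proof.
have -> : [set p | follows w K p] = \bigcap_(ij in [set: nat * nat])
   [set p | (ij.1 < K)%N -> (ij.2 < len ij.1)%N ->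
     d (iter (time ij.1 + ij.2) f p) (iter ij.2 f (pt ij.1 (w ij.1)))
    <= tau * expR (- lam * (minn ij.2 (len ij.1 - ij.2))%:R)].
  by apply/seteqP; split => p h; [move=> [i j] _; exact: h|move=> i j; exact: (h (i, j))].
apply: dclosed_bigcap => -[i j] /=.
have [iK|iK] := boolP (i < K)%N; last first.
  by move=> p; case.
have [jl|jl] := boolP (j < len i)%N; last first.
  by move=> p; case.
have := @dclosed_le_comp _ _ _ dm _ (iter j f (pt i (w i)))
  (tau * expR (- lam * (minn j (len i - j))%:R)) (dcontinuous_iter (time i + j) cf).
congr dclosed; apply/seteqP; split => p /= h; [by []|exact: h].
Qed.

Lemma follows_exists w : exists p, forall K, follows w K p.
Proof.
have [p hp] := glue (fun i => pt i (w i)) len_gt0; exists p => K i j _ jl.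
by rewrite -seg_start_time; exact/ltW/hp.
Qed.

Lemma follows_eq w w' K p : (forall i, (i < K)%N -> w i = w' i) ->
  follows w K p -> follows w' K p.
Proof. by move=> ww h i j iK jl; rewrite -ww//; exact: h. Qed.

Lemma follows_le w K K' p : (K <= K')%N -> follows w K' p -> follows w K p.
Proof. by move=> KK h i j iK jl; apply: h => //; exact: leq_trans KK. Qed.

(** The choices may depend on [K]; in this form the set is an intersection of finite unions of
    closed sets. *)
Definition reach := [set p | forall K, exists2 w, admissible w K & follows w K p].

Lemma reach_closed : dclosed d reach.
Proof.
have -> : reach = \bigcap_(K in [set: nat]) [set p | exists2 w, admissible w K & follows w K p].
  by apply/seteqP; split => p h; [move=> K _; exact: h|move=> K; exact: h].
apply: dclosed_bigcap => K.
(* Only the first [K] choices matter, and they take finitely many values, so the union over [w] is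
   finite. *)
pose B := (\max_(i < K) nch i).+1.
pose ext (t : {ffun 'I_K -> 'I_B}) (i : nat) : nat := if insub i is Some o then t o else 0%N.
have -> : [set p | exists2 w, admissible w K & follows w K p] =
    [set p | exists t : {ffun 'I_K -> 'I_B}, admissible (ext t) K /\ follows (ext t) K p].
  apply/seteqP; split => p /=; last by move=> [t [h1 h2]]; exists (ext t).
  move=> [w aw fw].
  have wB (i : 'I_K) : (w i < B)%N.
    rewrite /B ltnS (leq_trans (ltnW (aw i (ltn_ord i))))//; exact: leq_bigmax.
  exists [ffun i => Ordinal (wB i)].
  have E i : (i < K)%N -> w i = ext [ffun i => Ordinal (wB i)] i.
    by move=> iK; rewrite /ext insubT/= ffunE.
  by split; [move=> i iK; rewrite -E// aw|exact: follows_eq fw].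
apply: dclosed_fin => t.
have [at_|at_] := pselect (admissible (ext t) K).
  have := @follows_closed (ext t) K; congr dclosed; apply/seteqP; split => p //=.
  by case.
by move=> p; exists 1 => // q _ [].
Qed.

Lemma reach_compact : dcompact d reach.
Proof. by apply: dclosed_compact => //; exact: reach_closed. Qed.

Lemma follows_reach w p : (forall K, admissible w K) -> (forall K, follows w K p) -> reach p.
Proof. by move=> aw fw K; exists w. Qed.

End Scheme.

(** * Oscillating growth and full topological and packing entropy *)

Section Oscillation.
Context {R : realType} {dsp : measure_display} {X : measurableType dsp}.
Context (f : X -> X) {m : nat} (A : X -> 'M[R]_m).

Lemma oscillation_MLI x (r1 r2 : R) : r1 < r2 ->
  (forall n0, exists2 n, (n0 <= n)%N & lnorm f A n x <= r1 * n%:R) ->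
  (forall n0, exists2 n, (n0 <= n)%N & r2 * n%:R <= lnorm f A n x) ->
  MLI A f x.
Proof.
move=> r12 H1 H2 /cvg_ex[l cl].
have e0 : 0 < (r2 - r1) / 2 by lra.
have [n0 _ hn] := iffLR (cvgrPdist_lt _ _) cl _ e0.
have [n1 hn1 h1] := H1 n0.+1; have [n2 hn2 h2] := H2 n0.+1.
have p1 : 0 < n1%:R :> R by rewrite ltr0n (leq_trans _ hn1).
have p2 : 0 < n2%:R :> R by rewrite ltr0n (leq_trans _ hn2).
have := hn n1 (ltnW hn1); have := hn n2 (ltnW hn2); rewrite /= !lyapE ?(leq_trans _ hn1) ?(leq_trans _ hn2)//.
have h1' : lnorm f A n1 x / n1%:R <= r1 by rewrite ler_pdivrMr.
have h2' : r2 <= lnorm f A n2 x / n2%:R by rewrite ler_pdivlMr.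
rewrite !ltr_norml => /andP[a1 a2] /andP[b1 b2]; lra.
Qed.

End Oscillation.

Lemma large_mod r k a b : (r < k)%N -> exists i, [/\ (a <= i)%N, (b <= i)%N & (i %% k)%N = r].
Proof.
move=> rk; exists (k * (a + b) + r)%N; rewrite mulnC modnMDl modn_small//.
have h : (a + b <= (a + b) * k)%N by rewrite leq_pmulr// (leq_ltn_trans _ rk).
by split => //; apply: leq_trans (leq_trans h (leq_addr _ _)); rewrite ?leq_addr ?leq_addl.
Qed.

Section SchemeGrowth.
Context {R : realType} {dsp : measure_display} {X : measurableType dsp}.
Context (d : X -> X -> R) (dm : is_metric d).
Context (cX : dcompact d [set: X]) (f : X -> X) (cf : dcontinuous d f).
Context {m : nat} (A : X -> 'M[R]_m) (C0 : R) (C0_ge0 : 0 <= C0).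
Context (m0 : (0 < m)%N) (Au : forall x, A x \in unitmx)
  (hA : forall x, opnorm (A x) <= expR C0) (hA' : forall x, expands (expR C0) (A x)).
Context (lam tau : R) (N : nat) (D : nat -> nat -> nat * nat * (nat -> X)).
Context (lam0 : 0 < lam) (tau0 : 0 < tau).

Let L := lnorm f A.

Definition low_seg (tau1 rl : R) (l q : nat) (s : nat -> X) := forall a p, (a < q)%N ->
  (forall j, (j < l)%N -> d (iter j f p) (iter j f (s a)) <= tau1) -> L l p <= rl * l%:R.

Definition up_seg (ru : R) (l q : nat) (s : nat -> X) := forall a p, (a < q)%N ->
  (forall j, (j < l)%N -> d (iter j f p) (iter j f (s a)) <=
     expR (- lam * (minn j (l - j))%:R)) -> ru * l%:R <= L l p.

Lemma follows_seg w K p i : follows d f lam tau N D w K p -> (i < K)%N ->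
  forall j, (j < len N D i)%N -> d (iter j f (iter (time N D i) f p)) (iter j f (pt N D i (w i))) <=
     tau * expR (- lam * (minn j (len N D i - j))%:R).
Proof. by move=> h iK j jl; rewrite -iterD addnC; exact: h. Qed.

Lemma expR_lam_le1 (k : nat) : expR (- lam * k%:R) <= 1.
Proof. by rewrite -[leRHS]expR0 ler_expR mulNr oppr_le0 mulr_ge0// ltW. Qed.

(** The time before a segment changes the growth by at most [C0] per step; a segment much longer
    than its starting time therefore determines the average at its end, up to [e]. *)
Lemma scheme_MLI (tau1 rl ru e : R) : tau <= 1 -> tau <= tau1 -> rl + 2 * e < ru ->
  (forall i, (0 < len N D i)%N) ->
  (forall i0, exists2 i, (i0 <= i)%N &
    low_seg tau1 rl (len N D i) (nch N D i) (pt N D i) /\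
    (C0 + `|rl + e|) * (time N D i)%:R <= e * (len N D i)%:R) ->
  (forall i0, exists2 i, (i0 <= i)%N &
    up_seg ru (len N D i) (nch N D i) (pt N D i) /\
    (C0 + `|ru - e|) * (time N D i)%:R <= e * (len N D i)%:R) ->
  reach d f lam tau N D `<=` MLI A f.
Proof.
move=> tle1 tle2 hr l0 Hlow Hup p rp.
apply: (@oscillation_MLI _ _ _ f m A p (rl + e) (ru - e)); first lra.
  move=> n0; have [i ii [hl ht]] := Hlow n0.
  have [w aw fw] := rp i.+1; have fs := follows_seg fw (leqnn _).
  exists (time N D i + len N D i)%N; first exact: leq_trans ii (leq_trans (time_ge l0 i) (leq_addr _ _)).
  have h1 : L (len N D i) (iter (time N D i) f p) <= rl * (len N D i)%:R.
    apply: (hl (w i)); first exact: aw.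
    move=> j jl; apply: (le_trans (fs j jl)).
    by apply: le_trans tle2; rewrite ler_piMr ?(ltW tau0)// expR_lam_le1.
  have := lnormD_le_l f m0 Au hA (time N D i) (len N D i) p; rewrite -/L natrD => h2.
  have := ler_norm (- (rl + e)); rewrite normrN => h3.
  have : - (rl + e) * (time N D i)%:R <= `|rl + e| * (time N D i)%:R by rewrite ler_wpM2r.
  lra.
move=> n0; have [i ii [hl ht]] := Hup n0.
have [w aw fw] := rp i.+1; have fs := follows_seg fw (leqnn _).
exists (time N D i + len N D i)%N; first exact: leq_trans ii (leq_trans (time_ge l0 i) (leq_addr _ _)).
have h1 : ru * (len N D i)%:R <= L (len N D i) (iter (time N D i) f p).
  apply: (hl (w i)); first exact: aw.
  move=> j jl; apply: (le_trans (fs j jl)).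
  by rewrite ler_piMl ?expR_ge0.
have := lnormD_ge_l f m0 Au hA' (time N D i) (len N D i) p; rewrite -/L natrD => h2.
have : (ru - e) * (time N D i)%:R <= `|ru - e| * (time N D i)%:R by rewrite ler_wpM2r// ler_norm.
lra.
Qed.

Context (glue : forall (x : nat -> X) (n : nat -> nat), (forall i, (0 < n i)%N) ->
  exists z, forall i j, (j < n i)%N ->
    d (iter (seg_start N n i + j) f z) (iter j f (x i))
      < tau * expR (- lam * (minn j (n i - j))%:R)).

Context (tau1 rl ru e t e0 : R) (e_gt0 : 0 < e) (e00 : 0 < e0) (t0 : 0 <= t).
Context (tle1 : tau <= 1) (tle2 : tau <= tau1) (tle3 : tau <= e0 / 4)
  (hr : rl + 2 * e < ru).
(** Three kinds of segments in rotation: entropy, low growth, high growth. The factor [i.+1] in the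
    length makes the elapsed time negligible against each new segment. *)
Context (PD : forall i c, let: (l, q, s) := D i c in
  [/\ (i.+1 * c.+1 <= l)%N, (0 < q)%N &
   [/\ (i %% 3)%N = 0%N -> dn_separated d f l q e0 [set: X] s /\ expR (t * l%:R) <= q%:R,
     (i %% 3)%N = 1%N -> low_seg tau1 rl l q s & (i %% 3)%N = 2%N -> up_seg ru l q s]]).

Lemma len_ge i : (i.+1 * (time N D i).+1 <= len N D i)%N.
Proof. by have := PD i (time N D i); rewrite /len; case: (D i _) => [[l q] s] []. Qed.

Lemma len_pos i : (0 < len N D i)%N.
Proof. exact: leq_trans (len_ge i). Qed.

Lemma nch_pos i : (0 < nch N D i)%N.
Proof. by have := PD i (time N D i); rewrite /nch; case: (D i _) => [[l q] s] []. Qed.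

Lemma seg_props i :
  [/\ (i %% 3)%N = 0%N -> dn_separated d f (len N D i) (nch N D i) e0 [set: X] (pt N D i) /\
        expR (t * (len N D i)%:R) <= (nch N D i)%:R,
     (i %% 3)%N = 1%N -> low_seg tau1 rl (len N D i) (nch N D i) (pt N D i) &
     (i %% 3)%N = 2%N -> up_seg ru (len N D i) (nch N D i) (pt N D i)].
Proof.
by have := PD i (time N D i); rewrite /len /nch /pt; case: (D i _) => [[l q] s] [].
Qed.

Lemma small_time (K g : R) : 0 < g -> exists i0, forall i, (i0 <= i)%N ->
  K * (time N D i)%:R <= g * (len N D i)%:R.
Proof.
move=> g0; have [i0 [_ hi0]] := bigger (`|K| / g); exists i0 => i ii.
have : (i.+1 * (time N D i).+1)%:R <= (len N D i)%:R :> R by rewrite ler_nat len_ge.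
have iR : i0%:R <= i%:R :> R by rewrite ler_nat.
rewrite natrM -!natr1; set c := (time N D i)%:R; set l := (len N D i)%:R => h.
have c0 : 0 <= c by exact: ler0n.
have h1 : K * c <= `|K| * c by rewrite ler_wpM2r// ler_norm.
have h2 : `|K| <= g * i%:R by rewrite mulrC -ler_pdivrMr// (le_trans hi0).
have h3 : `|K| * c <= g * i%:R * c by rewrite ler_wpM2r.
have h4 : g * (i%:R * c) <= g * l.
  rewrite ler_wpM2l ?(ltW g0)//; have := ler0n R i; lra.
lra.
Qed.

Lemma full_scheme_MLI : reach d f lam tau N D `<=` MLI A f.
Proof.
apply: (scheme_MLI tle1 tle2 hr); first exact: len_pos.
  move=> i0; have [i1 h1] := small_time (C0 + `|rl + e|) e_gt0.
  have [i [ii1 ii2 i3]] := @large_mod 1 3 i0 i1 isT; exists i => //.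
  by have [_ hl _] := seg_props i; split; [exact: hl|exact: h1].
move=> i0; have [i1 h1] := small_time (C0 + `|ru - e|) e_gt0.
have [i [ii1 ii2 i3]] := @large_mod 2 3 i0 i1 isT; exists i => //.
by have [_ _ hl] := seg_props i; split; [exact: hl|exact: h1].
Qed.

(** Shadowing within [e0 / 4] of two points more than [e0] apart leaves more than [e0 / 2], whatever
    the earlier choices are. *)
Lemma follows_separated w w' p p' i : (i %% 3)%N = 0%N -> (w i < nch N D i)%N ->
  (w' i < nch N D i)%N -> w i != w' i ->
  follows d f lam tau N D w i.+1 p -> follows d f lam tau N D w' i.+1 p' ->
  exists2 j, (j < time N D i + len N D i)%N & e0 / 2 < d (iter j f p) (iter j f p').
Proof.
move=> i3 wi wi' ww fw fw'.
have [/(_ i3) [[_ sep] _] _ _] := seg_props i.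
have := sep _ _ wi wi' ww; move=> /(dn_gtP _ _ _ _ _ (ltW e00))[j jl hj].
exists (time N D i + j)%N; first by rewrite ltn_add2l.
have h1 := follows_seg fw (leqnn _) jl; have h2 := follows_seg fw' (leqnn _) jl.
have h0 := expR_lam_le1 (minn j (len N D i - j)).
have h3 : tau * expR (- lam * (minn j (len N D i - j))%:R) <= tau.
  by rewrite ler_piMr// ltW.
rewrite addnC !iterD; set y := iter j f (iter _ f p) in h1 *; set y' := iter j f (iter _ f p') in h2 *.
have := dtri dm y (iter j f (pt N D i (w i))) (iter j f (pt N D i (w' i))).
have := dtri dm y' y (iter j f (pt N D i (w' i))).
by rewrite (dsym dm (iter j f (pt N D i (w i))) y); move: tle3; lra.
Qed.

(* Only the choice made in the last separated segment matters: by [PD] its length dominates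
   the time elapsed before. *)
Lemma full_htop (t' : R) : 0 <= t' -> t' < t -> (t'%:E <= htop d f (MLI A f))%E.
Proof.
move=> t'0 tt.
have cR : dcompact d (reach d f lam tau N D) by exact: reach_compact.
apply: le_trans (htop_cpt_le_htop f full_scheme_MLI cR).
apply: (@htop_cpt_ge _ _ _ _ _ (e0 / 2)) => //; first by move: e00; lra.
move=> n0; have [i1 h1] := @small_time t' (t - t') ltac:(lra).
have [i [in0 ii1 i3]] := @large_mod 0 3 n0 i1 isT.
pose W a := fun l : nat => if l == i then a else 0%N.
have [p hp] := choice (fun a => follows_exists glue len_pos (W a)).
have WE a : W a i = a by rewrite /W eqxx.
exists (time N D i + len N D i)%N, (nch N D i), p; split.
- exact: leq_trans in0 (leq_trans (time_ge len_pos i) (leq_addr _ _)).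
- split => [a aq|a b aq bq ab].
    apply: (follows_reach (w := W a)); last exact: hp.
    move=> K l lK; rewrite /W; case: eqP => [->//|_]; exact: nch_pos.
  apply/(dn_gtP _ _ _ _ _); first by move: e00; lra.
  by apply: (@follows_separated (W a) (W b)); rewrite ?WE//; exact: hp.
have [/(_ i3) [_ hq] _ _] := seg_props i; apply: le_trans hq.
by rewrite ler_expR natrD; have := h1 i ii1; lra.
Qed.

(* Diagonal argument: if no member of the cover carried enough entropy, then one could extend
   the choices step by step so as to leave each [F i] in turn. *)
Lemma full_hP (t' : R) : 0 <= t' -> t' < t -> (t'%:E <= hP d f (MLI A f))%E.
Proof.
(* Closed balls of radius [e0 / 8] around points more than [e0 / 2] apart are disjoint. *)
move=> t'0 tt; apply: (@hP_ge _ _ _ _ _ (e0 / 8)); first by move: e00; lra.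
move=> F YF s /andP[s0 st]; apply: contrapT => H.
have {}H i : exists N0, forall T k p, (N0 <= T)%N -> (forall a, (a < k)%N -> F i (p a)) ->
     (forall a b, (a < k)%N -> (b < k)%N -> a != b ->
     bowen_cball d f T (p a) (e0 / 8) `&` bowen_cball d f T (p b) (e0 / 8) = set0) ->
     k%:R * expR (- s * T%:R) < 1.
  apply: contrapT => H'; apply: H; exists i => N0; apply: contrapT => H''.
  apply: H'; exists N0 => T k p NT pF pd; rewrite ltNge; apply/negP => h.
  by apply: H''; exists T, k, p.
have [N0 hN0] := choice H.
pose fol := follows d f lam tau N D.
have ext (x : nat * ((nat -> nat) * nat)) : exists y : (nat -> nat) * nat,
    (forall K, admissible N D x.2.1 K) ->
    [/\ (x.2.2 < y.2)%N, forall l, (l < x.2.2)%N -> y.1 l = x.2.1 l,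
      forall K, admissible N D y.1 K & forall p, fol y.1 y.2 p -> ~ F x.1 p].
  case: x => i [w K] /=; apply: contrapT => H'.
  have aw : forall K, admissible N D w K.
    by apply: contrapT => nw; apply: H'; exists (w, K) => aw; case: nw.
  have {}H' w' K' : (K < K')%N -> (forall l, (l < K)%N -> w' l = w l) ->
      (forall K, admissible N D w' K) -> exists2 p, fol w' K' p & F i p.
    move=> h1 h2 h3; apply: contrapT => h4; apply: H'; exists (w', K') => _; split => //= p fp Fp.
    by apply: h4; exists p.
  have [i1 h1] := @small_time t' (t - t') ltac:(lra).
  (* Otherwise every extension is followed by some point of [F i]; letting the choice in a late
     segment [i2] vary over all its values yields a packing of [F i] that contradicts [hN0]. *)
  have [i2 [i2a i2i i3]] := @large_mod 0 3 (maxn K.+1 (N0 i)) i1 isT.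
  have i2K : (K < i2)%N by exact: leq_trans (leq_maxl _ _) i2a.
  have i2N : (N0 i <= i2)%N by exact: leq_trans (leq_maxr _ _) i2a.
  pose W a := fun l : nat => if l == i2 then (if (a < nch N D i2)%N then a else 0%N) else w l.
  have WE a : (a < nch N D i2)%N -> W a i2 = a by move=> ai; rewrite /W eqxx ai.
  have aW a K0 : admissible N D (W a) K0.
    move=> l lK; rewrite /W; case: eqP => [->|_]; last exact: (aw l.+1).
    by case: ifP => // _; exact: nch_pos.
  have /choice[p hp] a : exists p, fol (W a) i2.+1 p /\ F i p.
    have agree l : (l < K)%N -> W a l = w l.
      move=> lK; rewrite /W; case: eqP => // li.
      by move: lK; rewrite li ltnNge (ltnW i2K).
    by have [p fp Fp] := H' (W a) i2.+1 (leqW i2K) agree (aW a); exists p.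
  pose T := (time N D i2 + len N D i2)%N.
  have NT : (N0 i <= T)%N by exact: leq_trans i2N (leq_trans (time_ge len_pos i2) (leq_addr _ _)).
  have [/(_ i3) [_ hq] _ _] := seg_props i2.
  have := @hN0 i T (nch N D i2) p NT (fun a _ => (hp a).2).
  rewrite ltNge => h; apply: (negP (h _)) => [a b aq bq ab|].
    apply/seteqP; split => // y [ya yb].
    have [j jT] := @follows_separated (W a) (W b) (p a) (p b) i2 i3
      ltac:(by rewrite WE) ltac:(by rewrite WE) ltac:(by rewrite !WE) (hp a).1 (hp b).1.
    have e80 : 0 <= e0 / 8 by move: e00; lra.
    have := iffLR (dn_leP _ _ _ _ _ e80) ya j jT; have := iffLR (dn_leP _ _ _ _ _ e80) yb j jT.
    have := dtri dm (iter j f y) (iter j f (p a)) (iter j f (p b)).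
    rewrite (dsym dm (iter j f y)); move: e00; lra.
  apply: (@le_trans _ _ (expR (t * (len N D i2)%:R) * expR (- s * T%:R))); last first.
    by rewrite ler_wpM2r ?expR_ge0.
  rewrite -expRD -[leLHS]expR0 ler_expR.
  have : s * T%:R <= t' * T%:R by rewrite ler_wpM2r// ltW.
  have := h1 i2 i2i; rewrite /T natrD; lra.
have [E hE] := choice ext.
pose state := fix state i : (nat -> nat) * nat := if i is k.+1 then E (k, state k) else (fun=> 0%N, 0%N).
have ast i : forall K, admissible N D (state i).1 K.
  elim: i => [K l _|i IH] /=; first exact: nch_pos.
  by have [] := hE (i, state i) IH.
have hst i := hE (i, state i) (ast i).
have stK i : (i <= (state i).2)%N.
  elim: i => // i IH; have [h _ _ _] := hst i; exact: leq_ltn_trans h.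
have [|||p pP] := @nested_nonempty _ _ _ cX (fun i => [set p | fol (state i).1 (state i).2 p]).
- by move=> i; exact: follows_closed.
- by move=> i; have [p hp] := follows_exists glue len_pos (state i).1; exists p; exact: hp.
- move=> i p /= fp; have [h1 h2 _ _] := hst i.
  by apply: follows_eq h2 _; exact: follows_le (ltnW h1) fp.
have rp : reach d f lam tau N D p.
  by move=> K; exists (state K).1; [exact: ast|apply: follows_le (stK K) (pP K)].
have [i _ Fp] := YF _ (full_scheme_MLI rp).
by have [_ _ _ /(_ p (pP i.+1))] := hst i.
Qed.

End SchemeGrowth.

(** * Regularity of Borel probabilities *)

Section Regularity.
Context {R : realType} {dsp : measure_display} {X : measurableType dsp}.
Context (d : X -> X -> R) (dm : is_metric d).
Context (hm : (@measurable dsp X) = <<s dopen d >>).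
Context (mu : probability X R).

Lemma prob_bigcup_le (U : nat -> set X) (e : R) : (forall n, measurable (U n)) ->
  0 <= e -> (forall n, prob mu (U n) <= e / (2 ^ n.+1)%:R) ->
  prob mu (\bigcup_n U n) <= e.
Proof.
move=> mU e0 pU; rewrite -lee_fin -probE; last exact: bigcupT_measurable.
apply: (le_trans (measure_sigma_subadditive mu mU (bigcupT_measurable _ mU) (@subset_refl _ _))).
apply: (@le_trans _ _ (\sum_(i <oo | xpredT i) (0 + (e / (2 ^ i.+1)%:R)%:E))%E).
  apply: lee_nneseries => // n _; rewrite add0e; have := pU n.
  by rewrite -lee_fin -probE.
apply: (le_trans (epsilon_trick _ _ e0)) => //.
by rewrite eseries0// add0e.
Qed.

(** Only finite unions of closed sets are closed in general; continuity from above replaces the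
    countable union by a finite one at the price of [e / 2]. *)
Lemma prob_setD_bigcup (V : set X) (F : nat -> set X) (e : R) : measurable V ->
  (forall n, measurable (F n)) -> prob mu (V `\` \bigcup_n F n) <= e / 2 -> 0 < e ->
  exists n, prob mu (V `\` \bigcup_(i in [set i | (i < n)%N]) F i) <= e.
Proof.
move=> mO mF pO e0.
have mFF : measurable (\bigcup_n F n) by exact: bigcupT_measurable.
pose Fn n := \bigcup_(i in [set i | (i < n)%N]) F i.
have mFn n : measurable (Fn n) by exact: bigcup_measurable.
pose V0 n := (V `&` \bigcup_n F n) `\` Fn n.
have mV0 n : measurable (V0 n) by apply: measurableD => //; exact: measurableI.
have [||n0 h] := @decreasing_prob _ _ _ mu V0 mV0 _ _ (e / 2) ltac:(lra).
- move=> n x [Ox nx]; split => // -[i /= iN Fx]; apply: nx.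
  by exists i => //=; exact: ltnW.
- suff -> : \bigcap_n V0 n = set0 by rewrite /prob measure0.
  apply/seteqP; split => // x Vx.
  have [[Ox [i _ Fx]] _] := Vx 0%N I.
  by have [_] := Vx i.+1 I; apply; exists i => /=.
exists n0; have := h n0 (leqnn _) => hV.
have mD : measurable (V `\` \bigcup_n F n) by exact: measurableD.
have : prob mu (V `\` Fn n0) <= prob mu ((V `\` \bigcup_n F n) `|` V0 n0).
  apply: prob_le; [exact: measurableD|exact: measurableU|].
  move=> x [Ox nx]; have [FFx|nF] := pselect ((\bigcup_n F n) x); last by left.
  by right.
have : prob mu ((V `\` \bigcup_n F n) `|` V0 n0) <= prob mu (V `\` \bigcup_n F n) + prob mu (V0 n0).
  exact: probU2.
rewrite -/(Fn n0); lra.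
Qed.

(** Approximating from both sides makes the class stable under complements, as required to reach the
    whole sigma-algebra. *)
Definition regular_set (U : set X) := forall e : R, 0 < e -> exists F V : set X,
  [/\ dclosed d F, dopen d V, F `<=` U, U `<=` V & prob mu (V `\` F) <= e].

Lemma dclosed_fin_bigcup (F : nat -> set X) n : (forall i, dclosed d (F i)) ->
  dclosed d (\bigcup_(i in [set i | (i < n)%N]) F i).
Proof.
move=> cF; have := @dclosed_fin _ _ d 'I_n (fun i => F i) (fun i => cF i).
congr dclosed; apply/seteqP; split => x /=; first by move=> [i Fx]; exists i => /=.
by move=> [i /= iN Fx]; exists (Ordinal iN).
Qed.

Lemma dopen_regular U : dopen d U -> regular_set U.
Proof.
move=> oU e e0.
(* The points at distance at least [1 / n.+1] from the complement of [U] exhaust [U] by closed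
   sets. *)
pose F n := [set x | forall y, ~ U y -> n.+1%:R^-1 <= d x y].
have cF n : dclosed d (F n).
  rewrite /F; move: (n.+1%:R^-1) => r x /existsNP[y /not_implyP[nUy /negP]].
  rewrite -ltNge => xy; exists (r - d x y) => [|z]; first by rewrite subr_gt0.
  rewrite /dball/= => xz /(_ y nUy); have := dtri dm x z y; rewrite (dsym dm z x); lra.
have FU : \bigcup_n F n = U.
  apply/seteqP; split => x.
    move=> [n _ Fx]; apply: contrapT => /Fx; rewrite (dxx dm).
    by rewrite leNgt invr_gt0 ltr0n.
  move=> /oU[r r0 hr]; have [n [n0 hn]] := bigger r^-1.
  exists n => // y nUy; rewrite leNgt; apply/negP => xy; apply: nUy; apply: hr.
  rewrite /dball/=; apply: (lt_le_trans xy); rewrite -[leRHS]invrK lef_pV2 ?posrE ?invr_gt0//.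
  by rewrite (le_trans hn)// ler_nat.
have mF n := dclosed_measurable hm (cF n).
have [|n hn] := @prob_setD_bigcup U F e (dopen_measurable hm oU) mF _ e0.
  by rewrite FU setDv /prob measure0/=; lra.
exists (\bigcup_(i in [set i | (i < n)%N]) F i), U; split => //.
  exact: dclosed_fin_bigcup.
by rewrite -[X in _ `<=` X]FU => x [i _ Fx]; exists i.
Qed.

Lemma measurable_regular U : measurable U -> regular_set U.
Proof.
rewrite hm; move: U; apply: smallest_sub; last exact: dopen_regular.
split.
- move=> e e0; exists set0, set0; split => //.
  + by rewrite /dclosed setC0 => x _; exists 1.
  + by rewrite setD0 /prob measure0; exact: ltW.
- move=> U rU e e0; have [F [V [cF oO FU UO h]]] := rU e e0.
  exists (~` V), (~` F); split.
  + by rewrite /dclosed setCK.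
  + exact: cF.
  + by move=> x nO; split => // /UO.
  + by move=> x [_ nU] /FU.
  + apply: le_trans h; rewrite le_eqVlt; apply/orP; left; apply/eqP; congr prob.
    by apply/seteqP; split => x [a b]; split => //; exact: contrapT.
- move=> U rU e e0.
  have [F hF] := choice (fun n => rU n (e / 2 / (2 ^ n.+1)%:R) ltac:(by rewrite !divr_gt0// ltr0n expn_gt0)).
  have [V hO] := choice hF.
  have mO n : measurable (V n) by case: (hO n) => _ /(dopen_measurable hm).
  have mF n : measurable (F n) by case: (hO n) => /(dclosed_measurable hm).
  have mOO : measurable (\bigcup_n V n) by exact: bigcupT_measurable.
  have [|n hn] := @prob_setD_bigcup _ F e mOO mF _ e0.
    apply: (@le_trans _ _ (prob mu (\bigcup_n (V n `\` F n)))).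
      apply: prob_le.
      + by apply: measurableD => //; exact: bigcupT_measurable.
      + by apply: bigcupT_measurable => n; exact: measurableD.
      + move=> x [[n _ Ox] nF]; exists n => //; split => // Fx; apply: nF; by exists n.
    apply: prob_bigcup_le; [by move=> n; exact: measurableD|lra|].
    by move=> n; case: (hO n).
  exists (\bigcup_(i in [set i | (i < n)%N]) F i), (\bigcup_n V n); split => //.
  + by apply: dclosed_fin_bigcup => i; case: (hO i).
  + by apply: dopen_bigcup => i; case: (hO i).
  + by move=> x [i _ Fx]; exists i => //; case: (hO i) => _ _ h _ _; exact: h.
  + by move=> x [i _ Ux]; exists i => //; case: (hO i) => _ _ _ h _; exact: h.
Qed.

Lemma inner_regular U (e : R) : measurable U -> 0 < e -> exists F : set X,
  [/\ dclosed d F, F `<=` U & prob mu (U `\` F) <= e].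
Proof.
move=> mU e0; have [F [V [cF oO FU UO h]]] := measurable_regular mU e0.
exists F; split => //; apply: le_trans h; apply: prob_le.
- by apply: measurableD => //; exact: (dclosed_measurable hm).
- by apply: measurableD; [exact: (dopen_measurable hm)|exact: (dclosed_measurable hm)].
- by move=> x [/UO].
Qed.

End Regularity.

(** * Counting and trees *)

Section Images.
Context {X : Type}.

Definition img {T : finType} (a : X -> T) (G : set X) : {set T} :=
  [set t | `[< exists2 x, G x & a x = t >]]%SET.

Lemma imgP {T : finType} (a : X -> T) G t : reflect (exists2 x, G x & a x = t) (t \in img a G).
Proof. by rewrite inE; exact: asboolP. Qed.

Lemma mem_img {T : finType} (a : X -> T) (G : set X) x : G x -> a x \in img a G.
Proof. by move=> Gx; apply/imgP; exists x. Qed.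

Lemma card_img_le {T T' : finType} (a : X -> T) (b : X -> T') (G : set X) :
  (forall x y, G x -> G y -> b x = b y -> a x = a y) -> (#|img a G| <= #|img b G|)%N.
Proof.
move=> H; have [->|/set0Pn[t0 _]] := eqVneq (img a G) finset.set0; first by rewrite cards0.
have /choice[psi hpsi] t' : exists t, forall x, G x -> b x = t' -> a x = t.
  have [[x Gx bx]|nx] := pselect (exists2 x, G x & b x = t').
    by exists (a x) => y Gy by_; apply: H => //; rewrite by_.
  by exists t0 => x Gx bx; case: nx; exists x.
apply: leq_trans (leq_imset_card psi (img b G)).
apply: subset_leq_card; apply/fintype.subsetP => t /imgP[x Gx <-].
by rewrite (hpsi (b x) x Gx erefl); apply: imset_f; exact: mem_img.
Qed.

Lemma img_sub {T : finType} (a : X -> T) (G : set X) (S : {set T}) :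
  (forall x, G x -> a x \in S) -> (#|img a G| <= #|S|)%N.
Proof.
by move=> H; apply: subset_leq_card; apply/fintype.subsetP => t /imgP[x Gx <-]; exact: H.
Qed.

End Images.

Section Counting.
Context {R : realType}.

(* Chernoff's method: count [w] with weight [expR (a * (s Q - number of bad indices))]. *)
Lemma card_few_bad (B : finType) (Q : nat) (C : 'I_Q -> {set B}) (c a s : R) :
  (forall i, #|C i|%:R <= c) -> 0 <= a ->
  #|[set w : {ffun 'I_Q -> B} | #|[set i | w i \notin C i]%SET|%:R <= s * Q%:R]%SET|%:R
    <= expR (a * s * Q%:R) * (c + expR (- a) * #|B|%:R) ^+ Q.
Proof.
move=> Cc a0; set S := [set w | _]%SET.
pose F i b : R := if b \in C i then 1 else expR (- a).
have FE (w : {ffun 'I_Q -> B}) : \prod_i F i (w i) = expR (- a * #|[set i | w i \notin C i]%SET|%:R).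
  rewrite expRM_natr (bigID (fun i => w i \in C i))/= big1 ?mul1r => [|i wi]; last by rewrite /F wi.
  rewrite (eq_bigr (fun=> expR (- a))) => [|i /negbTE wi]; last by rewrite /F wi.
  by rewrite prodr_const; congr (_ ^+ _); apply: eq_card => i; rewrite !inE.
apply: (@le_trans _ _ (\sum_(w : {ffun 'I_Q -> B}) expR (a * s * Q%:R) * \prod_i F i (w i))).
  rewrite -sum1_card natr_sum big_mkcond/=; apply: ler_sum => w _.
  have p0 : 0 <= \prod_i F i (w i) by rewrite FE expR_ge0.
  case: ifP => [|_]; last by rewrite mulr_ge0 ?expR_ge0.
  rewrite inE => h; rewrite FE -expRD -[leLHS]expR0 ler_expR.
  have : a * #|[set i | w i \notin C i]%SET|%:R <= a * (s * Q%:R) by rewrite ler_wpM2l.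
  lra.
rewrite -mulr_sumr ler_wpM2l ?expR_ge0// -(bigA_distr_bigA F).
rewrite -[X in _ ^+ X]card_ord -prodr_const; apply: ler_prod => i _.
rewrite sumr_ge0/=; last by move=> b _; rewrite /F; case: ifP; rewrite ?expR_ge0.
rewrite (bigID (fun b => b \in C i))/=; apply: lerD.
  rewrite (eq_bigr (fun=> 1)) => [|b bC]; last by rewrite /F bC.
  by rewrite sumr_const; apply: le_trans (Cc i).
rewrite (eq_bigr (fun=> expR (- a))) => [|b /negbTE bC]; last by rewrite /F bC.
rewrite sumr_const -[leLHS]mulr_natr ler_wpM2l ?expR_ge0// ler_nat; exact: max_card.
Qed.

(** [card_few_bad] with one good letter in each place. The weight [a] is large enough for
    [expR (- a) * k <= eta / 2], and then [s] small enough for [a * s <= eta / 2]; neither depends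
    on [n]. *)
Lemma hamming_ball (k : nat) (eta : R) : 0 < eta -> exists2 s : R, 0 < s &
  forall (n : nat) (w0 : {ffun 'I_n -> 'I_k}),
  #|[set w : {ffun 'I_n -> 'I_k} | #|[set j | w0 j != w j]%SET|%:R <= s * n%:R]%SET|%:R
    <= expR (eta * n%:R).
Proof.
move=> e0; pose a : R := 2 * k%:R / eta.
have a0 : 0 <= a by rewrite divr_ge0 ?(ltW e0)// mulr_ge0.
have a1 : 0 < 2 * (a + 1) by lra.
exists (eta / (2 * (a + 1))); first by rewrite divr_gt0.
move=> n w0; set s := eta / _.
have ea : expR (- a) * k%:R <= eta / 2.
  have h1 : 1 + a <= expR a by exact: expR_ge1Dx.
  rewrite expRN mulrC ler_pdivrMr ?expR_gt0//.
  apply: (@le_trans _ _ (eta / 2 * (1 + a))); last by rewrite ler_wpM2l//; lra.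
  rewrite mulrDr mulr1 /a.
  have -> : eta / 2 * (2 * k%:R / eta) = k%:R by field; rewrite gt_eqF.
  lra.
have := @card_few_bad 'I_k n (fun j => [set w0 j]%SET) 1 a s _ a0.
have -> : [set w : {ffun 'I_n -> 'I_k} | #|[set i | w i \notin [set w0 i]]%SET|%:R <= s * n%:R]%SET =
    [set w : {ffun 'I_n -> 'I_k} | #|[set j | w0 j != w j]%SET|%:R <= s * n%:R]%SET.
  apply/setP => w; rewrite !inE; congr (_%:R <= _).
  by apply: eq_card => i; rewrite !inE eq_sym.
move=> h; apply: (le_trans (h _)) => [i|]; first by rewrite cards1.
rewrite card_ord.
have -> : expR (eta * n%:R) = expR (eta / 2 * n%:R) * expR (eta / 2 * n%:R) by rewrite -expRD; congr expR; lra.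
rewrite ler_pM ?expR_ge0// ?exprn_ge0//.
- rewrite ler_expR ler_wpM2r// /s mulrA ler_pdivrMr//; lra.
- rewrite expRM_natr lerXn2r ?nnegrE ?expR_ge0//.
  by rewrite (le_trans _ (expR_ge1Dx _))// lerD2l.
Qed.

(** The inequality [ln t <= t - 1] at [t = r / p]. Summed over a probability [p] and weights [r] of
    total at most [1], the terms [r - p] contribute nothing positive. *)
Lemma gibbs (p r : R) : 0 <= p -> 0 < r -> phiH p <= - (p * ln r) + r - p.
Proof.
move=> p0 r0; rewrite /phiH; have [->|pn0] := eqVneq p 0; first by rewrite !mul0r; lra.
have pp : 0 < p by rewrite lt0r pn0.
have h : ln (r / p) <= r / p - 1.
  have rp : 0 < r / p by rewrite divr_gt0.
  have := @le_ln1Dx R (r / p - 1); rewrite (_ : 1 + (r / p - 1) = r / p); last by lra.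
  by apply; lra.
have E : p * (r / p) = r by rewrite mulrCA divff ?mulr1// gt_eqF.
have : p * ln (r / p) <= p * (r / p - 1) by rewrite ler_wpM2l.
rewrite [in leRHS]mulrBr E mulr1 ln_div ?posrE//; lra.
Qed.

(** Gibbs' inequality against reference weights that put total [1 / 2] uniformly on [S] and weight
    [1 / (2 #|T|)] on every point outside [S]. *)
Lemma entropy_le (T : finType) (p : T -> R) (S : {set T}) (del : R) :
  (forall t, 0 <= p t) -> \sum_t p t = 1 -> S != finset.set0 ->
  \sum_(t | t \notin S) p t <= del ->
  \sum_t phiH (p t) <= ln 2 + ln #|S|%:R + del * ln #|T|%:R.
Proof.
move=> p0 p1 S0 pS.
have sp : 0 < #|S|%:R :> R by rewrite ltr0n card_gt0.
have ST : #|S|%:R <= #|T|%:R :> R by rewrite ler_nat max_card.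
have tp : 0 < #|T|%:R :> R by exact: lt_le_trans ST.
pose r t : R := if t \in S then (2 * #|S|%:R)^-1 else (2 * #|T|%:R)^-1.
have r0 t : 0 < r t by rewrite /r; case: ifP => _; rewrite invr_gt0 mulr_gt0.
apply: (@le_trans _ _ (\sum_t (- (p t * ln (r t)) + r t - p t))).
  by apply: ler_sum => t _; exact: gibbs.
rewrite !big_split/= !sumrN p1.
have r1 : \sum_t r t <= 1.
  rewrite (bigID (mem S))/= (eq_bigr (fun=> (2 * #|S|%:R)^-1)) => [|t tS]; last by rewrite /r tS.
  rewrite [X in _ + X](eq_bigr (fun=> (2 * #|T|%:R)^-1)) => [|t /negbTE tS]; last by rewrite /r tS.
  rewrite !sumr_const.
  have h1 : (2 * #|S|%:R)^-1 *+ #|S| = 2^-1 :> R.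
    by rewrite -[LHS]mulr_natr invfM -mulrA mulVf ?mulr1// gt_eqF.
  have h2 : (2 * #|T|%:R)^-1 *+ #|[pred t | t \notin S]| <= 2^-1 :> R.
    rewrite -[leLHS]mulr_natr invfM -mulrA ger_pMr ?invr_gt0// mulrC ler_pdivrMr// mul1r ler_nat.
    exact: max_card.
  have -> : (2 * #|S|%:R)^-1 *+ #|S| = 2^-1 :> R by exact: h1.
  lra.
have lr : - \sum_t p t * ln (r t) <= ln 2 + ln #|S|%:R + del * ln #|T|%:R.
  rewrite (bigID (mem S))/=.
  rewrite (eq_bigr (fun t => p t * (- (ln 2 + ln #|S|%:R)))) => [|t tS]; last first.
    by rewrite /r tS lnV ?posrE ?mulr_gt0// lnM ?posrE.
  rewrite [X in _ + X](eq_bigr (fun t => p t * (- (ln 2 + ln #|T|%:R)))) => [|t /negbTE tS]; last first.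
    by rewrite /r tS lnV ?posrE ?mulr_gt0// lnM ?posrE.
  rewrite -!mulr_suml.
  move: p1; rewrite (bigID (mem S))/=.
  set a := \sum_(t in S) p t; set b := \sum_(t | t \notin S) p t in pS *.
  move=> ab.
  have b0 : 0 <= b by apply: sumr_ge0 => t _.
  have lS : 0 <= ln #|S|%:R :> R by rewrite ln_ge0// ler1n card_gt0.
  have lT : 0 <= ln #|T|%:R :> R by rewrite ln_ge0// (le_trans _ ST)// ler1n card_gt0.
  have h1 : b * ln #|T|%:R <= del * ln #|T|%:R by rewrite ler_wpM2r.
  have h2 : 0 <= b * ln #|S|%:R by rewrite mulr_ge0.
  have -> : a = 1 - b by lra.
  lra.
lra.
Qed.

End Counting.

Section PrunedTree.
Context {X : Type} {T : finType} (far : rel T) (V D q : nat).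
Context (far_sym : symmetric far) (V0 : (0 < V)%N)
  (farV : forall b, (#|[set b' | ~~ far b b']%SET| <= V)%N).

(** Greedy choice: each chosen element excludes at most [V] elements of [S]. *)
Lemma far_selection (t0 : T) (r : nat) (S : {set T}) : (r * V <= #|S|)%N ->
  exists g : nat -> T, (forall a, (a < r)%N -> g a \in S) /\
    forall a b, (a < r)%N -> (b < r)%N -> a != b -> far (g a) (g b).
Proof.
elim: r S => [|r IH] S rS; first by exists (fun=> t0); split.
have /card_gt0P[b bS] : (0 < #|S|)%N by apply: leq_trans rS; rewrite mulSn addn_gt0 V0.
have [|g [gS gfar]] := IH (S :\: [set b' | ~~ far b b'])%SET.
  rewrite cardsD leq_subRL; last by apply: subset_leq_card; exact: subsetIl.
  apply: leq_trans rS; rewrite mulSn leq_add2r.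
  by apply: leq_trans (farV b); apply: subset_leq_card; exact: subsetIr.
have gP a : (a < r)%N -> g a \in S /\ far b (g a).
  by move=> /gS; rewrite !inE negbK => /andP[-> ->].
exists (fun a => if a is a'.+1 then g a' else b); split => [[|a] //|[|a] [|a'] //].
- by move=> /gP[].
- by move=> _ /gP[].
- by move=> /gP[_ h] _ _; rewrite far_sym.
- by move=> ar a'r aa; apply: gfar.
Qed.

(* A tree of depth [M] with at most [D] children per node and more than
   [M q V D^(M-1)] leaves contains a subtree in which every node has [q] pairwise
   far children. *)
Lemma pruned_tree M (beta : nat -> X -> T) (G : set X) :
  (forall m, (m < M)%N -> #|img (beta m) G| <= D)%N ->
  (M * (q * V) * D ^ M < D * #|img (fun x => [ffun m : 'I_M => beta m x]) G|)%N ->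
  exists leaf : (nat -> nat) -> X, forall v, (forall m, (m < M)%N -> v m < q)%N ->
    G (leaf v) /\ forall v', (forall m, (m < M)%N -> v' m < q)%N ->
    forall m, (m < M)%N -> (forall i, (i < m)%N -> v i = v' i) -> v m != v' m ->
    far (beta m (leaf v)) (beta m (leaf v')).
Proof.
elim: M beta G => [|M IH] beta G HD Hleaf.
  have /card_gt0P[t /imgP[x Gx _]] : (0 < #|img (fun x => [ffun m : 'I_0 => beta m x]) G|)%N.
    by move: Hleaf; rewrite !mul0n muln_gt0 => /andP[].
  by exists (fun=> x) => v _; split.
pose Gb b := G `&` [set x | beta 0%N x = b].
pose lf b := #|img (fun x => [ffun m : 'I_M => beta m.+1 x]) (Gb b)|.
have Gbsub b : (lf b <= D ^ M)%N.
  rewrite /lf; pose S := family (fun m : 'I_M => mem (img (beta m.+1) (Gb b))).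
  apply: (@leq_trans #|S|).
    apply: subset_leq_card; apply/fintype.subsetP => t /imgP[x Gx <-].
    by apply/familyP => m; rewrite ffunE; exact: mem_img.
  have h (s : seq 'I_M) : (foldr muln 1 [seq #|img (beta m.+1) (Gb b)| | m : 'I_M <- s] <= D ^ size s)%N.
    elim: s => [|m s IHs] //=; rewrite expnS leq_mul//.
    apply: leq_trans (HD m.+1 (ltn_ord m)).
    by apply: subset_leq_card; apply/fintype.subsetP => t /imgP[x [Gx _] <-]; exact: mem_img.
  by have := h (enum 'I_M); rewrite size_enum_ord /S card_family.
have leafs : (#|img (fun x => [ffun m : 'I_M.+1 => beta m x]) G| <= \sum_(b in img (beta 0%N) G) lf b)%N.
  set a := fun x => _; rewrite -sum1_card.
  rewrite (partition_big (fun t : {ffun 'I_M.+1 -> T} => t ord0) (mem (img (beta 0%N) G))) => [|t /imgP[x Gx <-]]; last first.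
    by rewrite /a ffunE; exact: mem_img.
  apply: leq_sum => b _; rewrite sum1_card.
  apply: (@leq_trans #|img a (Gb b)|).
    apply: subset_leq_card; apply/fintype.subsetP => t; rewrite unfold_in => /andP[/imgP[x Gx <-]].
    by rewrite /a ffunE => /eqP xb; apply/imgP; exists x.
  apply: card_img_le => x y [_ /= xb] [_ yb] /ffunP xy; apply/ffunP => -[[|m] mM].
    by rewrite !ffunE /= xb yb.
  by have := xy (Ordinal (mM : (m < M)%N)); rewrite !ffunE.
pose K := (M * (q * V) * D ^ M)%N.
pose good := [set b in img (beta 0%N) G | (K < D * lf b)%N]%SET.
(* [good] collects the children whose subtrees satisfy the hypothesis at depth [M]. Fewer than
   [q * V] of them, with at most [D ^ M] leaves each, together with at most [D] others having at
   most [K / D] leaves each, would give too few leaves. *)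
have goodq : (q * V <= #|good|)%N.
  rewrite leqNgt; apply/negP => gq; move: Hleaf; rewrite ltnNge => /negP; apply.
  apply: (leq_trans (leq_mul (leqnn D) leafs)).
  rewrite big_distrr/= (bigID (fun b => b \in good))/=.
  have h1 : (\sum_(b in img (beta 0%N) G | b \in good) D * lf b <= #|good| * (D * D ^ M))%N.
    rewrite -sum_nat_const.
    apply: (@leq_trans (\sum_(b in img (beta 0%N) G | b \in good) D * D ^ M)%N).
      by apply: leq_sum => b _; rewrite leq_mul2l Gbsub orbT.
    rewrite big_mkcondl/=; apply: leq_sum => b _; by case: ifP.
  have h2 : (\sum_(b in img (beta 0%N) G | b \notin good) D * lf b <= D * K)%N.
    apply: (@leq_trans (\sum_(b in img (beta 0%N) G) K)%N).
      rewrite big_mkcondr/=; apply: leq_sum => b bG; case: ifP => //.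
      by rewrite inE bG /= -leqNgt.
    by rewrite sum_nat_const leq_mul2r HD ?orbT.
  apply: (leq_trans (leq_add h1 h2)); rewrite /K expnS.
  have : (#|good| * (D * D ^ M) <= q * V * (D * D ^ M))%N by rewrite leq_mul2r ltnW ?orbT.
  move: (D ^ M)%N (q * V)%N => DM qV h; apply: (leq_trans (leq_add h (leqnn _))).
  by rewrite mulSn mulnDl leq_add2l; lia.
have [t0] : exists t0, t0 \in img (beta 0%N) G.
  have : (0 < D * #|img (fun x => [ffun m : 'I_M.+1 => beta m x]) G|)%N by exact: leq_ltn_trans Hleaf.
  rewrite muln_gt0 => /andP[_ /card_gt0P[t /imgP[x Gx _]]].
  by exists (beta 0%N x); exact: mem_img.
move=> /imgP[x0 Gx0 _].
have [g [gS gfar]] := far_selection (beta 0%N x0) goodq.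
have sub b : exists leaf : (nat -> nat) -> X, b \in good ->
    forall v, (forall m, (m < M)%N -> v m < q)%N ->
    Gb b (leaf v) /\ forall v', (forall m, (m < M)%N -> v' m < q)%N ->
    forall m, (m < M)%N -> (forall i, (i < m)%N -> v i = v' i) -> v m != v' m ->
    far (beta m.+1 (leaf v)) (beta m.+1 (leaf v')).
  have [bg|bg] := boolP (b \in good); last by exists (fun=> x0).
  have [m mM||leaf hl] := IH (fun m => beta m.+1) (Gb b).
  - apply: leq_trans (HD m.+1 mM).
    by apply: subset_leq_card; apply/fintype.subsetP => t /imgP[x [Gx _] <-]; exact: mem_img.
  - by move: bg; rewrite inE => /andP[_].
  - by exists leaf.
have [lv hlv] := choice sub.
exists (fun v => lv (g (v 0%N)) (fun m => v m.+1)) => v hv.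
have vg := gS _ (hv 0%N isT).
have [[h1 h2] h3] := hlv _ vg (fun m => v m.+1) (fun m mM => hv m.+1 mM).
split => // v' hv' [|m] mM agree vv.
  have v'g := gS _ (hv' 0%N isT).
  have [[_ h2'] _] := hlv _ v'g (fun m => v' m.+1) (fun m mM => hv' m.+1 mM).
  by rewrite h2 h2'; apply: gfar => //; [exact: hv|exact: hv'].
rewrite -(agree 0%N isT); apply: h3 => //.
  by move=> i iM; exact: hv'.
by move=> i im; exact: agree.
Qed.

End PrunedTree.

(** * Measure-theoretic entropy and names *)

Section Names.
Context {R : realType} {dsp : measure_display} {X : measurableType dsp}.
Context (f : X -> X) (mf : measurable_fun [set: X] f) (mu : probability X R).
Context (imu : Defs.invariant f mu).
Context (k : nat) (P : 'I_k -> set X) (hP : meas_partition P).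
Context (lab : X -> 'I_k) (labP : forall x, P (lab x) x).

Definition nm n x : {ffun 'I_n -> 'I_k} := [ffun i : 'I_n => lab (iter i f x)].

Lemma lab_eq x i : P i x -> lab x = i.
Proof.
move=> Pi; apply: contrapT => /eqP li; have [_ /(_ _ _ li) h _] := hP.
by have : (P (lab x) `&` P i) x by []; rewrite h.
Qed.

Lemma alphabet_gt0 : (0 < k)%N.
Proof. by case: k (lab point) => [[]|]. Qed.

Lemma measurable_lab_iter i n : measurable [set x | lab (iter n f x) = i].
Proof.
have -> : [set x | lab (iter n f x) = i] = [set: X] `&` iter n f @^-1` P i.
  apply/seteqP; split => x /=; first by move=> <-.
  by move=> [_ /lab_eq].
by apply: measurable_iter => //; case: hP.
Qed.

Lemma measurable_nm n w : measurable [set x | nm n x = w].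
Proof.
have -> : [set x | nm n x = w] = \bigcap_(i in [set: 'I_n]) [set x | lab (iter i f x) = w i].
  apply/seteqP; split => x /=; first by move=> <- i _; rewrite /= ffunE.
  by move=> h; apply/ffunP => i; rewrite ffunE h.
by apply: fin_bigcap_measurable => // i _; exact: measurable_lab_iter.
Qed.

Lemma measurable_nm_in n (S : {set {ffun 'I_n -> 'I_k}}) : measurable [set x | nm n x \in S].
Proof.
have -> : [set x | nm n x \in S] = \bigcup_(w in [set` S]) [set x | nm n x = w].
  by apply/seteqP; split => x /=; [move=> h; exists (nm n x)|move=> [w /= wS xw]; rewrite xw].
by apply: fin_bigcup_measurable => // w _; exact: measurable_nm.
Qed.

Lemma prob_nm_in n (S : {set {ffun 'I_n -> 'I_k}}) :
  \sum_(w in S) prob mu [set x | nm n x = w] = prob mu [set x | nm n x \in S].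
Proof.
rewrite -big_enum/=; have : uniq (enum S) by exact: enum_uniq.
have -> : [set x | nm n x \in S] = [set x | nm n x \in enum S].
  by apply/seteqP; split => x /=; rewrite mem_enum.
elim: (enum S) => [|w s IH] /=.
  rewrite big_nil => _; suff -> : [set x | nm n x \in [::]] = set0 by rewrite /prob measure0.
  by apply/seteqP; split.
move=> /andP[ws us]; rewrite big_cons IH//.
have ms : measurable [set x | nm n x \in s].
  have := measurable_nm_in [set w | w \in s]%SET; congr measurable.
  by apply/seteqP; split => x /=; rewrite inE.
have -> : [set x | nm n x \in w :: s] = [set x | nm n x = w] `|` [set x | nm n x \in s].
  apply/seteqP; split => x /=; rewrite inE.
    by move=> /predU1P[->|?]; [left|right].
  by move=> [->|->]; rewrite ?eqxx ?orbT.
have mw := measurable_nm w.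
apply: EFin_inj; rewrite EFinD -!probE//; last exact: measurableU.
rewrite measureU//; apply/seteqP; split => x //= -[-> ] h.
by rewrite h in ws.
Qed.

Lemma HjoinE n : Hjoin f mu P n = \sum_w phiH (prob mu [set x | nm n x = w]).
Proof.
apply: eq_bigr => w _; congr (phiH (fine (mu _))).
apply/seteqP; split => x /=.
  by move=> h; apply/ffunP => i; rewrite ffunE; apply: lab_eq; exact: (h i).
by move=> <- i _ /=; rewrite ffunE; exact: labP.
Qed.

Lemma Hjoin_le n (G : set X) (del : R) : measurable G -> G !=set0 ->
  prob mu (~` G) <= del ->
  Hjoin f mu P n <= ln 2 + ln #|img (nm n) G|%:R + del * (n%:R * ln k%:R).
Proof.
move=> mG [x0 Gx0] pG; rewrite HjoinE.
have := @entropy_le R _ (fun w => prob mu [set x | nm n x = w]) (img (nm n) G) del.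
rewrite card_ffun !card_ord natrX lnXn ?ltr0n ?alphabet_gt0// (_ : ln k%:R *+ n = n%:R * ln k%:R); last by rewrite mulr_natl.
apply.
- by move=> w; exact: prob_ge0.
- have -> : \sum_w prob mu [set x | nm n x = w] = \sum_(w in finset.setT) prob mu [set x | nm n x = w].
    by apply: eq_bigl => w; rewrite inE.
  rewrite prob_nm_in -(probT mu); congr prob.
  by apply/seteqP; split => x //= _; rewrite inE.
- by apply/set0Pn; exists (nm n x0); exact: mem_img.
- rewrite (eq_bigl (mem (~: img (nm n) G)%SET)) => [|w]; last by rewrite /= !inE.
  rewrite prob_nm_in; apply: le_trans pG; apply: prob_le.
  + exact: measurable_nm_in.
  + exact: measurableC.
  + move=> x /=; rewrite inE => h Gx; move: h; by rewrite mem_img.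
Qed.

Lemma img_nm_mono n n' G : (n <= n')%N -> (#|img (nm n) G| <= #|img (nm n') G|)%N.
Proof.
move=> nn; apply: card_img_le => x y _ _ /ffunP h; apply/ffunP => i.
by have := h (widen_ord nn i); rewrite !ffunE.
Qed.

Definition blocks Q b x : {ffun 'I_Q -> {ffun 'I_b -> 'I_k}} :=
  [ffun i : 'I_Q => nm b (iter (i * b) f x)].

Lemma img_nm_blocks Q b G : (#|img (nm (Q * b)) G| <= #|img (blocks Q b) G|)%N.
Proof.
apply: card_img_le => x y _ _ /ffunP h; apply/ffunP => i; rewrite !ffunE.
have b0 : (0 < b)%N by case: b i {h} => // i; case: i => i; rewrite muln0.
have iQ : (i %/ b < Q)%N by rewrite ltn_divLR.
have := h (Ordinal iQ); rewrite !ffunE => /ffunP/(_ (Ordinal (ltn_pmod i b0))).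
by rewrite !ffunE /= -!iterD addnC -divn_eq.
Qed.

(** Bounds the number of [n]-names needed to cover all but measure [del], the quantity in Katok's
    entropy formula. *)
Definition small n (del rho : R) := exists G : set X, [/\ measurable G,
  prob mu (~` G) <= del & #|img (nm n) G|%:R <= expR (rho * n%:R)].

Lemma prob_lt1_nonempty (G : set X) (del : R) : prob mu (~` G) <= del -> del < 1 -> G !=set0.
Proof.
move=> pG d1; apply/set0P/negP => /eqP G0.
by move: pG; rewrite G0 setC0 probT leNgt d1.
Qed.

Lemma small_rate_ge0 n (del rho : R) : (0 < n)%N -> del < 1 -> small n del rho -> 0 <= rho.
Proof.
move=> n0 d1 [G [mG pG cG]]; have [x Gx] := prob_lt1_nonempty pG d1.
have : 1 <= expR (rho * n%:R).
  apply: le_trans cG; rewrite ler1n card_gt0; apply/set0Pn; exists (nm n x); exact: mem_img.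
by rewrite -[leLHS]expR0 ler_expR pmulr_lge0// ltr0n.
Qed.

Lemma ln_alphabet_ge0 : 0 <= ln k%:R :> R.
Proof. by rewrite ln_ge0// ler1n alphabet_gt0. Qed.

(* Most orbits have most of their [b]-blocks in the list given by [small b del rho],
   which bounds the number of longer names. *)
Lemma small_blocks b (del rho s : R) Q : 0 <= del -> 0 < s -> 0 <= rho -> small b del rho ->
  exists G, [/\ measurable G, prob mu (~` G) * s <= del &
    #|img (blocks Q b) G|%:R <= expR (Q%:R * (rho * b%:R + ln 2 + s * (b%:R * ln k%:R)))].
Proof.
move=> d0 s0 r0 [G0 [mG0 pG0 cG0]].
pose U i := iter (i * b) f @^-1` (~` G0).
have mU i : measurable (U i).
  by rewrite /U -[X in measurable X]setTI; apply: measurable_iter => //; exact: measurableC.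
have pU i : (i < Q)%N -> prob mu (U i) <= del.
  by move=> _; rewrite /U (prob_iter mf imu)//; exact: measurableC.
have [mV pV] := prob_count_le s0 d0 mU pU; set V := [set x | _] in mV pV.
exists (~` V); split; [exact: measurableC|by rewrite setCK|].
pose S := img (nm b) G0.
pose W := [set w : {ffun 'I_Q -> {ffun 'I_b -> 'I_k}} |
   #|[set i | w i \notin S]%SET|%:R <= s * Q%:R]%SET.
apply: (@le_trans _ _ #|W|%:R).
  rewrite ler_nat; apply: img_sub => x xV; rewrite inE.
  have : \sum_(i < Q) \1_(U i) x <= s * Q%:R by rewrite leNgt; exact/negP.
  apply: le_trans; rewrite -sum1_card natr_sum big_mkcond/=; apply: ler_sum => i _.
  rewrite indicE inE ffunE; case: ifPn => // iS.
  rewrite mem_set// /U /preimage/= => Gx.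
  by move: iS; rewrite mem_img.
(* With the weight [b * ln k] the [k ^ b] possible blocks in an exceptional place count together as
   one. *)
have a0 : 0 <= b%:R * ln k%:R :> R by rewrite mulr_ge0 ?ln_alphabet_ge0.
have := @card_few_bad R _ Q (fun=> S) (expR (rho * b%:R)) (b%:R * ln k%:R) s (fun=> cG0) a0.
move=> h; apply: (le_trans h).
have k0 : 0 < k%:R :> R by rewrite ltr0n alphabet_gt0.
have -> : expR (- (b%:R * ln k%:R)) * #|{ffun 'I_b -> 'I_k}|%:R = 1 :> R.
  rewrite card_ffun !card_ord natrX -mulNr mulrC mulNr expRN expRM_natl lnK ?posrE//.
  by rewrite divff// gt_eqF// exprn_gt0.
have h1 : expR (rho * b%:R) + 1 <= 2 * expR (rho * b%:R).
  have : 1 <= expR (rho * b%:R) by rewrite -[leLHS]expR0 ler_expR mulr_ge0.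
  lra.
have -> : expR (Q%:R * (rho * b%:R + ln 2 + s * (b%:R * ln k%:R))) =
   expR (b%:R * ln k%:R * s * Q%:R) * (2 * expR (rho * b%:R)) ^+ Q.
  have e2 : 2 = expR (ln 2) :> R by rewrite lnK// posrE.
  rewrite {2}e2 -expRD -expRM_natr -expRD; congr expR; ring.
have h2 : 0 <= expR (rho * b%:R) + 1 by rewrite addr_ge0 ?expR_ge0.
have h3 : 0 <= 2 * expR (rho * b%:R) by rewrite mulr_ge0 ?expR_ge0.
by rewrite ler_wpM2l ?expR_ge0// lerXn2r.
Qed.

(** Asked only of arbitrarily large [n]; [small_blocks] transfers the bound from one length to all
    much larger ones. *)
Definition rate_bound (rho : R) := forall del : R, 0 < del -> forall n0,
  exists2 n, (n0 <= n)%N & small n del rho.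

(** A single length [b] controls every large [n]: cutting names into [b]-blocks bounds their number
    on most of the space, and the exceptional set, of measure at most [s], adds at most [s * ln k]
    to the entropy per step. *)
Lemma h_part_le (rho : R) : rate_bound rho -> (h_part f mu P <= rho%:E)%E.
Proof.
move=> hrho; apply/lee_addgt0Pr => eta e0; rewrite -EFinD.
pose K : R := ln k%:R; have K0 : 0 <= K := ln_alphabet_ge0.
pose s : R := Num.min (1 / 2) (eta / (8 * (K + 1))).
have s0 : 0 < s by rewrite lt_min !divr_gt0//; lra.
have s1 : s <= 1 / 2 by rewrite ge_min lexx.
have sK : s * K <= eta / 8.
  have : s <= eta / (8 * (K + 1)) by rewrite ge_min lexx orbT.
  rewrite ler_pdivlMr; last lra.
  have : 0 <= s by exact: ltW.
  lra.
have ss0 : 0 < s * s by rewrite mulr_gt0.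
have [n0 [n00 hn0]] := bigger (4 * ln 2 / eta).
(* With tolerance [s * s], Markov's inequality leaves measure at most [s] to the orbits having more
   than a proportion [s] of unlisted blocks. *)
have [b bn hb] := hrho _ ss0 n0.
have b0 : (0 < b)%N by exact: leq_trans bn.
have br : 0 < b%:R :> R by rewrite ltr0n.
have ss1 : s * s < 1 by nra.
have rho0 := small_rate_ge0 b0 ss1 hb.
have lb : ln 2 <= eta / 4 * b%:R.
  have : n0%:R <= b%:R :> R by rewrite ler_nat.
  by move: hn0; rewrite ler_pdivrMr// => h1 h2; nra.
pose E : R := rho * b%:R + ln 2 + s * (b%:R * K).
have l2 : 0 <= ln 2 :> R by rewrite ln_ge0// ler1n.
have E0 : 0 <= E by rewrite /E !addr_ge0 ?mulr_ge0// ltW.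
have EbE : E <= (rho + eta / 4 + eta / 8) * b%:R.
  have : s * K * b%:R <= eta / 8 * b%:R by rewrite ler_wpM2r// ltW.
  rewrite /E; lra.
have [n1 [n10 hn1]] := bigger ((ln 2 + E) / (eta / 4)).
apply: (@limn_esup_le _ _ _ n1) => n nn; rewrite lee_fin.
have nr : 0 < n%:R :> R by rewrite ltr0n (leq_trans n10).
have [G [mG pG cG]] := small_blocks (n %/ b).+1 (ltW ss0) s0 rho0 hb.
have pG' : prob mu (~` G) <= s by rewrite -(ler_pM2r s0).
have [x0 Gx0] := prob_lt1_nonempty pG' ltac:(lra).
have hH := @Hjoin_le n G s mG (ex_intro _ x0 Gx0) pG'.
have cnt : ln #|img (nm n) G|%:R <= (n %/ b).+1%:R * E.
  rewrite -[leRHS]expRK ler_ln ?posrE ?expR_gt0//; last first.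
    by rewrite ltr0n card_gt0; apply/set0Pn; exists (nm n x0); exact: mem_img.
  apply: le_trans cG; rewrite ler_nat (leq_trans _ (img_nm_blocks _ _ _))//.
  by apply: img_nm_mono; rewrite ltnW// ltn_ceil.
have divb : (n %/ b)%:R * b%:R <= n%:R :> R by rewrite -natrM ler_nat leq_divM.
rewrite mulrC ler_pdivrMr//.
have h1 : (n %/ b)%:R * E <= (rho + eta / 4 + eta / 8) * n%:R.
  apply: (@le_trans _ _ ((n %/ b)%:R * ((rho + eta / 4 + eta / 8) * b%:R))).
    by rewrite ler_wpM2l.
  rewrite mulrCA ler_wpM2l//; lra.
have h2 : ln 2 + E <= eta / 4 * n%:R.
  have : n1%:R <= n%:R :> R by rewrite ler_nat.
  move: hn1; rewrite ler_pdivrMr; last lra.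
  by move=> a1 a2; nra.
have h3 : s * (n%:R * K) <= eta / 8 * n%:R.
  have : s * K * n%:R <= eta / 8 * n%:R by rewrite ler_wpM2r// ltW.
  lra.
rewrite -natr1 mulrDl mul1r in cnt.
rewrite -/K in hH; nra.
Qed.

(** This takes the place of the Shannon-McMillan-Breiman theorem; [r] is the infimum of all rate
    bounds. Above it few names suffice at arbitrarily large lengths; below it, for some tolerance,
    they fail at all large lengths. *)
Lemma entropy_rate (h : R) : (h%:E < h_part f mu P)%E -> exists r : R, [/\ h <= r,
  forall eta, 0 < eta -> rate_bound (r + eta) &
  forall eta, 0 < eta -> exists2 del : R, 0 < del & exists n0, forall n, (n0 <= n)%N ->
    ~ small n del (r - eta)].
Proof.
move=> hh.
have lbh rho : rate_bound rho -> h <= rho.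
  by move=> /h_part_le hr; rewrite -lee_fin (le_trans (ltW hh)).
have Z0 : [set rho | rate_bound rho] !=set0.
  exists (ln k%:R) => /= del d0 n0; exists n0 => //; exists [set: X]; split => //.
    by rewrite setCT /prob measure0 ltW.
  apply: (@le_trans _ _ #|{ffun 'I_n0 -> 'I_k}|%:R); first by rewrite ler_nat max_card.
  by rewrite card_ffun !card_ord natrX expRM_natr lnK// posrE ltr0n alphabet_gt0.
have hinf : has_inf [set rho | rate_bound rho].
  by split => //; exists h => rho; exact: lbh.
exists (inf [set rho | rate_bound rho]); split.
- by apply: lb_le_inf => // rho; exact: lbh.
- move=> eta e0; have [rho hrho lt] := inf_adherent e0 hinf.
  move=> del d0 n0; have [n nn [G [mG pG cG]]] := hrho del d0 n0.
  exists n => //; exists G; split => //; apply: (le_trans cG).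
  by rewrite ler_expR ler_wpM2r// ltW.
- move=> eta e0; apply: contrapT => H.
  have : rate_bound (inf [set rho | rate_bound rho] - eta).
    move=> del d0 n0; apply: contrapT => H'; apply: H; exists del => //; exists n0 => n nn sm.
    by apply: H'; exists n.
  move=> /(ge_inf hinf.2); lra.
Qed.

End Names.

Lemma ereal_lt_real {R : realType} (h : R) (x : \bar R) : (h%:E < x)%E ->
  exists2 h' : R, h < h' & (h'%:E < x)%E.
Proof.
case: x => [x| |] //; last by exists (h + 1); [lra|exact: ltry].
by rewrite lte_fin => hx; exists ((h + x) / 2); rewrite ?lte_fin; lra.
Qed.

Lemma partition_label {X : Type} {k} (P : 'I_k -> set X) : \bigcup_(i in setT) P i = setT ->
  exists lab : X -> 'I_k, forall x, P (lab x) x.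
Proof.
move=> PT; have H x : exists i, P i x.
  by have [i _ Pix] : (\bigcup_(i in setT) P i) x; [rewrite PT|exists i].
by have [lab hlab] := choice H; exists lab.
Qed.

Section ClosedCore.
Context {R : realType} {dsp : measure_display} {X : measurableType dsp}.
Context (d : X -> X -> R) (dm : is_metric d) (cX : dcompact d [set: X]).
Context (hm : (@measurable dsp X) = <<s dopen d >>).

(** Atoms of a measurable partition may touch; disjoint closed subsets of almost full measure lie at
    a positive distance, so that different labels at points of the core mean metric separation. *)
Lemma closed_core (mu : probability X R) k (P : 'I_k -> set X) (g : R) :
  meas_partition P -> 0 < g -> exists F : 'I_k -> set X,
  [/\ forall i, F i `<=` P i, measurable (\bigcup_i F i),
   prob mu (~` (\bigcup_i F i)) <= g &
   exists2 e0 : R, 0 < e0 & forall i j x y, i != j -> F i x -> F j y -> e0 <= d x y].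
Proof.
move=> [mP dP PT] g0.
have gk : 0 < g / k.+1%:R by rewrite divr_gt0// ltr0n.
have [F hF] := choice (fun i => inner_regular dm hm mu (mP i) gk).
have cF i : dclosed d (F i) by case: (hF i).
have FP i : F i `<=` P i by case: (hF i).
have mF i : measurable (F i) by exact: (dclosed_measurable hm).
have mU : measurable (\bigcup_i F i) by exact: fin_bigcup_measurable.
exists F; split => //.
  apply: (@le_trans _ _ (prob mu (\bigcup_(i in [set: 'I_k]) (P i `\` F i)))).
    apply: prob_le; first exact: measurableC.
      by apply: fin_bigcup_measurable => // i _; exact: measurableD.
    move=> x nF; have [i _ Pix] : (\bigcup_(i in setT) P i) x by rewrite PT.
    by exists i => //; split => // Fix; apply: nF; exists i.
  apply: (le_trans (prob_bigU _ _)) => [i|]; first exact: measurableD.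
  apply: (@le_trans _ _ (\sum_(i < k) g / k.+1%:R)); first by apply: ler_sum => i _; case: (hF i).
  rewrite sumr_const card_ord -[leLHS]mulr_natr mulrAC ler_pdivrMr ?ltr0n//.
  by rewrite ler_pM2l// ler_nat.
have dist (ij : 'I_k * 'I_k) : exists r : R, 0 < r /\ (ij.1 != ij.2 ->
    forall x y, F ij.1 x -> F ij.2 y -> r <= d x y).
  have [->|ne] := eqVneq ij.1 ij.2; first by exists 1.
  have [|r r0 hr] := closed_disjoint_dist dm cX (cF ij.1) (cF ij.2).
    apply/seteqP; split => // x [/FP P1 /FP P2].
    by rewrite -(dP _ _ ne).
  by exists r.
have [r hr] := choice dist.
pose e0 := \big[Num.min/1]_(ij : 'I_k * 'I_k) r ij.
exists e0.
  rewrite /e0; elim/big_ind : _ => // [a b a0 b0|ij _]; first by rewrite lt_min a0.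
  by case: (hr ij).
move=> i j x y ij Fx Fy; apply: le_trans ((hr (i, j)).2 ij _ _ Fx Fy).
by rewrite /e0 (bigD1 (i, j))//= ge_min lexx.
Qed.

End ClosedCore.

(** * Trees of separated orbit segments with good growth *)

Section EntropyUp.
Context {R : realType} {dsp : measure_display} {X : measurableType dsp}.
Context (d : X -> X -> R) (dm : is_metric d) (cX : dcompact d [set: X]).
Context (hm : (@measurable dsp X) = <<s dopen d >>).
Context (f : X -> X) (cf : dcontinuous d f).
Context {m : nat} (A : X -> 'M[R]_m) (C0 C alpha lam : R) (C0_ge0 : 0 <= C0).
Context (m0 : (0 < m)%N) (Au : forall x, A x \in unitmx)
  (hA : forall x, opnorm (A x) <= expR C0) (hA' : forall x, expands (expR C0) (A x)).
Context (C_ge0 : 0 <= C) (alpha0 : 0 < alpha)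
  (lam0 : 0 < lam) (hol : forall x y, opnorm (A x - A y) <= C * d x y `^ alpha).

Let L := lnorm f A.
Let chi := chiR f m0 Au hA hA'.

Let mf : measurable_fun [set: X] f.
Proof. exact: (dcontinuous_measurable hm). Qed.

(** The names of good points over [M] blocks of length [b = Q * b0] have more than
    [expR ((r - eta) * M * b)] leaves but at most [expR ((r + 2 * eta) * b)] children on each level,
    so [pruned_tree] applies. Two names count as far if their Hamming distance exceeds [sH * b]; few
    names are not far from a given one. *)
Lemma entropy_up (mu : probability X R) (h eps : R) (M0 : nat) :
  ergodic f mu -> 0 <= h -> (h%:E < h_mu f mu)%E -> 0 < eps ->
  exists M b0 Q0 : nat, [/\ (M0 <= M)%N, (0 < M)%N, (0 < b0)%N & exists2 e0 : R, 0 < e0 &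
  forall Q, (Q0 <= Q)%N -> exists qq : nat, exists leaf : (nat -> nat) -> X,
    expR (h * (Q * b0)%:R) <= qq%:R /\
    forall v, (forall i, (i < M)%N -> v i < qq)%N ->
    (forall p, (forall j, (j < M * (Q * b0))%N -> d (iter j f p) (iter j f (leaf v)) <=
        expR (- lam * (minn j (M * (Q * b0) - j))%:R)) ->
      (Ex mu chi - eps) * (M * (Q * b0))%:R <= L (M * (Q * b0)) p /\
      L (M * (Q * b0)) p <= (Ex mu chi + eps) * (M * (Q * b0))%:R) /\
    forall v', (forall i, (i < M)%N -> v' i < qq)%N -> forall i, (i < M)%N ->
      (forall l, (l < i)%N -> v l = v' l) -> v i != v' i ->
      exists2 j, (j < Q * b0)%N & e0 <= d (iter (i * (Q * b0) + j) f (leaf v))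
                                          (iter (i * (Q * b0) + j) f (leaf v'))].
Proof.
move=> erg h0 hh eps0; have imu := erg.1.
have [_ [[k P] /= hP <-] hhP] := ereal_sup_gt hh.
have [h' hh' h'P] := ereal_lt_real hhP.
have [lab labP] : exists lab : X -> 'I_k, forall x, P (lab x) x.
  by apply: partition_label; case: hP.
have [r [h'r Hup Hlow]] := entropy_rate mf imu hP labP h'P.
have [M [M0M Mgt0 Hgood]] := good_set dm hm cf C0_ge0 m0 Au hA hA' C_ge0 alpha0 lam0 hol M0 erg eps0.
have Mr : 1 <= M%:R :> R by rewrite ler1n.
(* The total loss in the count is [3 * eta * M], within the margin [h' - h = 8 * eta * M]. *)
pose eta := (h' - h) / (8 * M%:R).
have eta0 : 0 < eta by rewrite divr_gt0//; lra.
have etaM : 8 * (eta * M%:R) = h' - h.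
  by rewrite /eta; field; rewrite gt_eqF//; lra.
have [del del0 [n1 Hlow1]] := Hlow _ eta0.
pose K : R := ln k%:R; have K0 : 0 <= K := ln_alphabet_ge0 lab.
pose s1 := eta / (2 * (K + 1)).
have s10 : 0 < s1 by rewrite divr_gt0//; lra.
have s1K : s1 * K <= eta / 2.
  have : s1 * (2 * (K + 1)) = eta by rewrite /s1 divfK// gt_eqF//; lra.
  lra.
pose del' := Num.min del 1.
have del'0 : 0 < del' by rewrite lt_min del0 ltr01.
(* Budget for bad points: [del' / 4] for the growth, and two events of measure at most [dM] on each
   of the [M] levels. *)
pose dM := del' / (4 * M%:R).
have dM0 : 0 < dM by rewrite divr_gt0//; lra.
pose del1 := Num.min (s1 * dM) (1 / 2).
have del10 : 0 < del1 by rewrite lt_min mulr_gt0//=; lra.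
have [n2 [n20 hn2]] := bigger (2 * ln 2 / eta).
have [b0 b0n sm] := Hup _ eta0 _ del10 n2.
have b00 : (0 < b0)%N by exact: leq_trans b0n.
have del11 : del1 < 1 by rewrite gt_min; apply/orP; right; lra.
have r0 : 0 <= r + eta by exact: small_rate_ge0 sm.
have [sH sH0 hamm] := @hamming_ball R k eta eta0.
(* Each of two orbits leaves the core at most [s2 * b] times per block. If their names differ in
   more than [sH * b = 2 * s2 * b] places, then at one of these both are in the core, hence at least
   [e0] apart. *)
pose s2 := sH / 2; have s20 : 0 < s2 by rewrite /s2; lra.
have g0 : 0 < s2 * dM by rewrite mulr_gt0.
have [F [FP mF pF [e0 e00 hF]]] := closed_core dm cX hm mu hP g0.
have [w0 Hw0] := Hgood (del' / 4) ltac:(lra).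
have [n3 [n30 hn3]] := bigger (2 * M%:R / eta).
exists M, b0, (n1 + n3 + w0).+1; split => //; exists e0 => // Q QQ.
pose b := (Q * b0)%N.
have Qb : (Q <= b)%N by rewrite /b leq_pmulr.
have bw : (w0 <= b)%N by apply: leq_trans Qb; nlia.
have [G1 [mG1 pG1 hG1]] := Hw0 b bw.
have [G2 [mG2 pG2 cG2]] := small_blocks mf imu Q (ltW del10) s10 r0 sm.
pose U i := iter i f @^-1` (~` (\bigcup_i F i)).
have mU i : measurable (U i).
  by rewrite /U -[X in measurable X]setTI; apply: measurable_iter => //; exact: measurableC.
have pU i : (i < b)%N -> prob mu (U i) <= s2 * dM.
  by move=> _; rewrite /U (prob_iter mf imu)//; exact: measurableC.
have [mG3 pG3] := prob_count_le s20 (ltW g0) mU pU; set V3 := [set x | _] in mG3 pG3.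
(* Block [i] is bad if its name is not on the short list or its orbit leaves the core too often. *)
pose B (i : 'I_M) := iter (i * b) f @^-1` (~` G2 `|` V3).
have mB0 : measurable (~` G2 `|` V3) by apply: measurableU => //; exact: measurableC.
have mB i : measurable (B i).
  by rewrite /B -[X in measurable X]setTI; apply: measurable_iter.
have pB i : prob mu (B i) <= 2 * dM.
  rewrite /B (prob_iter mf imu)//.
  have : prob mu (~` G2 `|` V3) <= prob mu (~` G2) + prob mu V3.
    by apply: probU2 => //; exact: measurableC.
  have : prob mu (~` G2) <= dM.
    rewrite -(ler_pM2r s10) (le_trans pG2)// mulrC.
    by rewrite /del1 ge_min lexx.
  have : prob mu V3 <= dM by rewrite -(ler_pM2r s20) (le_trans pG3)// mulrC.
  lra.
pose G := G1 `&` ~` (\bigcup_(i in [set: 'I_M]) B i).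
have mBB : measurable (\bigcup_(i in [set: 'I_M]) B i) by exact: fin_bigcup_measurable.
have mG : measurable G by apply: measurableI => //; exact: measurableC.
have pG : prob mu (~` G) <= del.
  rewrite /G setCI setCK.
  have : prob mu (~` G1 `|` \bigcup_(i in [set: 'I_M]) B i) <= prob mu (~` G1) + prob mu (\bigcup_(i in [set: 'I_M]) B i).
    by apply: probU2 => //; exact: measurableC.
  have : prob mu (\bigcup_(i in [set: 'I_M]) B i) <= \sum_(i < M) 2 * dM.
    by apply: (le_trans (prob_bigU _ mB)); exact: ler_sum.
  rewrite sumr_const card_ord -[X in _ <= X -> _]mulr_natr.
  have -> : 2 * dM * M%:R = del' / 2 by rewrite /dM; field; rewrite gt_eqF//; lra.
  have : del' <= del by rewrite ge_min lexx.
  lra.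
have GB x i : (i < M)%N -> G x -> G2 (iter (i * b) f x) /\ ~ V3 (iter (i * b) f x).
  move=> iM [_ nB]; split.
    by apply: contrapT => bad; apply: nB; exists (Ordinal iM) => //; left.
  by move=> bad; apply: nB; exists (Ordinal iM) => //; right.
have n1b : (n1 <= M * b)%N.
  by apply: leq_trans (leq_pmull b Mgt0); apply: leq_trans Qb; nlia.
have leaves : expR ((r - eta) * (M * b)%:R) < #|img (nm f lab (M * b)) G|%:R.
  by rewrite ltNge; apply/negP => h1; apply: (Hlow1 _ n1b); exists G.
pose beta i x := nm f lab b (iter (i * b) f x).
pose D := #|img (nm f lab b) G2|.
have Dle : D%:R <= expR ((r + 2 * eta) * b%:R).
  apply: (@le_trans _ _ #|img (blocks f lab Q b0) G2|%:R); first by rewrite ler_nat /D /b img_nm_blocks.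
  apply: (le_trans cG2); rewrite ler_expR -/K /b natrM.
  have b0r : 0 < b0%:R :> R by rewrite ltr0n.
  have h2 : ln 2 <= eta / 2 * b0%:R.
    have : n2%:R <= b0%:R :> R by rewrite ler_nat.
    by move: hn2; rewrite ler_pdivrMr// => a1 a2; nra.
  have h3 : s1 * K * b0%:R <= eta / 2 * b0%:R by rewrite ler_wpM2r// ltW.
  have : Q%:R * ((r + eta) * b0%:R + ln 2 + s1 * (b0%:R * K)) <= Q%:R * ((r + 2 * eta) * b0%:R).
    rewrite ler_wpM2l//; lra.
  lra.
pose far (w w' : {ffun 'I_b -> 'I_k}) := ~~ (#|[set j | w j != w' j]%SET|%:R <= sH * b%:R).
have far_sym : symmetric far.
  move=> w w'; rewrite /far; congr (~~ (_%:R <= _)).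
  by apply: eq_card => j; rewrite !inE eq_sym.
pose V := Num.truncn (expR (eta * b%:R)).
have V0 : (0 < V)%N.
  by rewrite /V truncn_ge_nat ?expR_ge0// -[leLHS]expR0 ler_expR mulr_ge0// ltW.
have Vle : V%:R <= expR (eta * b%:R) by rewrite /V truncn_le// expR_ge0.
have farV w : (#|[set w' | ~~ far w w']%SET| <= V)%N.
  rewrite /V truncn_ge_nat ?expR_ge0//; apply: le_trans (hamm b w).
  rewrite ler_nat; apply: subset_leq_card; apply/fintype.subsetP => w'.
  by rewrite !inE negbK.
pose qq := (Num.truncn (expR (h * b%:R))).+1.
have qqge : expR (h * b%:R) <= qq%:R by apply/ltW/truncnS_gt.
have HD i : (i < M)%N -> (#|img (beta i) G| <= D)%N.
  by move=> iM; apply: img_sub => x Gx; apply: mem_img; case: (GB x i iM Gx).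
pose Nl := #|img (fun x => [ffun i : 'I_M => beta i x]) G|.
have Nlge : (#|img (nm f lab (M * b)) G| <= Nl)%N by exact: img_nm_blocks.
have D0 : (0 < D)%N.
  have : 0 < #|img (nm f lab (M * b)) G|%:R :> R by apply: lt_trans leaves; exact: expR_gt0.
  rewrite ltr0n card_gt0 => /set0Pn[_ /imgP[x Gx _]].
  have := HD 0%N Mgt0; apply: leq_trans.
  by rewrite card_gt0; apply/set0Pn; exists (beta 0%N x); exact: mem_img.
have count : (M * (qq * V) * D ^ M < D * Nl)%N.
  have ME : M = M.-1.+1 by rewrite prednK.
  rewrite {2}ME expnS mulnCA ltn_pmul2l// -(ltr_nat R) !natrM natrX.
  apply: (@le_lt_trans _ _ (expR ((r - eta) * (M * b)%:R))); last first.
    by apply: (lt_le_trans leaves); rewrite ler_nat.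
  have MpR : M%:R = M.-1%:R + 1 :> R by rewrite {1}ME -natr1.
  have n3b : n3%:R <= b%:R :> R by rewrite ler_nat; apply: leq_trans Qb; nlia.
  have M2 : 2 * M%:R <= expR (eta * b%:R).
    apply: le_trans (expR_ge1Dx _).
    move: hn3; rewrite ler_pdivrMr// => hn3.
    have : n3%:R * eta <= b%:R * eta by rewrite ler_wpM2r// ltW.
    lra.
  have q2 : qq%:R <= 2 * expR (h * b%:R).
    have : (Num.truncn (expR (h * b%:R)))%:R <= expR (h * b%:R) by rewrite truncn_le// expR_ge0.
    have : 1 <= expR (h * b%:R) by rewrite -[leLHS]expR0 ler_expR mulr_ge0.
    rewrite /qq -natr1; lra.
  have DM : D%:R ^+ M.-1 <= expR ((r + 2 * eta) * b%:R * M.-1%:R).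
    by rewrite expRM_natr lerXn2r ?nnegrE ?expR_ge0.
  apply: (@le_trans _ _ ((expR (eta * b%:R) * expR (h * b%:R) * expR (eta * b%:R)) *
      expR ((r + 2 * eta) * b%:R * M.-1%:R))).
    rewrite ler_pM ?mulr_ge0 ?exprn_ge0//.
    rewrite mulrA ler_pM ?mulr_ge0//.
    apply: (@le_trans _ _ (M%:R * (2 * expR (h * b%:R)))); first by rewrite ler_wpM2l.
    by rewrite mulrA (mulrC _ 2) ler_wpM2r ?expR_ge0.
  rewrite -!expRD ler_expR natrM MpR.
  suff : (3 * (eta * M%:R) + h + r * M.-1%:R) * b%:R <= (r * M%:R) * b%:R by rewrite MpR; lra.
  rewrite ler_wpM2r// MpR; rewrite MpR in etaM; rewrite MpR in Mr.
  have : 0 <= eta * (M.-1%:R + 1) by rewrite mulr_ge0 ?(ltW eta0)//; lra.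
  lra.
have [leaf hleaf] := pruned_tree far_sym V0 farV HD count.
exists qq, leaf; split => // v hv; have [Gv sep] := hleaf v hv.
split; first by move=> p hp; apply: hG1 hp; case: Gv.
move=> v' hv' i iM agree vv; have [Gv' _] := hleaf v' hv'.
have := sep v' hv' i iM agree vv; rewrite /far -ltNge => hfar.
apply: contrapT => H; move: hfar; rewrite ltNge => /negP; apply.
have [_ b1] := GB _ i iM Gv; have [_ b2] := GB _ i iM Gv'.
have sb y : ~ V3 y -> \sum_(j < b) \1_(U j) y <= s2 * b%:R by move=> nV; rewrite leNgt; exact/negP.
have := sb _ b1; have := sb _ b2.
set y' := iter _ f (leaf v'); set y := iter _ f (leaf v) => h1 h2.
apply: (@le_trans _ _ (\sum_(j < b) (\1_(U j) y + \1_(U j) y'))); last first.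
  rewrite big_split/=; have : sH = s2 + s2 by rewrite /s2; lra.
  move=> ->; rewrite mulrDl; lra.
rewrite -sum1_card natr_sum big_mkcond/=; apply: ler_sum => j _.
case: ifP => [|_]; last by rewrite !indicE addr_ge0.
rewrite inE /beta !ffunE => lne.
rewrite !indicE; have [//|yU] := boolP (y \in U j); first by rewrite lerDl.
have [//|y'U] := boolP (y' \in U j); first by rewrite add0r.
exfalso; apply: H; exists (nat_of_ord j); first exact: ltn_ord.
move: yU y'U; rewrite !notin_setE /U /preimage/= => /contrapT[i1 _ F1] /contrapT[i2 _ F2].
rewrite addnC !iterD; apply: (hF i1 i2) => //.
by rewrite -(lab_eq hP labP (FP _ _ F1)) -(lab_eq hP labP (FP _ _ F2)).
Qed.

End EntropyUp.

(** * Lower bound for the Bowen entropy *)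

Section BowenLower.
Context {R : realType}.

(* Forbidden prefixes of total weight [< 1] can be avoided: choose the digits one after the
   other so that the conditional weight stays [< 1]. *)
Lemma avoid_prefixes Rm (q : nat -> nat) (I : nat) (P : pred nat) (b : nat -> nat -> nat)
    (l : nat -> nat) : (forall j, (0 < q j)%N) -> (forall i, P i -> (l i <= Rm)%N) ->
  \sum_(i < I | P i) (\prod_(j < l i) (q j)%:R)^-1 < 1 :> R ->
  exists v : nat -> nat, (forall j, (v j < q j)%N) /\
    forall i, (i < I)%N -> P i -> exists2 j, (j < l i)%N & v j != b i j.
Proof.
elim: Rm q P b l => [|Rm IH] q P b l q0 lR.
  move=> lt1; exists (fun=> 0%N); split => // i iI Pi; exfalso; move: lt1.
  rewrite ltNge => /negP; apply; rewrite (bigD1 (Ordinal iI))//=.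
  have := lR i Pi; rewrite leqn0 => /eqP ->; rewrite big_ord0 invr1 lerDl.
  by apply: sumr_ge0 => j _; rewrite invr_ge0 prodr_ge0.
move=> lt1.
have prod0 (p : nat -> nat) n : 0 <= (\prod_(j < n) (p j)%:R)^-1 :> R.
  by rewrite invr_ge0 prodr_ge0.
have lpos i : (i < I)%N -> P i -> (0 < l i)%N.
  move=> iI Pi; rewrite lt0n; apply/negP => /eqP li.
  move: lt1; rewrite ltNge => /negP; apply; rewrite (bigD1 (Ordinal iI))//=.
  by rewrite li big_ord0 invr1 lerDl; apply: sumr_ge0 => j _; exact: prod0.
pose w i : R := (\prod_(j < (l i).-1) (q j.+1)%:R)^-1.
have w0 i : 0 <= w i by exact: (prod0 (fun j => q j.+1)).
have qr0 : 0 < (q 0%N)%:R :> R by rewrite ltr0n.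
have wE i : (i < I)%N -> P i -> (\prod_(j < l i) (q j)%:R)^-1 = w i / (q 0%N)%:R.
  move=> iI Pi; rewrite -(prednK (lpos i iI Pi)) big_ord_recl/= invfM mulrC.
  by rewrite /w; congr (_^-1 * _); apply: eq_bigr.
have sumw : \sum_(i < I | P i) w i < (q 0%N)%:R.
  move: lt1; rewrite (eq_bigr (fun i : 'I_I => w i / (q 0%N)%:R)) => [|i Pi]; last exact: wE.
  by rewrite -mulr_suml ltr_pdivrMr// mul1r.
have [a aq Sa] : exists2 a, (a < q 0%N)%N & \sum_(i < I | P i && (b i 0%N == a)) w i < 1.
  apply: contrapT => H; move: sumw; rewrite ltNge => /negP; apply.
  have h1 : (q 0%N)%:R <= \sum_(a < q 0%N) \sum_(i < I | P i && (b i 0%N == a)) w i.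
    rewrite -[X in X%:R <= _]card_ord -sum1_card natr_sum; apply: ler_sum => a _.
    by rewrite leNgt; apply/negP => h; apply: H; exists a.
  apply: (le_trans h1).
  under eq_bigr => a _ do rewrite big_mkcondr.
  rewrite exchange_big/=; apply: ler_sum => i _.
  rewrite -big_mkcond/=; have [bi|bi] := ltnP (b i 0%N) (q 0%N).
    rewrite (big_pred1 (Ordinal bi))// => a; by rewrite /= eq_sym -val_eqE.
  rewrite big_pred0// => a; apply/negP => /eqP ba.
  by move: (ltn_ord a); rewrite -ba ltnNge bi.
have [|v [vq hv]] := IH (fun j => q j.+1) (fun i => P i && (b i 0%N == a))
  (fun i j => b i j.+1) (fun i => (l i).-1) (fun j => q0 j.+1) _ Sa.
  move=> i /andP[Pi _]; have := lR i Pi; lia.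
exists (fun j => if j is j'.+1 then v j' else a); split => [[|j] //|i iI Pi].
have [ba|ba] := eqVneq (b i 0%N) a; last first.
  by exists 0%N; [exact: lpos|rewrite eq_sym].
have [|j jl vj] := hv i iI; first by rewrite Pi ba eqxx.
by exists j.+1 => //; have := lpos i iI Pi; lia.
Qed.

Context {X : Type} (d : X -> X -> R) (dm : is_metric d) (f : X -> X) (cf : dcontinuous d f).

Lemma dopen_bowen_ball n x e : 0 < e -> dopen d (bowen_ball d f n x e).
Proof.
move=> e0; have -> : bowen_ball d f n x e =
    [set y | forall i, (i < n)%N -> d (iter i f x) (iter i f y) < e].
  by apply/seteqP; split => y /=; rewrite /bowen_ball/=; [move/(dn_ltP _ _ _ _ _ e0)|move=> h; apply/(dn_ltP _ _ _ _ _ e0)].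
elim: n => [|n IH]; first by move=> y _; exists 1.
have -> : [set y | forall i, (i < n.+1)%N -> d (iter i f x) (iter i f y) < e] =
    [set y | forall i, (i < n)%N -> d (iter i f x) (iter i f y) < e] `&`
    [set y | d (iter n f x) (iter n f y) < e].
  apply/seteqP; split => y /=.
    by move=> h; split; [move=> i iN; apply: h; exact: ltnW|exact: h].
  by move=> [h1 h2] i; rewrite ltnS leq_eqVlt => /predU1P[->|/h1].
apply: dopenI => // y /= hy.
have e1 : 0 < e - d (iter n f x) (iter n f y) by rewrite subr_gt0.
have dc : dcontinuous d (iter n f) by exact: dcontinuous_iter.
have [r r0 hr] := dc y _ e1.
exists r => // z /hr /=; have := dtri dm (iter n f y) (iter n f x) (iter n f z); lra.
Qed.

Lemma bowenC_nondecreasing E t s : nondecreasing_seq (fun n => bowenC d f E t n s).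
Proof.
move=> n n' nn; apply: ereal_inf_le_tmp => _ [c [c1 c2] <-]; exists c => //; split => //.
by move=> i xu /c1; exact: leq_trans.
Qed.

(* By separation, a Bowen ball of radius [sg] and length [u >= T r] only meets points [pp v] with
   a common prefix of length [r.+1]; a finite subcover of weight [< 1] of the compact set [E]
   would therefore leave out some [pp v]. *)
Lemma hB_ge (Y E : set X) (sg s : R) (q T : nat -> nat) (pp : (nat -> nat) -> X) :
  E `<=` Y -> dcompact d E -> 0 < sg -> (forall j, (0 < q j)%N) ->
  (forall i j, (i <= j)%N -> (T i <= T j)%N) ->
  (forall v, (forall j, (v j < q j)%N) -> E (pp v)) ->
  (forall v v' r, (forall j, (v j < q j)%N) -> (forall j, (v' j < q j)%N) ->
     (forall j, (j < r)%N -> v j = v' j) -> v r != v' r ->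
     exists2 j, (j < T r)%N & 2 * sg <= d (iter j f (pp v)) (iter j f (pp v'))) ->
  (exists n0, forall u, (n0 <= u)%N -> exists r, (T r <= u)%N /\
     expR (s * u%:R) <= \prod_(j < r.+1) (q j)%:R) ->
  (s%:E <= hB d f Y)%E.
Proof.
move=> EY cE sg0 q0 Tmono ppE sep [n0 hn0].
apply: le_ereal_sup_tmp; exists (ereal_inf [set t%:E | t in [set t : R | 0 <= t /\ bowenC_lim d f Y t sg = 0%E]]).
  by exists sg.
apply: le_ereal_inf_tmp => _ [t [t0 limt] <-]; rewrite lee_fin leNgt; apply/negP => ts.
have : (bowenC d f Y t n0 sg < 1%:E)%E.
  apply: (@le_lt_trans _ _ (bowenC_lim d f Y t sg)); last by rewrite limt lte_fin.
  rewrite /bowenC_lim (cvg_lim _ (ereal_nondecreasing_cvgn (@bowenC_nondecreasing Y t sg)))//.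
  by apply: ereal_sup_ubound; exists n0.
move=> /ereal_inf_lt[_ [c [c1 c2] <-]] sum1.
pose U i := match c i with Some xu => bowen_ball d f xu.2 xu.1 sg | None => set0 end.
have oU i : dopen d (U i).
  rewrite /U; case: (c i) => [xu|]; first exact: dopen_bowen_ball.
  by move=> x [].
have [k [hh hk]] := cE _ U oU (subset_trans EY c2).
pose I := (\max_(j < k) hh j).+1.
pose P i := `[< exists2 v, (forall j, (v j < q j)%N) & U i (pp v) >].
(* Every ball that contains some [pp v] becomes a forbidden prefix of [v], whose weight is at most
   [expR (- s * u)] and so at most that of the ball, as [t < s]. *)
have data i : exists bl : (nat -> nat) * nat, P i ->
    [/\ (forall j, (bl.1 j < q j)%N), U i (pp bl.1) &
      exists2 xu, c i = Some xu & (T bl.2 <= xu.2)%N /\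
        expR (s * xu.2%:R) <= \prod_(j < bl.2.+1) (q j)%:R].
  have [Pi|nP] := boolP (P i); last by exists (fun=> 0%N, 0%N).
  have /asboolP[v vq Uv] := Pi.
  move: (Uv); rewrite /U; case ci : (c i) => [xu|] // _.
  have [r [Tr hr]] := hn0 xu.2 (c1 i xu ci).
  by exists (v, r) => _; split; [exact: vq|by move: Uv; rewrite /U ci|by exists xu].
have [bl hbl] := choice data.
pose len i := (bl i).2.+1.
have lenb i : P i && (i < I)%N -> (len i <= (\max_(j < I) len j))%N.
  by move=> /andP[_ iI]; rewrite (leq_bigmax (Ordinal iI)).
pose term i : \bar R := match c i with Some xu => (expR (- t * (xu.2)%:R))%:E | None => 0%E end.
have term0 i : (0 <= term i)%E by exact: famterm_ge0.
have [|v [vq hv]] := @avoid_prefixes (\max_(j < I) len j) q I (fun i => P i && (i < I)%N)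
    (fun i => (bl i).1) len q0 lenb.
  rewrite -lte_fin -sumEFin; apply: le_lt_trans sum1.
  apply: (@le_trans _ _ (\sum_(0 <= i < I) term i)%E); last first.
    by apply: nneseries_lim_ge => i _ _.
  rewrite big_mkord big_mkcond/=; apply: lee_sum => i _.
  case: ifP => [/andP[Pi _]|_]; last exact: term0.
  have [_ _ [xu ci [_ hr]]] := hbl i Pi; rewrite /term ci lee_fin.
  apply: (@le_trans _ _ (expR (- (s * xu.2%:R)))).
    by rewrite expRN lef_pV2 ?posrE ?expR_gt0// prodr_gt0// => j _; rewrite ltr0n.
  by rewrite ler_expR mulNr lerN2 ler_wpM2r// ltW.
have [j _ Uj] := hk _ (ppE v vq).
set i := hh j in Uj.
have iI : (i < I)%N by rewrite /I ltnS /i leq_bigmax.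
have Pi : P i by apply/asboolP; exists v.
have [bq Ub [xu ci [Tr hr]]] := hbl i Pi.
have [|j0 j0l j0v] := hv i iI; first by rewrite Pi iI.
have exj : exists j, v j != (bl i).1 j by exists j0.
(* The first disagreement falls within the forbidden prefix, so the two points separate before the
   ball ends, although both lie in it. *)
pose r := ex_minn exj.
have [vr rmin] : v r != (bl i).1 r /\ forall j, v j != (bl i).1 j -> (r <= j)%N.
  by rewrite /r; case: ex_minnP.
have [|j1 j1T hj1] := sep v (bl i).1 r vq bq _ vr.
  move=> j2 j2r; apply/eqP; apply: contraLR j2r => /rmin; by rewrite -leqNgt.
have j1u : (j1 < xu.2)%N.
  apply: (leq_trans j1T); apply: leq_trans Tr; apply: Tmono.
  by rewrite -ltnS; apply: leq_ltn_trans j0l; exact: rmin.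
move: Uj Ub; rewrite /U ci /bowen_ball/= => /(dn_ltP _ _ _ _ _ sg0)/(_ j1 j1u) a1.
move=> /(dn_ltP _ _ _ _ _ sg0)/(_ j1 j1u) a2.
have := dtri dm (iter j1 f xu.1) (iter j1 f (pp v)) (iter j1 f (pp (bl i).1)).
by rewrite (dsym dm (iter j1 f (pp v)) (iter j1 f xu.1)); lra.
Qed.

End BowenLower.

(** Base-[q] digits encode the [M] choices of one tree as a single number, the format required by a
    gluing scheme. *)
Lemma digits_exist (q M : nat) (v : nat -> nat) : (forall i, (i < M)%N -> (v i < q)%N) ->
  exists2 a, (a < q ^ M)%N & forall i, (i < M)%N -> ((a %/ q ^ i) %% q)%N = v i.
Proof.
elim: M v => [|M IH] v hv; first by exists 0%N.
have q0 : (0 < q)%N by apply: leq_ltn_trans (hv 0%N isT).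
have [|a aq ha] := IH (fun i => v i.+1); first by move=> i iM; exact: hv.
exists (v 0 + a * q)%N.
  rewrite expnS; apply: (@leq_trans (q * a.+1)); last by rewrite leq_mul2l aq orbT.
  by rewrite mulnS mulnC ltn_add2r hv.
move=> [|i] iM; first by rewrite expn0 divn1 addnC modnMDl modn_small// hv.
by rewrite expnS divnMA divnDMl// (divn_small (hv 0%N isT)) add0n ha.
Qed.

(** * Gluing trees: the set carrying the Bowen entropy *)

Section TreeScheme.
Context {R : realType} {dsp : measure_display} {X : measurableType dsp}.
Context (d : X -> X -> R) (dm : is_metric d).
Context (cX : dcompact d [set: X]) (f : X -> X) (cf : dcontinuous d f).
Context {m : nat} (A : X -> 'M[R]_m) (C0 : R) (C0_ge0 : 0 <= C0).
Context (m0 : (0 < m)%N) (Au : forall x, A x \in unitmx)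
  (hA : forall x, opnorm (A x) <= expR C0) (hA' : forall x, expands (expR C0) (A x)).
Context (lam tau : R) (N : nat) (lam0 : 0 < lam) (tau0 : 0 < tau).
Context (glue : forall (x : nat -> X) (n : nat -> nat), (forall i, (0 < n i)%N) ->
  exists z, forall i j, (j < n i)%N ->
    d (iter (seg_start N n i + j) f z) (iter j f (x i))
      < tau * expR (- lam * (minn j (n i - j))%:R)).

Let L := lnorm f A.

Context (M J b0 w Q0 : nat) (M_gt0 : (0 < M)%N) (J_gt0 : (0 < J)%N) (b0_gt0 : (0 < b0)%N)
  (w_gt0 : (0 < w)%N) (Q0_gt0 : (0 < Q0)%N) (JM : (J <= M)%N) (Q0_big : (J * (3 * N + w) <= Q0)%N).
Context (qq : nat -> nat) (leaf : nat -> (nat -> nat) -> X) (yy : nat -> X).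
Context (chi kap e0 h tau1 : R) (kap0 : 0 < kap) (e00 : 0 < e0).
(** An odd segment lowers the growth by [2 * kap] per step during about [1 / J] of the time, and
    [eps] is a small part of this. Since [mu' * Z = eps], an initial piece or a gap of relative
    length [mu'] contributes at most [eps] per step of the tree. *)
Let eps := kap / (16 * J%:R).
Let Z := C0 + `|chi| + kap + 1.
Context (mu' : R) (mu'E : mu' = kap / (16 * J%:R * Z)) (Mbig : J%:R <= mu' * M%:R)
  (NQ0 : N%:R <= mu' * Q0%:R).
Context (tle1 : tau <= 1) (tle2 : tau <= tau1) (tle3 : tau <= e0 / 4).
Context (qq_ge : forall Q, (Q0 <= Q)%N -> expR (h * (Q * b0)%:R) <= (qq Q)%:R).
Context (leaf_growth : forall Q v, (Q0 <= Q)%N -> (forall i, (i < M)%N -> (v i < qq Q)%N) ->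
  forall p, (forall j, (j < M * (Q * b0))%N -> d (iter j f p) (iter j f (leaf Q v)) <=
        expR (- lam * (minn j (M * (Q * b0) - j))%:R)) ->
      (chi - eps) * (M * (Q * b0))%:R <= L (M * (Q * b0)) p /\
      L (M * (Q * b0)) p <= (chi + eps) * (M * (Q * b0))%:R).
Context (leaf_sep : forall Q v v', (Q0 <= Q)%N -> (forall i, (i < M)%N -> (v i < qq Q)%N) ->
  (forall i, (i < M)%N -> (v' i < qq Q)%N) -> forall i, (i < M)%N ->
      (forall l, (l < i)%N -> v l = v' l) -> v i != v' i ->
      exists2 j, (j < Q * b0)%N & e0 <= d (iter (i * (Q * b0) + j) f (leaf Q v))
                                          (iter (i * (Q * b0) + j) f (leaf Q v'))).
Context (yy_low : forall Q p,
    (forall j, (j < Q * w)%N -> d (iter j f p) (iter j f (yy Q)) <= tau1) ->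
    L (Q * w) p <= (chi - 2 * kap) * (Q * w)%:R).

(** Integer versions of [c / J]: the block length [Qof c * b0] differs from it by a bounded amount,
    and [Yof c * w] is the first multiple of [w] exceeding it. *)
Let Qof c := (Q0 + c %/ (J * b0))%N.
Let Yof c := (c %/ (J * w)).+1.
Let dig Q a i := ((a %/ qq Q ^ i) %% qq Q)%N.

(* Even segments carry a tree of [qq ^ M] choices and grow at rate about [chi]; they dominate the
   elapsed time, while each of their [M] blocks is at most about [1 / J] of it. Odd segments have
   no choice and grow at a lower rate; they are just long enough (a proportion [1 / J] of the
   elapsed time) to pull the average growth below [chi - 4 u], hence cost little entropy. *)
Let D i c : nat * nat * (nat -> X) :=
  if odd i then (Yof c * w, 1, fun=> yy (Yof c))%N
  else (M * (Qof c * b0), qq (Qof c) ^ M, fun a => leaf (Qof c) (dig (Qof c) a))%N.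

Let tm k := time N D k.*2.
Let Qk k := Qof (tm k).
Let b k := (Qk k * b0)%N.
Let l k := (M * b k)%N.

Let Q0_le k : (Q0 <= Qk k)%N. Proof. exact: leq_addr. Qed.

Let qq_gt0 Q : (Q0 <= Q)%N -> (0 < qq Q)%N.
Proof. by move=> /qq_ge h1; rewrite -(ltr0n R); apply: lt_le_trans h1; exact: expR_gt0. Qed.

Let len_even k : len N D k.*2 = l k.
Proof. by rewrite /len /D odd_double. Qed.
Let nch_even k : nch N D k.*2 = (qq (Qk k) ^ M)%N.
Proof. by rewrite /nch /D odd_double. Qed.
Let pt_even k a : pt N D k.*2 a = leaf (Qk k) (dig (Qk k) a).
Proof. by rewrite /pt /D odd_double. Qed.
Let time_odd k : time N D k.*2.+1 = (tm k + l k + N)%N.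
Proof. by rewrite timeS len_even. Qed.
Let Y k := Yof (tm k + l k + N).
Let len_odd k : len N D k.*2.+1 = (Y k * w)%N.
Proof. by rewrite /len time_odd /D /= odd_double. Qed.
Let nch_odd k : nch N D k.*2.+1 = 1%N.
Proof. by rewrite /nch /D /= odd_double. Qed.
Let pt_odd k a : pt N D k.*2.+1 a = yy (Y k).
Proof. by rewrite /pt time_odd /D /= odd_double. Qed.

Let evenodd i : exists k, i = k.*2 \/ i = k.*2.+1.
Proof.
by exists i./2; rewrite -{1 3}(odd_double_half i); case: (odd i); [right|left].
Qed.

Let b_gt0 k : (0 < b k)%N.
Proof. by rewrite muln_gt0 b0_gt0 andbT (leq_trans Q0_gt0). Qed.

Let Q0_le_b k : (Q0 <= b k)%N.
Proof. by apply: leq_trans (Q0_le k) _; rewrite leq_pmulr. Qed.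

Let b_le_l k : (b k <= l k)%N. Proof. by rewrite leq_pmull. Qed.

Let len_gt0 i : (0 < len N D i)%N.
Proof.
have [k [->|->]] := evenodd i; first by rewrite len_even muln_gt0 M_gt0 b_gt0.
by rewrite len_odd muln_gt0.
Qed.

Let nch_gt0 i : (0 < nch N D i)%N.
Proof.
have [k [->|->]] := evenodd i; last by rewrite nch_odd.
by rewrite nch_even expn_gt0 qq_gt0.
Qed.

Let tmS k : tm k.+1 = (tm k + l k + N + Y k * w + N)%N.
Proof. by rewrite /tm doubleS timeS time_odd len_odd. Qed.

Let tm_le_b k : (tm k <= J * b k)%N.
Proof.
rewrite /b /Qk /Qof; set c := tm k.
have Jb0 : (0 < J * b0)%N by rewrite muln_gt0 J_gt0 b0_gt0.
have := ltn_ceil c Jb0.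
set r := (c %/ _)%N => h1; apply: (leq_trans (ltnW h1)).
by rewrite mulnCA leq_mul2l leq_mul2r -add1n leq_add2r Q0_gt0 !orbT.
Qed.

Let b_le_tm k : (J * b k <= tm k + J * Q0 * b0)%N.
Proof.
rewrite /b /Qk /Qof; set c := tm k; have := leq_divM c (J * b0).
by set r := (c %/ _)%N => h1; nlia.
Qed.

Let Y_ge k : (l k <= J * (Y k * w))%N.
Proof.
rewrite /Y /Yof; set c := (tm k + _ + _)%N.
have Jw : (0 < J * w)%N by rewrite muln_gt0 J_gt0 w_gt0.
have := ltn_ceil c Jw.
have : (l k <= c)%N by rewrite /c; nlia.
by set r := (c %/ _)%N => h1 h2; nlia.
Qed.

Let Y_le k : (J * (Y k * w) <= tm k + l k + N + J * w)%N.
Proof.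
rewrite /Y /Yof; set c := (tm k + _ + _)%N; have := leq_divM c (J * w).
by set r := (c %/ _)%N => h1; nlia.
Qed.

Let tm_le_l k : (tm k <= l k)%N.
Proof. by apply: leq_trans (tm_le_b k) _; rewrite /l leq_mul2r JM orbT. Qed.

Let tm_small k : (tm k)%:R <= mu' * (l k)%:R.
Proof.
apply: (@le_trans _ _ (J * b k)%:R); first by rewrite ler_nat.
by rewrite /l; move: (b k) => bk; rewrite !natrM mulrA ler_wpM2r.
Qed.

Let mu'0 : 0 < mu'.
Proof.
rewrite mu'E divr_gt0// !mulr_gt0 ?ltr0n//.
by rewrite /Z; have := normr_ge0 chi; move: C0_ge0 kap0; lra.
Qed.

Let N_small k : N%:R <= mu' * (l k)%:R.
Proof.
apply: (le_trans NQ0); rewrite ler_wpM2l ?(ltW mu'0)// ler_nat.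
exact: leq_trans (Q0_le_b k) (b_le_l k).
Qed.

Lemma tree_MLI : reach d f lam tau N D `<=` MLI A f.
Proof.
have Jr : 0 < J%:R :> R by rewrite ltr0n.
have Z0 : 0 < Z by rewrite /Z; have := normr_ge0 chi; move: C0_ge0 kap0; lra.
pose u := kap / (16 * J%:R).
have u0 : 0 < u by rewrite divr_gt0// mulr_gt0.
have uJ : 16 * (J%:R * u) = kap by rewrite /u; field; rewrite gt_eqF.
have muZ : mu' * Z = u by rewrite mu'E /u; field; rewrite !gt_eqF.
have u1 : 4 * u <= kap.
  have : 1 * u <= J%:R * u by rewrite ler_wpM2r ?(ltW u0)// ler1n.
  move: kap0; lra.
have muZl k : Z * (tm k)%:R <= u * (l k)%:R /\ Z * N%:R <= u * (l k)%:R.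
  by rewrite -muZ mulrAC !(mulrC Z); split; rewrite ler_wpM2r ?(ltW Z0).
have Zc (c : R) : 0 <= c -> (C0 - chi + 4 * u) * c <= Z * c /\ (C0 + chi - 2 * u) * c <= Z * c.
  move=> c0; have := ler_norm chi; have := ler_norm (- chi); rewrite normrN => a1 a2.
  by split; rewrite ler_wpM2r// /Z; move: u1 u0; lra.
move=> p rp.
have up k : (chi - u) * (l k)%:R <= L (l k) (iter (tm k) f p) /\
    L (l k) (iter (tm k) f p) <= (chi + u) * (l k)%:R.
  have [om _ fo] := rp k.*2.+1.
  apply: (@leaf_growth (Qk k) (dig (Qk k) (om k.*2))) => // [i _|j jl].
    by rewrite ltn_mod qq_gt0.
  have := follows_seg fo (leqnn _); rewrite len_even pt_even => /(_ j jl).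
  by move=> /le_trans; apply; rewrite ler_piMl ?expR_ge0.
have low k : L (Y k * w)%N (iter (tm k + l k + N) f p) <= (chi - 2 * kap) * (Y k * w)%:R.
  have [om _ fo] := rp k.*2.+2.
  apply: yy_low => j jl.
  have := follows_seg fo (ltnSn _); rewrite len_odd pt_odd time_odd => /(_ j jl).
  move=> /le_trans; apply; apply: le_trans tle2.
  by rewrite ler_piMr ?(ltW tau0)// expR_lam_le1.
have tmk k : (k <= tm k)%N.
  apply: leq_trans (time_ge len_gt0 _); rewrite -addnn; exact: leq_addr.
apply: (@oscillation_MLI _ _ _ f m A p (chi - 4 * u) (chi - 2 * u)); first by move: u0; lra.
  (* The odd segment lowers the growth by [2 * kap = 32 * u * J] per step. As [l <= J * (Y * w)],
     this outweighs the surplus of the tree and the errors from the initial piece and the gap, which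
     are a few times [u * l]. *)
  move=> n0; exists (tm n0 + l n0 + N + Y n0 * w)%N.
    by rewrite -!addnA; exact: leq_trans (tmk n0) (leq_addr _ _).
  have h1 := lnorm_subadd f m0 Au (tm n0 + l n0 + N) (Y n0 * w) p.
  have h2 := lnormD_le_r f m0 Au hA (tm n0 + l n0) N p.
  have h3 := lnormD_le_l f m0 Au hA (tm n0) (l n0) p.
  have [_ h4] := up n0; have h5 := low n0.
  have [h6 h7] := muZl n0.
  have h10 : u * (l n0)%:R <= u * J%:R * (Y n0 * w)%:R.
    by rewrite -mulrA ler_wpM2l ?(ltW u0)// -natrM ler_nat.
  have Ju : u <= u * J%:R by rewrite ler_peMr ?(ltW u0)// ler1n.
  have : u * (Y n0 * w)%:R <= u * J%:R * (Y n0 * w)%:R by rewrite ler_wpM2r.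
  have [h8 _] := Zc (tm n0)%:R (ler0n _ _); have [h9 _] := Zc N%:R (ler0n _ _).
  have uJ' : kap * (Y n0 * w)%:R = 16 * (u * J%:R * (Y n0 * w)%:R) by rewrite -uJ; ring.
  have : 0 <= u * (Y n0 * w)%:R by rewrite mulr_ge0 ?(ltW u0).
  move: h1 h2 h3 h4 h5 h6 h7 h8 h9 h10 uJ'; rewrite -/L.
  by move: (Y n0 * w)%N (tm n0) (l n0) => yk tk lk; rewrite !natrD; lra.
move=> n0; exists (tm n0 + l n0)%N; first exact: leq_trans (tmk n0) (leq_addr _ _).
have h3 := lnormD_ge_l f m0 Au hA' (tm n0) (l n0) p.
have [h4 _] := up n0; have [h6 h7] := muZl n0; have [_ h8] := Zc (tm n0)%:R (ler0n _ _).
move: h3 h4 h6 h7 h8; rewrite -/L.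
by move: (tm n0) (l n0) => tk lk; rewrite natrD; lra.
Qed.

Let ck r := (r %/ M)%N.
(* The [r]-th choice is made in block [r %% M] of the [ck r]-th tree and is visible at time [T r];
   [B r] is the time spent in the blocks before it. *)
Let T r := (tm (ck r) + (r %% M).+1 * b (ck r))%N.
Let q r := qq (Qk (ck r)).
Let S k := (\sum_(j < k) l j)%N.
Let B r := (S (ck r) + (r %% M) * b (ck r))%N.

Let ckS r : ck r.+1 = ck r /\ (r.+1 %% M = (r %% M).+1)%N \/
  [/\ ck r.+1 = (ck r).+1, (r.+1 %% M = 0)%N & ((r %% M).+1 = M)%N].
Proof.
rewrite /ck divnS// modnS; have [dv|dv] := boolP (M %| r.+1)%N; [right|by left].
split => //; apply/eqP; rewrite eqn_leq ltn_mod M_gt0/= leqNgt; apply/negP => h1.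
by move: dv; rewrite (divn_eq r M) -addnS dvdn_addr ?dvdn_mull// gtnNdvd.
Qed.

Let BS r : B r.+1 = (B r + b (ck r))%N.
Proof.
rewrite /B; have [[-> ->]|[-> -> E]] := ckS r; first by rewrite mulSn addnA addnAC.
have lE : l (ck r) = ((r %% M).+1 * b (ck r))%N by rewrite E.
by rewrite /S big_ord_recr/= -/(S _) lE mulSn mul0n addn0 (addnC (b _)) addnA.
Qed.

Let T_mono i j : (i <= j)%N -> (T i <= T j)%N.
Proof.
apply: (@homo_leq _ T (fun x y => (x <= y)%N)) => // [x y z|r]; first exact: leq_trans.
rewrite /T; have [[-> ->]|[-> -> E]] := ckS r; first by rewrite leq_add2l leq_mul2r leqnSn orbT.
by rewrite tmS E -/(l _) mul1n -!addnA leq_add2l leq_addr.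
Qed.

(** The odd segment and the two gaps of a cycle take at most [3 * l / J]: [J * (Y * w)] is at most
    [2 * l + N + J * w], and the remaining [N + 2 * J * N + J * w] is at most
    [J * (3 * N + w) <= l]. *)
Let tm_le_S k : (J * tm k <= (J + 3) * S k)%N.
Proof.
elim: k => [|k IH]; first by rewrite /tm /= muln0.
rewrite /S big_ord_recr/= -/(S _) tmS.
have h1 := Y_le k; have h2 := tm_le_l k.
have h3 : (J * (3 * N + w) <= l k)%N.
  exact: leq_trans Q0_big (leq_trans (Q0_le_b k) (b_le_l k)).
have h4 : (N <= J * N)%N by rewrite leq_pmull.
move: h1 h2 h3 h4 IH; move: (tm k) (l k) (Y k * w)%N (S k) => a1 a2 a3 a4.
clear; lia.
Qed.

(** Up to a constant, time exceeds the time spent in finished blocks by two factors: [1 + 1 / J] for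
    the block under way and [1 + 3 / J] for odd segments and gaps. *)
Let T_le r : (J * J * T r <= (J + 1) * (J + 3) * B r + J * J * Q0 * b0)%N.
Proof.
rewrite /T /B; have := tm_le_S (ck r); have := b_le_tm (ck r).
move: (tm _) (b _) (S _) (r %% M)%N => a1 a2 a3 a4; clear => h1 h2.
have h3 : (J * (J * a2) <= J * (a1 + J * Q0 * b0))%N by rewrite leq_mul2l h1 orbT.
have h4 : ((J + 1) * (J * a1) <= (J + 1) * ((J + 3) * a3))%N by rewrite leq_mul2l h2 orbT.
nia.
Qed.

Let B_ge r : (r <= B r)%N.
Proof. by elim: r => // r IH; rewrite BS -addn1 leq_add. Qed.

Let T_ge r : (r <= T r)%N.
Proof.
elim: r => // r IH; apply: leq_ltn_trans IH _; rewrite /T.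
have b1 := b_gt0 (ck r); have b2 := b_gt0 (ck r).+1.
have [[-> ->]|[-> -> E]] := ckS r; first by rewrite ltn_add2l ltn_mul2r b1 ltnSn.
rewrite tmS E -/(l _) mul1n -!addnA ltn_add2l -[X in (X < _)%N]addn0 ltn_add2l.
by rewrite !addn_gt0 b2 !orbT.
Qed.

Let prod_q r : expR (h * (B r)%:R) <= \prod_(j < r) (q j)%:R.
Proof.
elim: r => [|r IH]; first by rewrite big_ord0 /B /ck div0n mod0n /S big_ord0 mulr0 expR0.
rewrite big_ord_recr/= BS natrD mulrDr expRD ler_pM ?expR_ge0//.
exact: qq_ge.
Qed.

Lemma tree_hB (s : R) : 0 <= s -> s * ((J + 1) * (J + 3))%:R < h * (J * J)%:R ->
  (s%:E <= hB d f (MLI A f))%E.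
Proof.
move=> s0 sJ.
have enc (x : nat * (nat -> nat)) : exists a, (Q0 <= x.1)%N ->
    (forall i, (i < M)%N -> (x.2 i < qq x.1)%N) ->
    (a < qq x.1 ^ M)%N /\ forall i, (i < M)%N -> dig x.1 a i = x.2 i.
  have [Hv|nHv] := pselect (forall i, (i < M)%N -> (x.2 i < qq x.1)%N); last by exists 0%N.
  by have [a aq ha] := digits_exist Hv; exists a.
have [E hE] := choice enc.
pose W (v : nat -> nat) i := if odd i then 0%N else E (Qk i./2, fun t => v (i./2 * M + t)%N).
have [pp hpp] := choice (fun v => follows_exists glue len_gt0 (W v)).
have ckE k t : (t < M)%N -> ck (k * M + t) = k by move=> tM; rewrite /ck divnMDl// divn_small// addn0.
have WE v k : (forall j, (v j < q j)%N) -> (W v k.*2 < qq (Qk k) ^ M)%N /\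
    forall i, (i < M)%N -> dig (Qk k) (W v k.*2) i = v (k * M + i)%N.
  move=> vq; rewrite /W odd_double doubleK; apply: hE => //= i iM.
  by have := vq (k * M + i)%N; rewrite /q ckE.
have digq Q a i : (Q0 <= Q)%N -> (dig Q a i < qq Q)%N by move=> QQ; rewrite ltn_mod qq_gt0.
have JJ : 0 < (J * J)%:R :> R by rewrite ltr0n muln_gt0 J_gt0.
apply: (@hB_ge _ _ d dm f cf (MLI A f) (reach d f lam tau N D) (e0 / 4) s q T pp) => //.
- exact: tree_MLI.
- exact: reach_compact.
- by move: e00; lra.
- by move=> j; exact: qq_gt0.
- move=> v vq; apply: (follows_reach (w := W v)); last exact: hpp.
  move=> K i _; have [k [->|->]] := evenodd i; first by rewrite nch_even; case: (WE v k vq).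
  by rewrite nch_odd /W /= odd_double.
- move=> v v' r vq vq' agree vv.
  set k := ck r; set t := (r %% M)%N.
  have rE : r = (k * M + t)%N by exact: divn_eq.
  have tM : (t < M)%N by rewrite ltn_mod.
  have [_ d1] := WE v k vq; have [_ d2] := WE v' k vq'.
  have [||j jb hj] := @leaf_sep (Qk k) (dig (Qk k) (W v k.*2)) (dig (Qk k) (W v' k.*2)) (Q0_le k)
      (fun i _ => digq _ _ i (Q0_le k)) (fun i _ => digq _ _ i (Q0_le k)) t tM.
  + by move=> i it; rewrite d1 ?d2 ?(ltn_trans it)//; apply: agree; rewrite rE ltn_add2l.
  + by rewrite d1// d2// -rE.
  exists (tm k + (t * b k + j))%N; first by rewrite /T -/k -/t ltn_add2l mulSn addnC ltn_add2r.
  have jl : (t * b k + j < len N D k.*2)%N.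
    rewrite len_even /l; apply: (@leq_trans (t.+1 * b k)); last by rewrite leq_mul2r tM orbT.
    by rewrite mulSn addnC ltn_add2r.
  have := hpp v k.*2.+1 k.*2 _ (ltnSn _) jl; have := hpp v' k.*2.+1 k.*2 _ (ltnSn _) jl.
  rewrite !pt_even -/(tm k); set c := expR _ => a1 a2.
  have tc : tau * c <= tau by rewrite ler_piMr ?(ltW tau0)// expR_lam_le1.
  move: hj a1 a2; rewrite -/(b k); set n1 := (t * _ + j)%N; set n2 := (tm k + n1)%N.
  set x := iter n1 f _; set x' := iter n1 f _; set z := iter n2 f _; set z' := iter n2 f _.
  have := dtri dm z' x x'; have := dtri dm z z' x'; rewrite (dsym dm x z').
  by move: tle3; lra.
pose del := h * (J * J)%:R - s * ((J + 1) * (J + 3))%:R.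
have del0 : 0 < del by rewrite subr_gt0.
(* From [r0] on, the surplus [del * B r] absorbs the additive constant of [T_le], since
   [r <= B r]. *)
have [r0 [r00 hr0]] := bigger (s * (J * J * Q0 * b0)%:R / del).
exists (T r0) => u uT.
have exr : exists r, (T r <= u)%N by exists r0.
have bnd r : (T r <= u)%N -> (r <= u)%N.
  by apply: leq_trans; exact: T_ge.
(* The last choice visible by time [u]: then [u < T r.+1], which [T_le] compares with [B r.+1], the
   time carrying the first [r.+1] choices. *)
exists (ex_maxn exr bnd); case: ex_maxnP => r Tr rmax; split => //.
apply: le_trans (prod_q r.+1); rewrite ler_expR.
have uT' : (u < T r.+1)%N by rewrite ltnNge; apply/negP => /rmax; rewrite ltnn.
have rr : (r0 <= r.+1)%N by apply: leqW; exact: rmax.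
rewrite -(ler_pM2r JJ).
have h1 : u%:R * (J * J)%:R <= ((J + 1) * (J + 3))%:R * (B r.+1)%:R + (J * J * Q0 * b0)%:R :> R.
  rewrite -!natrM -natrD ler_nat; apply: leq_trans (T_le r.+1).
  by rewrite mulnC leq_mul2l (ltnW uT') orbT.
have h2 : s * (J * J * Q0 * b0)%:R <= del * (B r.+1)%:R.
  rewrite -ler_pdivrMl// [leLHS]mulrC.
  by rewrite (le_trans hr0)// ler_nat (leq_trans rr)// B_ge.
have h3 : s * (u%:R * (J * J)%:R) <= s * (((J + 1) * (J + 3))%:R * (B r.+1)%:R + (J * J * Q0 * b0)%:R).
  by rewrite ler_wpM2l.
move: h2 h3; rewrite /del.
move: (J * J * Q0 * b0)%:R ((J + 1) * (J + 3))%:R (J * J)%:R (B r.+1)%:R u%:R => a1 a2 a3 a4 a5.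
by lra.
Qed.

End TreeScheme.

(** * The dichotomy *)

Section Positivity.
Context {R : realType} {X : Type} (d : X -> X -> R) (f : X -> X).

Lemma hP_ge0 Y : (0 <= hP d f Y)%E.
Proof.
apply: le_ereal_sup_tmp; exists (ereal_inf [set s%:E | s in [set s : R | 0 <= s /\ packPP d f Y s 1 = 0%E]]).
  by exists 1 => //=.
by apply: le_ereal_inf_tmp => _ [s [s0 _] <-]; rewrite lee_fin.
Qed.

Lemma hB_ge0 Y : (0 <= hB d f Y)%E.
Proof.
apply: le_ereal_sup_tmp; exists (ereal_inf [set t%:E | t in [set t : R | 0 <= t /\ bowenC_lim d f Y t 1 = 0%E]]).
  by exists 1 => //=.
by apply: le_ereal_inf_tmp => _ [s [s0 _] <-]; rewrite lee_fin.
Qed.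

End Positivity.

Section Dichotomy.
Context {R : realType} {dsp : measure_display} {X : measurableType dsp}.
Context (d : X -> X -> R) (dm : is_metric d) (cX : dcompact d [set: X]).
Context (hm : (@measurable dsp X) = <<s dopen d >>).
Context (f : X -> X) (cf : dcontinuous d f).
Context {m : nat} (A : X -> 'M[R]_m) (C0 C alpha lam : R) (C0_ge0 : 0 <= C0).
Context (m0 : (0 < m)%N) (Au : forall x, A x \in unitmx)
  (hA : forall x, opnorm (A x) <= expR C0) (hA' : forall x, expands (expR C0) (A x)).
Context (C_ge0 : 0 <= C) (alpha0 : 0 < alpha)
  (lam0 : 0 < lam) (hol : forall x y, opnorm (A x - A y) <= C * d x y `^ alpha).
Context (glue : forall tau : R, 0 < tau -> exists2 N, (0 < N)%N &
  forall (x : nat -> X) (n : nat -> nat), (forall i, (0 < n i)%N) ->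
  exists z, forall i j, (j < n i)%N ->
    d (iter (seg_start N n i + j) f z) (iter j f (x i))
      < tau * expR (- lam * (minn j (n i - j))%:R)).

Let chi := chiR f m0 Au hA hA'.

Context (mu nu : probability X R) (erg : ergodic f mu) (inu : Defs.invariant f nu)
  (gap : Ex nu chi < Ex mu chi).

Lemma MLI_full_entropy (t' : R) : 0 <= t' -> (t'%:E < htop d f [set: X])%E ->
  (t'%:E <= htop d f (MLI A f))%E /\ (t'%:E <= hP d f (MLI A f))%E.
Proof.
move=> t'0 /ereal_lt_real[t t't /ereal_sup_gt[_ [E [_ _] <-] tE]].
have t0 : 0 <= t by lra.
(* One [kap] for each of the two growth estimates, two for the elapsed times, and one to make the
   inequality strict. *)
pose kap := (Ex mu chi - Ex nu chi) / 5.
have kap0 : 0 < kap by rewrite /kap; move: gap; lra.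
have [w [w0 [tau1 tau10 low]]] := low_segments dm hm cf C0_ge0 m0 Au hA hA' C_ge0 alpha0 lam0 hol inu kap0.
have [x0 _] := low 0%N.
have [e0 e00 sep] := htop_cpt_lt x0 t0 tE.
have [W [_ W0 good]] := good_set dm hm cf C0_ge0 m0 Au hA hA' C_ge0 alpha0 lam0 hol 0%N erg kap0.
pose tau := Num.min 1 (Num.min tau1 (e0 / 4)).
have tau0 : 0 < tau by rewrite !lt_min ltr01 tau10/=; lra.
have tle1 : tau <= 1 by rewrite ge_min lexx.
have tle2 : tau <= tau1 by rewrite !ge_min lexx orbT.
have tle3 : tau <= e0 / 4 by rewrite !ge_min lexx !orbT.
have [N _ glueN] := glue tau0.
have [w0' good'] := good (1 / 2) ltac:(lra).
have [y hy] := choice low.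
have data (ic : nat * nat) : exists D : nat * nat * (nat -> X), let: (l, q, s) := D in
  [/\ (ic.1.+1 * ic.2.+1 <= l)%N, (0 < q)%N &
   [/\ (ic.1 %% 3)%N = 0%N -> dn_separated d f l q e0 [set: X] s /\ expR (t * l%:R) <= q%:R,
     (ic.1 %% 3)%N = 1%N -> low_seg d f A tau1 (Ex nu chi + kap) l q s &
     (ic.1 %% 3)%N = 2%N -> up_seg d f A lam (Ex mu chi - kap) l q s]].
  case: ic => i c /=; set l0 := (_ * _)%N.
  have [i3|i3|i3] : [\/ i %% 3 = 0, i %% 3 = 1 | i %% 3 = 2]%N.
  - by have := ltn_pmod i (isT : 0 < 3)%N; case: (i %% 3)%N => [|[|[|]]] // _; constructor.
  - have [l [q [p [ll [_ hs] hq]]]] := sep l0; exists (l, q, p).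
    rewrite i3; split => //; first by rewrite -(ltr0n R); apply: lt_le_trans hq; exact: expR_gt0.
  - exists ((l0 * w)%N, 1%N, fun=> y l0); split => //; first by rewrite leq_pmulr.
    by rewrite i3; split => // _ a p _ hp; exact: hy.
  have [G [mG pG hG]] := good' (maxn w0' l0) (leq_maxl _ _).
  have [x Gx] : exists x, G x.
    apply: contrapT => nG; have : prob mu (~` G) = 1.
      by rewrite (_ : ~` G = setT) ?probT//; apply/seteqP; split => // x _ Gx; apply: nG; exists x.
    by move=> p1; move: pG; rewrite p1; lra.
  exists ((W * maxn w0' l0)%N, 1%N, fun=> x); split => //.
    by apply: leq_trans (leq_maxr w0' l0) _; rewrite leq_pmull.
  by rewrite i3; split => // _ a p _ hp; case: (hG x p Gx hp).
have [DD hDD] := choice data.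
pose D i c := DD (i, c).
have PD i c := hDD (i, c).
have hr : Ex nu chi + kap + 2 * kap < Ex mu chi - kap by move: kap0; rewrite /kap; lra.
split.
  exact: (full_htop (D := D) dm cX cf m0 Au hA hA' lam0 tau0 glueN kap0 e00 tle1 tle2 tle3 hr PD).
exact: (full_hP (D := D) dm cX cf m0 Au hA hA' lam0 tau0 glueN kap0 e00 tle1 tle2 tle3 hr PD).
Qed.

Lemma MLI_bowen_entropy : (h_mu f mu <= hB d f (MLI A f))%E.
Proof.
apply: lee_real_dense => [|s s0 /ereal_lt_real[h sh hmu]]; first exact: hB_ge0.
have h0 : 0 <= h by lra.
(* Low segments of tolerance [2 * kap] then grow at rate at most [Ex nu chi + 2 * kap = Ex mu chi -
   2 * kap]. *)
pose kap := (Ex mu chi - Ex nu chi) / 4.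
have kap0 : 0 < kap by rewrite /kap; move: gap; lra.
have kap20 : 0 < 2 * kap by lra.
have [w [w0 [tau1 tau10 low]]] := low_segments dm hm cf C0_ge0 m0 Au hA hA' C_ge0 alpha0 lam0 hol inu kap20.
have [yy hyy] := choice low.
(* Chosen for [s * (J + 1) * (J + 3) < h * J ^ 2]: the left side is at most [s * J ^ 2 + 7 * s * J],
   and [7 * s < (h - s) * J]. *)
have [J [J0 hJ]] := bigger (7 * s / (h - s) + 1).
have Jr : 1 <= J%:R :> R by rewrite ler1n.
pose eps := kap / (16 * J%:R).
have eps0 : 0 < eps by rewrite divr_gt0//; lra.
pose Z := C0 + `|Ex mu chi| + kap + 1.
have Z0 : 0 < Z by rewrite /Z; have := normr_ge0 (Ex mu chi); move: C0_ge0; lra.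
pose mu' := kap / (16 * J%:R * Z).
have mu'0 : 0 < mu' by rewrite divr_gt0// mulr_gt0//; lra.
have [M0 [_ hM0]] := bigger (J%:R / mu').
have [M [b0 [Q1 [MM M0' b00 [e0 e00 tree]]]]] :=
  entropy_up dm cX hm cf C0_ge0 m0 Au hA hA' C_ge0 alpha0 lam0 hol (M0 + J) erg h0 hmu eps0.
pose tau := Num.min 1 (Num.min tau1 (e0 / 4)).
have tau0 : 0 < tau by rewrite !lt_min ltr01 tau10/=; lra.
have tle1 : tau <= 1 by rewrite ge_min lexx.
have tle2 : tau <= tau1 by rewrite !ge_min lexx orbT.
have tle3 : tau <= e0 / 4 by rewrite !ge_min lexx !orbT.
have [N _ glueN] := glue tau0.
have [Q2 [_ hQ2]] := bigger (N%:R / mu').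
pose Q0 := (Q1 + Q2 + J * (3 * N + w)).+1.
have tree' Q : exists ql : nat * ((nat -> nat) -> X), (Q0 <= Q)%N -> 
  expR (h * (Q * b0)%:R) <= ql.1%:R /\
  forall v, (forall i, (i < M)%N -> v i < ql.1)%N ->
    (forall p, (forall j, (j < M * (Q * b0))%N -> d (iter j f p) (iter j f (ql.2 v)) <=
        expR (- lam * (minn j (M * (Q * b0) - j))%:R)) ->
      (Ex mu chi - eps) * (M * (Q * b0))%:R <= lnorm f A (M * (Q * b0)) p /\
      lnorm f A (M * (Q * b0)) p <= (Ex mu chi + eps) * (M * (Q * b0))%:R) /\
    forall v', (forall i, (i < M)%N -> v' i < ql.1)%N -> forall i, (i < M)%N ->
      (forall l, (l < i)%N -> v l = v' l) -> v i != v' i ->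
      exists2 j, (j < Q * b0)%N & e0 <= d (iter (i * (Q * b0) + j) f (ql.2 v))
                                          (iter (i * (Q * b0) + j) f (ql.2 v')).
  have [QQ|QQ] := leqP Q0 Q; last by exists (0%N, fun=> yy 0%N).
  have [|qq [leaf H]] := tree Q; first by apply: leq_trans QQ; rewrite /Q0 -addnA -addnS leq_addr.
  by exists (qq, leaf).
have [ql hql] := choice tree'.
apply: (tree_hB (qq := fun Q => (ql Q).1) (leaf := fun Q => (ql Q).2) (yy := yy) (Q0 := Q0)
  (chi := Ex mu chi) (h := h) (mu' := mu') dm cX cf C0_ge0 m0 Au hA hA' lam0 tau0 glueN M0' J0 b00
  w0 _ _ _ kap0 e00 _ _ _ tle1 tle2 tle3) => //.
- exact: leq_trans (leq_addl _ _) MM.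
- by rewrite /Q0 ltnW// ltnS leq_addl.
- by rewrite -ler_pdivrMl// mulrC (le_trans hM0)// ler_nat (leq_trans (leq_addr _ _) MM).
- rewrite -ler_pdivrMl// mulrC (le_trans hQ2)// ler_nat /Q0 -addnS -addnA.
  exact: leq_trans (leq_addr _ _) (leq_addl _ _).
- by move=> Q /hql[].
- by move=> Q v /hql[_ H] /H[].
- by move=> Q v v' /hql[_ H] /H[_ H2] /H2.
- move=> Q p /hyy; congr (_ <= _ * _); rewrite /kap; lra.
have : 7 * s < (h - s) * J%:R.
  rewrite -ltr_pdivrMl ?subr_gt0// mulrC (lt_le_trans _ hJ)//; lra.
rewrite !natrM !natrD => h1.
have : 0 <= s * (J%:R - 1) by rewrite mulr_ge0// subr_ge0.
have : 7 * s * J%:R < (h - s) * J%:R * J%:R by rewrite ltr_pM2r//; lra.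
lra.
Qed.

End Dichotomy.

Theorem mainTheorem3 (R : realType) (dsp : measure_display) (X : measurableType dsp)
  (d : X -> X -> R) (f g : X -> X) (m : nat) (A : X -> 'M[R]_m) :
  is_metric d ->
  dcompact d setT ->
  (@measurable dsp X) = <<s dopen d >> ->
  homeo d f g ->
  top_mixing d f ->
  exp_shadowing d f g ->
  (0 < m)%N ->
  (forall x, A x \in unitmx) ->
  holder d A ->
  (forall mu nu : probability X R, ergodic f mu -> ergodic f nu ->
     chi_mu A f mu = chi_mu A f nu)
  \/
  (htop d f (MLI A f) = htop d f setT /\
   hP d f (MLI A f) = htop d f setT /\
   (ereal_sup [set h_mu f mu | mu in
       [set mu : probability X R | ergodic f mu /\ ~ lyap_minimizing A f mu]]
      <= hB d f (MLI A f))%E).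
Proof.
move=> dm cX hm fg mix [lam lam0 sh] m0 Au hol.
have cf : dcontinuous d f by case: fg.
have [C [alpha [C_ge0 alpha0 holC]]] := holder_nonneg hol.
have [C0 [C0_ge0 hA hA']] := cocycle_bounds dm cX C_ge0 alpha0 holC Au.
have glue := gluing dm cX fg mix sh.
have mf : measurable_fun [set: X] f := dcontinuous_measurable hm cf.
have mL n : measurable_fun [set: X] (lnorm f A n).
  have -> : lnorm f A n = fun x => ln (opnorm (cocycle A f n x)).
    by apply/funext => x; rewrite lnormE.
  exact: (lnorm_measurable dm hm C0_ge0 hA C_ge0 alpha0 holC cf).
pose chi := chiR f m0 Au hA hA'.
have chiE (mu : probability X R) : chi_mu A f mu = (Ex mu chi)%:E := chi_muE m0 Au hA hA' mL mu.
have [same|differ] := pselect (forall mu nu : probability X R, ergodic f mu -> ergodic f nu ->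
     chi_mu A f mu = chi_mu A f nu); [by left|right].
have [mu [nu [erg inu gap]]] : exists mu nu : probability X R,
    [/\ ergodic f mu, Defs.invariant f nu & Ex nu chi < Ex mu chi].
  apply: contrapT => H; apply: differ => mu nu emu enu; rewrite !chiE; congr _%:E.
  apply/eqP; rewrite eq_le !leNgt; apply/andP; split; apply/negP => lt.
    by apply: H; exists mu, nu; split => //; exact: enu.1.
  by apply: H; exists nu, mu; split => //; exact: emu.1.
have full := @MLI_full_entropy _ _ _ d dm cX hm f cf _ A C0 C alpha lam C0_ge0 m0 Au hA hA'
  C_ge0 alpha0 lam0 holC glue mu nu erg inu gap.
split; last split.
- apply/eqP; rewrite eq_le htop_mono//=.
  apply: lee_real_dense => [|t t0 ht]; first exact: htop_ge0.
  exact: (full t t0 ht).1.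
- apply/eqP; rewrite eq_le; apply/andP; split.
    apply: lee_real_dense => [|t t0 ht]; first exact: htop_ge0.
    rewrite leNgt; apply/negP => hlt; move: ht; rewrite ltNge => /negP; apply.
    apply: (hP_le dm _ t0); apply: le_lt_trans hlt; exact: (htop_cpt_le_htop f _ cX).
  apply: lee_real_dense => [|t t0 ht]; first exact: hP_ge0.
  exact: (full t t0 ht).2.
- apply: ge_ereal_sup => _ [mu' [emu' nmin] <-].
  have [nu' inu' gap'] : exists2 nu' : probability X R, Defs.invariant f nu' &
      Ex nu' chi < Ex mu' chi.
    apply: contrapT => H; apply: nmin; split => //; apply/eqP; rewrite eq_le; apply/andP; split.
      apply: le_ereal_inf_tmp => _ [nu' inu' <-]; rewrite !chiE lee_fin leNgt; apply/negP => lt.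
      by apply: H; exists nu'.
    by apply: ereal_inf_lbound; exists mu' => //; exact: emu'.1.
  exact: (MLI_bowen_entropy dm cX hm cf C0_ge0 C_ge0 alpha0 lam0 holC glue emu' inu' gap').
Qed.
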